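(* Let $\mathcal{M}$ be an $n$-dimensional smooth oriented manifold and $\overline{\varphi}=(\overline{\varphi}_o,v):\mathcal{M}\to\mathcal{Q}$ a smooth map such that $\overline{\varphi}_o$ is an immersion and there exists a bundle isomorphism $\Phi:T\mathcal{M}\to E_T$ with $$d\overline{\varphi}_o(X)(\Phi(Y))=d\overline{\varphi}_o(Y)(\Phi(X))\qquad\forall X,Y\in T_x\mathcal{M},\ x\in\mathcal{M}.$$ If the bundle $(E_N,\nabla^N)$ is flat, then there locally exists a Riemannian foliation of $\mathbb{R}^m$ whose leaves are integral submanifolds of $\overline{\varphi}:\mathcal{M}\to\mathcal{Q}$ if and only if $\overline{\varphi}$ is Lagrangian, i.e. satisfies $$\overline{\varphi}^*\omega=0.$$
   Context: Let $m=n+k$. $\mathcal{Q}_o\subset\Lambda^n\mathbb{R}^m$ is the Grassmannian of oriented linear $n$-planes of Euclidean $\mathbb{R}^m$ (an oriented plane with positive orthonormal basis $(e_1,\dots,e_n)$ is represented by $e_1\wedge\dots\wedge e_n$). Over $\mathcal{Q}_o$ there are the tautological bundles $\tau_T=\{(p_o,v)\in\mathcal{Q}_o\times\mathbb{R}^m: v\in p_o\}$ and $\tau_N=\{(p_o,v)\in\mathcal{Q}_o\times\mathbb{R}^m: v\in p_o^\perp\}$, with their natural metrics and connections (orthogonal projections of the flat derivative of $\mathbb{R}^m$). $\mathcal{Q}$ is the Grassmannian of oriented affine $k$-planes of $\mathbb{R}^m$; each such plane is uniquely $v+p_o^\perp$ with $p_o\in\mathcal{Q}_o$, $v\in p_o$,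 so $\mathcal{Q}$ is identified with $\tau_T$, with points $p=(p_o,v)$. Let $\pi:\mathcal{Q}\to\mathcal{Q}_o$, $(p_o,v)\mapsto p_o$. $T_{p_o}\mathcal{Q}_o$ is identified with the space $L(p_o,p_o^\perp)$ of linear maps: $u$ corresponds to $\sum_{i=1}^n e_1\wedge\dots\wedge u(e_i)\wedge\dots\wedge e_n$ ($u(e_i)$ in $i$-th position). The canonical $\tau_N$-valued $1$-form on $\mathcal{Q}$ is $\alpha_p(\xi)=d\pi_p(\xi)(v)\in p_o^\perp$ for $p=(p_o,v)$, $\xi\in T_p\mathcal{Q}$; the canonical $2$-form is $\omega:=d^{\nabla^N}\alpha$, the exterior covariant derivative of $\alpha$ with respect to the connection of $\tau_N$ (pulled back to $\mathcal{Q}$ by $\pi$). For $\overline{\varphi}=(\overline{\varphi}_o,v):\mathcal{M}\to\mathcal{Q}$, with $\overline{\varphi}_o=\pi\circ\overline{\varphi}$, set $E_T=\overline{\varphi}_o^*\tau_T$, $E_N=\overline{\varphi}_o^*\tau_N$, so $E_T\oplus E_N=\mathcal{M}\times\mathbb{R}^m$ (orthogonal). $E_N$ has the connection $\nabla^N_X\xi=(d\xi(X))^N$, the superscript $N$ denoting the $E_N$-component. The differential $d\overline{\varphi}_o$ is regarded as a map $T\mathcal{M}\to L(E_T,E_N)$. An integral submanifold of $\overline{\varphi}$ is an $n$-dimensional submanifold of $\mathbb{R}^m$, image of a (local) immersion $\varphi$ of $\mathcal{M}$, which crosses orthogonally the affine $k$-planes of $\overline{\varphi}$: $\overline{\varphi}(x)=\varphi(x)+(d\varphi_x(T_x\mathcal{M}))^\perp$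 for all $x$. ''Locally'' means on a neighborhood of each point of $\mathcal{M}$ (the foliation being of an open subset of $\mathbb{R}^m$); a local Riemannian foliation is one whose leaves are the fibres of a Riemannian submersion onto an open subset of $\mathbb{R}^k$. *)

(* Defs.v *)
From HB Require Import structures.
From mathcomp Require Import all_boot all_order all_algebra.
From mathcomp Require Import all_classical all_reals all_analysis.
Import Order.TTheory GRing.Theory Num.Theory.
Import numFieldNormedType.Exports.

Set Implicit Arguments.
Unset Strict Implicit.
Unset Printing Implicit Defensive.

Local Open Scope classical_set_scope.
Local Open Scope ring_scope.

(** Conventions.  Vectors are row vectors and a linear map [u] acts on the right,
    [x |-> x *m u].  The norm of ['rV_n] is used only for its topology; the
    Euclidean structure is [dot].  The total functions ['d] and [get] are only
    used where the object they describe exists; for [frame] and for the local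
    parametrization in [omega] it is not unique, but [plane], [projT],
    [tangent_of_hom] and [omega] do not depend on the choice. *)

(** * Smooth maps *)

Fixpoint iter_derive (R : realType) (V W : normedModType R) (s : seq V)
    (f : V -> W) : V -> W :=
  if s is v :: s' then fun x => 'D_v (iter_derive s' f) x else f.

(** [C^oo] on an open set [D]: all iterated directional derivatives (including
    [f] itself) are Frechet differentiable at each point of [D]. *)
Definition smooth_on (R : realType) (V W : normedModType R) (D : set V)
    (f : V -> W) : Prop :=
  forall (s : seq V) (x : V), D x -> differentiable (iter_derive s f) x.

(** * Oriented manifolds *)

Record chart (R : realType) (n : nat) (M : Type) := Chart {
  cdom : set M;
  cmap : M -> 'rV[R]_n;
  cinv : 'rV[R]_n -> M }.

Definition chart_axiom (R : realType) (n : nat) (M : topologicalType)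
    (c : chart R n M) : Prop :=
  [/\ open (cdom c), open (cmap c @` cdom c),
      {in cdom c, cancel (cmap c) (cinv c)},
      (forall x, cdom c x -> {for x, continuous (cmap c)}) &
      (forall y, (cmap c @` cdom c) y -> {for y, continuous (cinv c)})].

(** An orientation is given by an atlas whose transition maps have positive
    Jacobian determinant.  The tangent space at [x] is ['rV_n], a vector being
    identified with its coordinates in the preferred chart [chart_at x]. *)
Record oriented_manifold (R : realType) (n : nat) := OrientedManifold {
  mfd_space :> topologicalType;
  mfd_hausdorff : hausdorff_space mfd_space;
  mfd_countable : @second_countable mfd_space;
  atlas : set (chart R n mfd_space);
  chart_at : mfd_space -> chart R n mfd_space;
  atlas_chart : forall c, atlas c -> chart_axiom c;
  chart_at_atlas : forall x, atlas (chart_at x);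
  chart_at_dom : forall x, cdom (chart_at x) x;
  atlas_smooth : forall c c', atlas c -> atlas c' ->
    smooth_on (cmap c @` (cdom c `&` cdom c')) (cmap c' \o cinv c);
  atlas_oriented : forall c c', atlas c -> atlas c' ->
    forall x, (cdom c `&` cdom c') x ->
    0 < \det (jacobian (cmap c' \o cinv c) (cmap c x)) }.

Definition msmooth_on (R : realType) (n : nat) (M : oriented_manifold R n)
    (W : normedModType R) (U : set M) (f : M -> W) : Prop :=
  forall c, atlas c -> smooth_on (cmap c @` (U `&` cdom c)) (f \o cinv c).

Definition mdiff (R : realType) (n : nat) (M : oriented_manifold R n)
    (W : normedModType R) (f : M -> W) (x : M) (X : 'rV[R]_n) : W :=
  'd (f \o cinv (chart_at x)) (cmap (chart_at x) x) X.

(** The tangent vector at [x] whose coordinates in the chart [c] are [a]. *)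
Definition coord_vec (R : realType) (n : nat) (M : oriented_manifold R n)
    (c : chart R n M) (a : 'rV[R]_n) (x : M) : 'rV[R]_n :=
  'd (cmap (chart_at x) \o cinv c) (cmap c x) a.

Definition immersion_on (R : realType) (n : nat) (M : oriented_manifold R n)
    (W : normedModType R) (U : set M) (f : M -> W) : Prop :=
  msmooth_on U f /\ forall x, U x -> injective (mdiff f x).

(** [sigma] parametrizes the open part [S `&` W] of [S] by the open set [D], and
    its inverse is the restriction of an ambient smooth map [kappa]. *)
Definition submanifold_chart (R : realType) (E : normedModType R) (d : nat)
    (S W : set E) (D : set 'rV[R]_d) (sigma : 'rV[R]_d -> E)
    (kappa : E -> 'rV[R]_d) : Prop :=
  [/\ open W /\ open D, smooth_on D sigma, smooth_on W kappa,
      sigma @` D = S `&` W & forall y, D y -> kappa (sigma y) = y].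

Definition submanifold (R : realType) (E : normedModType R) (d : nat)
    (S : set E) : Prop :=
  forall p, S p -> exists W D sigma kappa,
    W p /\ @submanifold_chart R E d S W D sigma kappa.

(** * Grassmannians *)

Definition dot (R : realType) (m : nat) (u v : 'rV[R]_m) : R :=
  (u *m v^T) 0 0.

Definition multi_index (n m : nat) : finType :=
  {J : {ffun 'I_n -> 'I_m} |
     [forall i : 'I_n, forall j : 'I_n, (i < j)%N ==> (J i < J j)%N]}.

(** [Lambda^n R^m], in the basis of the [e_J], [J] an increasing multi-index. *)
Definition ext (R : realType) (n m : nat) := 'rV[R]_#|multi_index n m|.

(** [e_1 /\ ... /\ e_n] for the rows [e_i] of [e]: the coordinate on [e_J] is the
    minor on the columns [J]. *)
Definition wedge (R : realType) (n m : nat) (e : 'M[R]_(n, m)) : ext R n m :=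
  \row_l \det (colsub (val (enum_val l : multi_index n m)) e).

(** Positive orthonormal bases of the oriented plane represented by [p]. *)
Definition frames (R : realType) (n m : nat) (p : ext R n m) : set 'M[R]_(n, m) :=
  [set e | e *m e^T = 1%:M /\ p = wedge e].

Definition Qo (R : realType) (n m : nat) : set (ext R n m) :=
  [set p | frames p !=set0].

Definition frame (R : realType) (n m : nat) (p : ext R n m) : 'M[R]_(n, m) :=
  get (frames p).

Definition plane (R : realType) (n m : nat) (p : ext R n m) : set 'rV[R]_m :=
  [set u | (u <= frame p)%MS].

Definition orth (R : realType) (m : nat) (A : set 'rV[R]_m) : set 'rV[R]_m :=
  [set w | forall u, A u -> dot u w = 0].

Definition projT (R : realType) (n m : nat) (p : ext R n m) : 'M[R]_m :=
  (frame p)^T *m frame p.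

Definition projN (R : realType) (n m : nat) (p : ext R n m) : 'M[R]_m :=
  1%:M - projT p.

(** [L(p, p^perp)]: endomorphisms of [R^m] vanishing on [p^perp] and with values
    in [p^perp]. *)
Definition homTN (R : realType) (n m : nat) (p : ext R n m) : set 'M[R]_m :=
  [set u | u = projT p *m u *m projN p].

(** The tangent vector [\sum_i e_1 /\ ... /\ u(e_i) /\ ... /\ e_n] of [Qo]. *)
Definition tangent_of_hom (R : realType) (n m : nat) (p : ext R n m)
    (u : 'M[R]_m) : ext R n m :=
  \sum_(i < n) wedge (\matrix_(j < n)
     (if j == i then row j (frame p) *m u else row j (frame p))).

Definition hom_of_tangent (R : realType) (n m : nat) (p : ext R n m)
    (zeta : ext R n m) : 'M[R]_m :=
  get [set u | homTN p u /\ tangent_of_hom p u = zeta].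

(** The ambient space of the affine Grassmannian; [(p, v)] stands for the affine
    plane [v + p^perp]. *)
Definition affext (R : realType) (n m : nat) : normedModType R :=
  (ext R n m * 'rV[R]_m)%type.

Definition Qaff (R : realType) (n m : nat) : set (affext R n m) :=
  [set p | Qo p.1 /\ plane p.1 p.2].

Definition affine_plane (R : realType) (n m : nat) (p : affext R n m) :
    set 'rV[R]_m :=
  [set p.2 + w | w in orth (plane p.1)].

Definition bpi (R : realType) (n m : nat) (p : affext R n m) : ext R n m := p.1.

(** * Connections and the canonical forms *)

Definition lie (R : realType) (V : normedModType R) (X Y : V -> V) (y : V) : V :=
  'd Y y (X y) - 'd X y (Y y).

(** Covariant derivative, along the vector field [X], of a section [s] of the
    bundle of the images of the projections [P y]. *)
Definition nabla (R : realType) (V : normedModType R) (m : nat)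
    (P : V -> 'M[R]_m) (X : V -> V) (s : V -> 'rV[R]_m) (y : V) : 'rV[R]_m :=
  'd s y (X y) *m P y.

Definition curvature (R : realType) (V : normedModType R) (m : nat)
    (P : V -> 'M[R]_m) (X Y : V -> V) (s : V -> 'rV[R]_m) (y : V) : 'rV[R]_m :=
  nabla P X (nabla P Y s) y - nabla P Y (nabla P X s) y - nabla P (lie X Y) s y.

(** [(d^nabla beta)(X, Y)] for a bundle-valued 1-form [beta]. *)
Definition dnabla (R : realType) (V : normedModType R) (m : nat)
    (P : V -> 'M[R]_m) (beta : V -> V -> 'rV[R]_m) (X Y : V -> V) (y : V) :
    'rV[R]_m :=
  nabla P X (fun z => beta z (Y z)) y - nabla P Y (fun z => beta z (X z)) y
  - beta y (lie X Y y).

Definition alpha (R : realType) (n m : nat) (p xi : affext R n m) : 'rV[R]_m :=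
  p.2 *m hom_of_tangent (bpi p) ('d (@bpi R n m) p xi).

(** [omega = d^nabla alpha] at [p] on [xi, eta], computed in a local
    parametrization [sigma] of the affine Grassmannian (of dimension
    [n * k + n]) with the coordinate vector fields [a, b] extending [xi, eta]. *)
Definition omega (R : realType) (n k : nat) (p xi eta : affext R n (n + k)) :
    'rV[R]_(n + k) :=
  get [set w | exists W D (sigma : 'rV[R]_(n * k + n) -> affext R n (n + k)) kappa,
    [/\ submanifold_chart (@Qaff R n (n + k)) W D sigma kappa, W p &
     exists a b, [/\ 'd sigma (kappa p) a = xi, 'd sigma (kappa p) b = eta &
       w = dnabla (fun y => projN (bpi (sigma y)))
                  (fun y c => alpha (sigma y) ('d sigma y c))
                  (cst a) (cst b) (kappa p)]]].

(** * Maps into the affine Grassmannian *)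

(** The bundle [(E_N, nabla^N)] over [M] has zero curvature. *)
Definition flat_EN (R : realType) (n m : nat) (M : oriented_manifold R n)
    (phio : M -> ext R n m) : Prop :=
  forall (c : chart R n M) (D : set 'rV[R]_n)
         (X Y : 'rV[R]_n -> 'rV[R]_n) (s : 'rV[R]_n -> 'rV[R]_m),
    atlas c -> open D -> D `<=` cmap c @` cdom c ->
    smooth_on D X -> smooth_on D Y -> smooth_on D s ->
    (forall y, D y -> orth (plane (phio (cinv c y))) (s y)) ->
    forall y, D y -> curvature (fun z => projN (phio (cinv c z))) X Y s y = 0.

(** Smooth bundle isomorphisms from [TM] to [E_T], [Phi x] being the matrix of
    the map on the fibre over [x]. *)
Definition bundle_iso (R : realType) (n m : nat) (M : oriented_manifold R n)
    (phio : M -> ext R n m) (Phi : M -> 'M[R]_(n, m)) : Prop :=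
  (forall x, set_bij setT (plane (phio x)) (fun X : 'rV[R]_n => X *m Phi x)) /\
  (forall (c : chart R n M) (a : 'rV[R]_n), atlas c ->
     msmooth_on (cdom c) (fun x => coord_vec c a x *m Phi x)).

Definition lagrangian (R : realType) (n k : nat) (M : oriented_manifold R n)
    (phi : M -> affext R n (n + k)) : Prop :=
  forall x X Y, omega (phi x) (mdiff phi x X) (mdiff phi x Y) = 0.

(** [S] is an integral submanifold over the open set [U]; the equality of affine
    planes does not take orientations into account. *)
Definition integral_submanifold (R : realType) (n m : nat)
    (M : oriented_manifold R n) (phi : M -> affext R n m) (U : set M)
    (S : set 'rV[R]_m) : Prop :=
  submanifold n S /\
  exists f : M -> 'rV[R]_m,
    [/\ immersion_on U f, f @` U = S &
        forall x, U x ->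
          affine_plane (phi x) = [set f x + w | w in orth (range (mdiff f x))]].

Definition riemannian_submersion (R : realType) (m k : nat)
    (O : set 'rV[R]_m) (f : 'rV[R]_m -> 'rV[R]_k) : Prop :=
  smooth_on O f /\ forall y, O y ->
    range ('d f y) = setT /\
    {in orth [set u | 'd f y u = 0] &, forall u w,
       dot ('d f y u) ('d f y w) = dot u w}.

(** Around each point of [M] there is a Riemannian foliation of a nonempty open
    set, given by the fibres of a Riemannian submersion, whose leaves are integral
    submanifolds of [phi]. *)
Definition locally_foliated (R : realType) (n k : nat) (M : oriented_manifold R n)
    (phi : M -> affext R n (n + k)) : Prop :=
  forall x0 : M, exists (U : set M) (O : set 'rV[R]_(n + k))
      (f : 'rV[R]_(n + k) -> 'rV[R]_k),
    [/\ open U /\ U x0, open O /\ O !=set0,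
        riemannian_submersion O f, open (f @` O) &
        forall c, (f @` O) c -> integral_submanifold phi U (O `&` f @^-1` [set c])].

(* Main.v *)
(** In a chart write [phi = (phi_o, v)] and let [P] be the projection onto [E_N].
    The canonical 2-form pulls back to [(D_b v D_a P - D_a v D_b P) P], and [E_N] is
    flat iff [(D_b P D_a P - D_a P D_b P) P = 0].

    A leaf is [f = v + s] with [s] a section of [E_N] and [(D_a f) P = 0].
    Differentiating the last equation, [D_b f D_a P] is symmetric in [a, b]; since
    the curvature vanishes on [s], so does the 2-form.

    Conversely, flatness and the vanishing of the 2-form are the integrability
    conditions of the linear system [(D_a xi) P = 0], [(D_a g) P = 0] with [xi] and
    [g - v] in [E_N].  Its solutions give a parallel orthonormal frame [xi] of [E_N]
    and leaves [g + t xi] for every constant [t].  By the symmetry of [Phi] and the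
    Ricci equation the shape operators in the directions [xi_j] are commuting
    symmetric matrices up to a common factor, and their common kernel is trivial
    because [phi_o] is an immersion; so [(y, t) |-> g y + t xi y] is a local
    diffeomorphism near some [t], and its [t]-component is a Riemannian
    submersion because [xi] is orthonormal. *)

Require Import Defs.
From HB Require Import structures.
From mathcomp Require Import all_boot all_order all_algebra.
From mathcomp Require Import fingroup perm.
From mathcomp Require Import all_classical all_reals all_analysis.
From mathcomp Require Import ring lra.
Import Order.TTheory GRing.Theory Num.Theory.
Import numFieldNormedType.Exports.
Local Open Scope classical_set_scope.
Local Open Scope ring_scope.

Set Implicit Arguments.
Unset Strict Implicit.
Unset Printing Implicit Defensive.


(** * Rules of differential calculus for maps between normed spaces and for matrices *)

Section Derivatives.
Context {R : realType} {V : normedModType R}.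

(** The linear system is solved without differential equations or integrals. Transport along a
    segment is the limit of products of a second order approximation over dyadic subdivisions, and
    flatness makes transport around triangles trivial; mean value estimates and completeness
    suffice. Placing [v] as one more row under a moving frame of [E_N] turns the homogeneous system
    for [xi] and the affine one for [g] into a single linear connection of rank [k + 1].

    A second obstacle is that [frame], [hom_of_tangent] and [omega] are choices. Nothing makes
    [frame p] continuous in [p], so the smoothness of [projT] goes through a basis of the plane
    computed rationally from its Pluecker coordinates. For [omega], a parametrization of the affine
    Grassmannian must be exhibited, and all parametrizations must give the same value.

    That a generic combination of the shape operators is invertible follows from perturbing
    determinants, in place of simultaneous diagonalization. *)

Lemma differentiable_sumf (W : normedModType R) (I : Type) (s : seq I)
    (f : I -> V -> W) x :
  (forall i, differentiable (f i) x) ->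
  differentiable (fun y => \sum_(i <- s) f i y) x.
Proof.
move=> df; elim: s => [|i s IH].
  by under eq_fun do rewrite big_nil; exact: differentiable_cst.
under eq_fun do rewrite big_cons.
exact: (differentiableD (df i) IH).
Qed.

Lemma derive_sumf (W : normedModType R) (I : Type) (s : seq I)
    (f : I -> V -> W) x v :
  (forall i, differentiable (f i) x) ->
  'D_v (fun y => \sum_(i <- s) f i y) x = \sum_(i <- s) 'D_v (f i) x.
Proof.
move=> df; elim: s => [|i s IH].
  by under eq_fun do rewrite big_nil; rewrite big_nil derive_cst.
under eq_fun do rewrite big_cons.
rewrite big_cons -IH.
apply: deriveD; apply: diff_derivable => //; exact: differentiable_sumf.
Qed.

Lemma scaler_is_bilinear (W : normedModType R) :
  bilinear_for (GRing.Scale.Law.clone _ _ *:%R _)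
    (GRing.Scale.Law.clone _ _ *:%R _) (@GRing.scale R W : R^o -> W -> W).
Proof.
split=> [u|u] a x y /=.
- by rewrite scalerDl scalerA.
- by rewrite scalerDr !scalerA mulrC.
Qed.

Lemma diff_scaler (W : normedModType R) (k : V -> R) (f : V -> W) x :
  differentiable k x -> differentiable f x ->
  differentiable (fun y => k y *: f y) x /\
  forall v, 'd (fun y => k y *: f y) x v = k x *: 'd f x v + 'd k x v *: f x.
Proof.
move=> dk df.
pose M := bilinear_isBilinear.Build R R^o W W _ _ _ (scaler_is_bilinear W).
pose B : {bilinear R^o -> W -> W} := HB.pack (@GRing.scale R W : R^o -> W -> W) M.
have cB : continuous (fun p : R^o * W => B p.1 p.2) by exact: scale_continuous.
have -> : (fun y => k y *: f y) =
  (fun p : R^o * W => B p.1 p.2) \o (fun y => (k y : R^o, f y)) by [].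
have dp : differentiable (fun y => (k y : R^o, f y)) x by exact: differentiable_pair.
have dB p : differentiable (fun p : R^o * W => B p.1 p.2) p by exact: (@differentiable_bilin _ _ _ _ B p cB).
split; first exact: differentiable_comp.
move=> v; rewrite diff_comp //=.
by rewrite diff_pair //= (@diff_bilin _ _ _ _ B _ cB).
Qed.

Lemma differentiable_scaler (W : normedModType R) (k : V -> R) (f : V -> W) x :
  differentiable k x -> differentiable f x ->
  differentiable (fun y => k y *: f y) x.
Proof. by move=> dk df; case: (diff_scaler dk df). Qed.

Lemma derive_scaler (W : normedModType R) (k : V -> R) (f : V -> W) x v :
  differentiable k x -> differentiable f x ->
  'D_v (fun y => k y *: f y) x = k x *: 'D_v f x + 'D_v k x *: f x.
Proof.
move=> dk df; have [d e] := diff_scaler dk df.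
by rewrite !deriveE.
Qed.

Lemma derive_mulf (f g : V -> R) x v :
  differentiable f x -> differentiable g x ->
  'D_v (fun y => f y * g y) x = f x * 'D_v g x + 'D_v f x * g x.
Proof. by move=> df dg; rewrite (derive_scaler (W := R)). Qed.

Lemma differentiable_mulf (f g : V -> R) x :
  differentiable f x -> differentiable g x ->
  differentiable (fun y => f y * g y) x.
Proof. by move=> df dg; exact: differentiableM. Qed.

Lemma derive_addf (W : normedModType R) (f g : V -> W) x v :
  differentiable f x -> differentiable g x ->
  'D_v (fun y => f y + g y) x = 'D_v f x + 'D_v g x.
Proof. by move=> df dg; apply: deriveD; exact: diff_derivable. Qed.

Lemma derive_oppf (W : normedModType R) (f : V -> W) x v :
  differentiable f x -> 'D_v (fun y => - f y) x = - 'D_v f x.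
Proof. by move=> df; apply: deriveN; exact: diff_derivable. Qed.

Lemma derive_subf (W : normedModType R) (f g : V -> W) x v :
  differentiable f x -> differentiable g x ->
  'D_v (fun y => f y - g y) x = 'D_v f x - 'D_v g x.
Proof. by move=> df dg; apply: deriveB; exact: diff_derivable. Qed.

Lemma derive_comp (U W : normedModType R) (f : V -> U) (g : U -> W) x v :
  differentiable f x -> differentiable g (f x) ->
  'D_v (g \o f) x = 'D_('D_v f x) g (f x).
Proof.
move=> df dg; rewrite !deriveE //; last exact: differentiable_comp.
by rewrite diff_comp.
Qed.

Lemma derive_comp_lin (U W : normedModType R) (f : V -> U) (g : {linear U -> W}) x v :
  continuous g -> differentiable f x -> 'D_v (fun y => g (f y)) x = g ('D_v f x).
Proof.
move=> cg df.
rewrite (@derive_comp U W f g) //; last exact: linear_differentiable.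
by rewrite deriveE ?diff_lin //; exact: linear_differentiable.
Qed.

Lemma derive_dirD (W : normedModType R) (f : V -> W) x a b :
  differentiable f x -> 'D_(a + b) f x = 'D_a f x + 'D_b f x.
Proof. by move=> df; rewrite !deriveE // linearD. Qed.

Lemma derive_dirZ (W : normedModType R) (f : V -> W) x c a :
  differentiable f x -> 'D_(c *: a) f x = c *: 'D_a f x.
Proof. by move=> df; rewrite !deriveE // linearZ. Qed.

Lemma derive_dir_sum (W : normedModType R) (I : Type) (s : seq I) (a : I -> V)
    (f : V -> W) x :
  differentiable f x -> 'D_(\sum_(i <- s) a i) f x = \sum_(i <- s) 'D_(a i) f x.
Proof.
by move=> df; rewrite deriveE // linear_sum; apply: eq_bigr => i _; rewrite deriveE.
Qed.

(** The first order expansion only involves values near [x]. This matters because objects defined by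
    a choice become smooth only through local expressions that agree with them near a point. *)
Lemma near_eq_differentiable (W : normedModType R) (f g : V -> W) x :
  (\near x, f x = g x) -> differentiable f x -> differentiable g x.
Proof.
move=> fg df; have [cd ed] := (diff_locallyP x f).1 df.
have fgx := nbhs_singleton fg.
have e : g \o shift x = cst (g x) + 'd f x +o_ 0 id.
  rewrite -fgx; apply/eqaddoP => _/posnumP[e].
  have /eqaddoP/(_ _ (gt0 e)) h := ed.
  near=> y.
  have -> : (g \o shift x - (cst (f x) + 'd f x)) y =
            (f \o shift x - (cst (f x) + 'd f x)) y.
    rewrite /= !fctE /=; congr (_ - _); apply/esym.
    near: y; rewrite !near_simpl (near_shift x); apply: filterS fg => z /=.
    by rewrite sub0r subrK.
  by near: y; exact: h.
have eqd : 'd g x = 'd f x :> (V -> W) by apply: diff_unique.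
apply/diff_locallyP; rewrite eqd; split=> //.
Unshelve. all: by end_near.
Qed.

Lemma near_eq_diff (W : normedModType R) (f g : V -> W) x :
  (\near x, f x = g x) -> differentiable f x -> 'd f x = 'd g x :> (V -> W).
Proof.
move=> fg df; have dg := near_eq_differentiable fg df.
by apply/funext => v; rewrite -!deriveE //; exact: near_eq_derive.
Qed.

Lemma differentiable_mxP m n (f : V -> 'M[R]_(m, n)) x :
  differentiable f x <-> forall i j, differentiable (fun y => f y i j) x.
Proof.
split=> [df i j|df].
  apply: (@differentiable_comp _ _ _ _ f (fun N : 'M[R]_(m, n) => N i j)) => //.
  exact: differentiable_coord.
have -> : f = fun y => \sum_i \sum_j f y i j *: delta_mx i j.
  by apply/funext => y; rewrite -matrix_sum_delta.
do 2!apply: differentiable_sumf => ?.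
exact: differentiable_scaler.
Qed.

Lemma derive_mxE m n (f : V -> 'M[R]_(m, n)) x v i j :
  differentiable f x -> 'D_v f x i j = 'D_v (fun y => f y i j) x.
Proof.
by move=> df; rewrite derive_mx ?mxE //; exact: diff_derivable.
Qed.

Lemma differentiable_mulmx m n p (f : V -> 'M[R]_(m, n)) (g : V -> 'M[R]_(n, p)) x :
  differentiable f x -> differentiable g x ->
  differentiable (fun y => f y *m g y) x.
Proof.
move=> /differentiable_mxP df /differentiable_mxP dg; apply/differentiable_mxP => i j.
under eq_fun do rewrite mxE.
by apply: differentiable_sumf => l; exact: differentiable_mulf.
Qed.

Lemma derive_mulmx m n p (f : V -> 'M[R]_(m, n)) (g : V -> 'M[R]_(n, p)) x v :
  differentiable f x -> differentiable g x ->
  'D_v (fun y => f y *m g y) x = 'D_v f x *m g x + f x *m 'D_v g x.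
Proof.
move=> df dg; apply/matrixP => i j.
rewrite derive_mxE; last exact: differentiable_mulmx.
under eq_fun do rewrite mxE.
have df' := (differentiable_mxP f x).1 df; have dg' := (differentiable_mxP g x).1 dg.
rewrite derive_sumf; last by move=> l; exact: differentiable_mulf.
rewrite !mxE -big_split /=; apply: eq_bigr => l _.
by rewrite derive_mulf // !derive_mxE // addrC.
Qed.

Lemma derive_mulmxl m n p (A : 'M[R]_(m, n)) (g : V -> 'M[R]_(n, p)) x v :
  differentiable g x -> 'D_v (fun y => A *m g y) x = A *m 'D_v g x.
Proof.
by move=> dg; rewrite derive_mulmx ?derive_cst ?mul0mx ?add0r //;
   exact: differentiable_cst.
Qed.

Lemma derive_mulmxr m n p (A : 'M[R]_(n, p)) (f : V -> 'M[R]_(m, n)) x v :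
  differentiable f x -> 'D_v (fun y => f y *m A) x = 'D_v f x *m A.
Proof.
by move=> df; rewrite derive_mulmx ?derive_cst ?mulmx0 ?addr0 //;
   exact: differentiable_cst.
Qed.

Lemma differentiable_trmx m n (f : V -> 'M[R]_(m, n)) x :
  differentiable f x -> differentiable (fun y => (f y)^T) x.
Proof.
move=> /differentiable_mxP df; apply/differentiable_mxP => i j.
by under eq_fun do rewrite mxE.
Qed.

Lemma derive_trmx m n (f : V -> 'M[R]_(m, n)) x v :
  differentiable f x -> 'D_v (fun y => (f y)^T) x = ('D_v f x)^T.
Proof.
move=> df; apply/matrixP => i j.
rewrite derive_mxE; last exact: differentiable_trmx.
by under eq_fun do rewrite mxE; rewrite mxE derive_mxE.
Qed.

End Derivatives.

(** * Smooth functions *)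

Section Ck.
Context {R : realType} {V : normedModType R}.

(** Stronger than the usual class: derivatives of order [k] are themselves Frechet differentiable.
    The index makes induction possible for products and composites, which [smooth_on], quantifying
    over lists of any length, does not offer. *)
Definition Ck (W : normedModType R) (k : nat) (D : set V) (f : V -> W) : Prop :=
  forall s x, (size s <= k)%N -> D x -> differentiable (iter_derive s f) x.

Lemma smooth_onP (W : normedModType R) (D : set V) (f : V -> W) :
  smooth_on D f <-> forall k, Ck k D f.
Proof.
by split=> [sf k s x _ Dx|cf s x Dx]; [exact: sf|exact: (cf (size s))].
Qed.

Lemma iter_derive_rcons (W : normedModType R) s v (f : V -> W) :
  iter_derive (rcons s v) f = iter_derive s ('D_v f).
Proof. by elim: s => //= w s ->. Qed.

Lemma Ck0 (W : normedModType R) D (f : V -> W) :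
  Ck 0 D f <-> forall x, D x -> differentiable f x.
Proof.
by split=> [cf x Dx|cf [|//] x _ Dx]; [exact: (cf [::])|exact: cf].
Qed.

(** The last entry of the list is the derivative taken first. Peeling it off leaves a statement
    about ['D_v f], to which rules of calculus and then the induction hypothesis apply. *)
Lemma CkS (W : normedModType R) k D (f : V -> W) :
  Ck k.+1 D f <-> (forall x, D x -> differentiable f x) /\
                  forall v, Ck k D ('D_v f).
Proof.
split=> [cf|[df cf] s x].
  split=> [x Dx|v s x sk Dx]; first exact: (cf [::]).
  by rewrite -iter_derive_rcons; apply: cf => //; rewrite size_rcons.
case/lastP: s => [|s v]; first by move=> _; exact: df.
by rewrite size_rcons iter_derive_rcons; exact: cf.
Qed.

Lemma Ck_differentiable (W : normedModType R) k D (f : V -> W) x :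
  Ck k D f -> D x -> differentiable f x.
Proof. by move=> cf Dx; exact: (cf [::]). Qed.

Lemma Ck_le (W : normedModType R) k l D (f : V -> W) :
  (k <= l)%N -> Ck l D f -> Ck k D f.
Proof. by move=> kl cf s x sk; apply: cf; exact: leq_trans kl. Qed.

Lemma Ck_pred (W : normedModType R) k D (f : V -> W) : Ck k.+1 D f -> Ck k D f.
Proof. exact: Ck_le. Qed.

Lemma Ck_subset (W : normedModType R) k (D E : set V) (f : V -> W) :
  E `<=` D -> Ck k D f -> Ck k E f.
Proof. by move=> ED cf s x sk /ED; exact: cf. Qed.

Lemma Ck_ext (W : normedModType R) k D (f g : V -> W) :
  open D -> (forall x, D x -> f x = g x) -> Ck k D f -> Ck k D g.
Proof.
move=> oD; elim: k f g => [|k IH] f g fg.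
  move=> /Ck0 cf; apply/Ck0 => x Dx.
  apply: (near_eq_differentiable _ (cf _ Dx)).
  by apply: filterS (open_nbhs_nbhs (conj oD Dx)) => y; exact: fg.
move=> /CkS[df cf]; apply/CkS; split=> [x Dx|v].
  apply: (near_eq_differentiable _ (df _ Dx)).
  by apply: filterS (open_nbhs_nbhs (conj oD Dx)) => y; exact: fg.
apply: (IH ('D_v f)) => // x Dx; apply: near_eq_derive.
by apply: filterS (open_nbhs_nbhs (conj oD Dx)) => y; exact: fg.
Qed.

Lemma Ck_cst (W : normedModType R) k D (a : W) : Ck k D (fun _ : V => a).
Proof.
elim: k a => [|k IH] a.
  by apply/Ck0 => x _; exact: differentiable_cst.
apply/CkS; split=> [x _|v]; first exact: differentiable_cst.
have -> : 'D_v (fun=> a) = (fun=> 0 : W) by apply/funext => x; rewrite derive_cst.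
exact: IH.
Qed.

Lemma Ck_id k D : Ck k D (@id V).
Proof.
case: k => [|k]; first by apply/Ck0.
apply/CkS; split=> // v.
have -> : 'D_v id = (fun=> v) by apply/funext => x; rewrite derive_id.
exact: Ck_cst.
Qed.

Lemma Ck_lin_comp (U W : normedModType R) k D (g : {linear U -> W}) (f : V -> U) :
  open D -> continuous g -> Ck k D f -> Ck k D (fun x => g (f x)).
Proof.
move=> oD cg; elim: k f => [|k IH] f.
  move=> /Ck0 cf; apply/Ck0 => x Dx.
  apply: (differentiable_comp (cf _ Dx)); exact: linear_differentiable.
move=> /CkS[df cf]; apply/CkS; split=> [x Dx|v].
  apply: (differentiable_comp (df _ Dx)); exact: linear_differentiable.
apply: (Ck_ext oD _ (IH _ (cf v))) => x Dx.
by rewrite derive_comp_lin //; exact: df.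
Qed.

Lemma Ck_add (W : normedModType R) k D (f g : V -> W) :
  open D -> Ck k D f -> Ck k D g -> Ck k D (fun x => f x + g x).
Proof.
move=> oD; elim: k f g => [|k IH] f g.
  by move=> /Ck0 cf /Ck0 cg; apply/Ck0 => x Dx; apply: differentiableD; auto.
move=> /CkS[df cf] /CkS[dg cg]; apply/CkS; split=> [x Dx|v].
  by apply: differentiableD; auto.
apply: (Ck_ext oD _ (IH _ _ (cf v) (cg v))) => x Dx.
by rewrite derive_addf; auto.
Qed.

Lemma Ck_sum (W : normedModType R) k D (I : Type) (s : seq I) (f : I -> V -> W) :
  open D -> (forall i, Ck k D (f i)) -> Ck k D (fun x => \sum_(i <- s) f i x).
Proof.
move=> oD cf; elim: s => [|i s IH].
  by under eq_fun do rewrite big_nil; exact: Ck_cst.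
by under eq_fun do rewrite big_cons; exact: Ck_add.
Qed.

Lemma Ck_scaler (W : normedModType R) k D (c : V -> R) (f : V -> W) :
  open D -> Ck k D c -> Ck k D f -> Ck k D (fun x => c x *: f x).
Proof.
move=> oD; elim: k c f => [|k IH] c f.
  by move=> /Ck0 cc /Ck0 cf; apply/Ck0 => x Dx; apply: differentiable_scaler; auto.
move=> cc cf; have /CkS[dc c'] := cc; have /CkS[df f'] := cf.
apply/CkS; split=> [x Dx|v]; first by apply: differentiable_scaler; auto.
have h := Ck_add oD (IH _ _ (Ck_pred cc) (f' v)) (IH _ _ (c' v) (Ck_pred cf)).
by apply: (Ck_ext oD _ h) => x Dx; rewrite derive_scaler; auto.
Qed.

Lemma Ck_mulf k D (f g : V -> R) :
  open D -> Ck k D f -> Ck k D g -> Ck k D (fun x => f x * g x).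
Proof. exact: (@Ck_scaler R). Qed.

Lemma Ck_opp (W : normedModType R) k D (f : V -> W) :
  open D -> Ck k D f -> Ck k D (fun x => - f x).
Proof.
move=> oD cf; have -> : (fun x => - f x) = (fun x => -1 *: f x).
  by apply/funext => x; rewrite scaleN1r.
by apply: Ck_scaler => //; exact: Ck_cst.
Qed.

Lemma Ck_sub (W : normedModType R) k D (f g : V -> W) :
  open D -> Ck k D f -> Ck k D g -> Ck k D (fun x => f x - g x).
Proof. by move=> oD cf cg; apply: Ck_add => //; exact: Ck_opp. Qed.

Lemma Ck_prod k D (I : Type) (s : seq I) (f : I -> V -> R) :
  open D -> (forall i, Ck k D (f i)) -> Ck k D (fun x => \prod_(i <- s) f i x).
Proof.
move=> oD cf; elim: s => [|i s IH].
  by under eq_fun do rewrite big_nil; exact: Ck_cst.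
by under eq_fun do rewrite big_cons; exact: Ck_mulf.
Qed.

(** The derivative is a polynomial in [f^-1] and ['D_v f], so the induction hypothesis on [f^-1]
    itself closes the step. *)
Lemma Ck_invf k D (f : V -> R) :
  open D -> (forall x, D x -> f x != 0) -> Ck k D f -> Ck k D (fun x => (f x)^-1).
Proof.
move=> oD f0; elim: k => [|k IH].
  by move=> /Ck0 cf; apply/Ck0 => x Dx; apply: differentiableV; auto.
move=> cf; have /CkS[df f'] := cf.
apply/CkS; split=> [x Dx|v]; first by apply: differentiableV; auto.
have ci := IH (Ck_pred cf).
have h := Ck_opp oD (Ck_mulf oD (Ck_mulf oD ci ci) (f' v)).
apply: (Ck_ext oD _ h) => x Dx.
rewrite deriveV; [|exact: f0|by apply: diff_derivable; auto].
by rewrite -[RHS]/(- (f x) ^- 2 * 'D_v f x) expr2 invfM mulNr.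
Qed.

Lemma diff_sqrt (f : V -> R) x : 0 < f x -> differentiable f x ->
  differentiable (fun y => Num.sqrt (f y)) x /\
  forall v, 'D_v (fun y => Num.sqrt (f y)) x = 'D_v f x * (2 * Num.sqrt (f x))^-1.
Proof.
move=> f0 df; have ds := is_derive1_sqrt f0.
have dsq : differentiable (@Num.sqrt R : R -> R) (f x).
  by apply/derivable1_diffP; exact: ex_derive.
split=> [|v]; first exact: (differentiable_comp df dsq).
rewrite (derive_comp _ df dsq) -[in LHS](mulr1 ('D_v f x)).
rewrite -[in LHS]/('D_v f x *: (1 : R)) derive_dirZ //.
by rewrite derive_val.
Qed.

Lemma Ck_sqrt k D (f : V -> R) : open D -> (forall x, D x -> 0 < f x) ->
  Ck k D f -> Ck k D (fun x => Num.sqrt (f x)).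
Proof.
move=> oD f0; elim: k => [|k IH].
  move=> /Ck0 cf; apply/Ck0 => x Dx.
  by have [] := diff_sqrt (f0 _ Dx) (cf _ Dx).
move=> cf; have /CkS[df f'] := cf.
apply/CkS; split=> [x Dx|v]; first by have [] := diff_sqrt (f0 _ Dx) (df _ Dx).
have c2 : Ck k D (fun x => (2 * Num.sqrt (f x))^-1).
  apply: Ck_invf => // [x Dx|].
    by rewrite mulf_neq0 // gt_eqF // sqrtr_gt0 f0.
  by apply: Ck_mulf => //; [exact: Ck_cst|exact: IH (Ck_pred cf)].
apply: (Ck_ext oD _ (Ck_mulf oD (f' v) c2)) => x Dx.
by have [_ ->] := diff_sqrt (f0 _ Dx) (df _ Dx).
Qed.

Lemma coord_linear m n (i : 'I_m) (j : 'I_n) :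
  exists2 g : {linear 'M[R]_(m, n) -> R}, continuous g & forall A, g A = A i j.
Proof.
have lin : linear (fun A : 'M[R]_(m, n) => A i j).
  by move=> a A B; rewrite !mxE.
pose M := GRing.isLinear.Build _ _ _ _ _ lin.
pose g : {linear 'M[R]_(m, n) -> R} := HB.pack (fun A : 'M[R]_(m, n) => A i j) M.
by exists g => //; exact: coord_continuous.
Qed.

Lemma Ck_mxP m n k D (f : V -> 'M[R]_(m, n)) : open D ->
  Ck k D f <-> forall i j, Ck k D (fun x => f x i j).
Proof.
move=> oD; split=> [cf i j|cf].
  have [g cg gE] := coord_linear i j.
  apply: (Ck_ext oD _ (Ck_lin_comp oD cg cf)) => x _; exact: gE.
have -> : f = fun y => \sum_i \sum_j f y i j *: delta_mx i j.
  by apply/funext => y; rewrite -matrix_sum_delta.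
do 2!apply: Ck_sum => // ?.
by apply: Ck_scaler => //; exact: Ck_cst.
Qed.

Lemma Ck_mulmx m n p k D (f : V -> 'M[R]_(m, n)) (g : V -> 'M[R]_(n, p)) :
  open D -> Ck k D f -> Ck k D g -> Ck k D (fun x => f x *m g x).
Proof.
move=> oD cf cg; apply/Ck_mxP => // i j.
under eq_fun do rewrite mxE.
apply: Ck_sum => // l; apply: Ck_mulf => //.
  exact: (Ck_mxP _ _ oD).1.
exact: (Ck_mxP _ _ oD).1.
Qed.

Lemma Ck_trmx m n k D (f : V -> 'M[R]_(m, n)) :
  open D -> Ck k D f -> Ck k D (fun x => (f x)^T).
Proof.
move=> oD cf; apply/Ck_mxP => // i j.
under eq_fun do rewrite mxE.
exact: (Ck_mxP _ _ oD).1.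
Qed.

Lemma Ck_det n k D (f : V -> 'M[R]_n) :
  open D -> (forall i j, Ck k D (fun x => f x i j)) -> Ck k D (fun x => \det (f x)).
Proof.
move=> oD cf; rewrite /determinant.
apply: Ck_sum => // s; apply: Ck_mulf => //; first exact: Ck_cst.
by apply: Ck_prod => // i; exact: cf.
Qed.

Lemma Ck_invmx n k D (f : V -> 'M[R]_n) :
  open D -> (forall x, D x -> f x \in unitmx) -> Ck k D f ->
  Ck k D (fun x => invmx (f x)).
Proof.
move=> oD fu cf.
have c1 : Ck k D (fun x => (\det (f x))^-1 *: \adj (f x)).
  have cf' := (Ck_mxP k f oD).1 cf.
  apply: Ck_scaler => //.
    apply: Ck_invf => //; last exact: Ck_det.
    by move=> x /fu; rewrite unitmxE unitfE.
  apply/Ck_mxP => // i j; under eq_fun do rewrite mxE /cofactor.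
  apply: Ck_mulf => //; first exact: Ck_cst.
  by apply: Ck_det => // a b; under eq_fun do rewrite !mxE; exact: cf'.
by apply: (Ck_ext oD _ c1) => x Dx; rewrite /invmx fu.
Qed.

End Ck.

Section CkComp.
Context {R : realType}.

(** In the chain rule the direction ['D_v f x] varies with [x], whereas [Ck] speaks of fixed
    directions. Expanding it in the standard basis of the intermediate space repairs this, hence the
    restriction to row vectors. *)
Lemma Ck_comp (V W : normedModType R) N k D (E : set 'rV[R]_N) (f : V -> 'rV[R]_N)
    (g : 'rV[R]_N -> W) :
  open D -> (forall x, D x -> E (f x)) ->
  Ck k D f -> Ck k E g -> Ck k D (g \o f).
Proof.
move=> oD DE; elim: k g => [|k IH] g.
  move=> /Ck0 cf /Ck0 cg; apply/Ck0 => x Dx.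
  by apply: differentiable_comp; auto.
move=> cf /CkS[dg cg]; have /CkS[df f'] := cf.
apply/CkS; split=> [x Dx|v]; first by apply: differentiable_comp; auto.
have h : Ck k D (fun x => \sum_i 'D_v f x 0 i *: ('D_(delta_mx 0 i) g \o f) x).
  apply: Ck_sum => // i; apply: Ck_scaler => //.
    exact: (Ck_mxP _ _ oD).1.
  by apply: IH => //; exact: Ck_pred.
apply: (Ck_ext oD _ h) => x Dx.
have dgx : differentiable g (f x) by apply: dg; exact: DE.
rewrite [RHS]derive_comp //; last exact: df.
rewrite [in RHS](row_sum_delta ('D_v f x)) derive_dir_sum //.
by apply: eq_bigr => i _; rewrite derive_dirZ.
Qed.

Lemma Ck_pair (V U W : normedModType R) k D (f : V -> U) (g : V -> W) :
  open D -> Ck k D f -> Ck k D g -> Ck k D (fun x => (f x, g x)).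
Proof.
move=> oD; elim: k f g => [|k IH] f g.
  by move=> /Ck0 cf /Ck0 cg; apply/Ck0 => x Dx; apply: differentiable_pair; auto.
move=> /CkS[df cf] /CkS[dg cg]; apply/CkS; split=> [x Dx|v].
  by apply: differentiable_pair; auto.
apply: (Ck_ext oD _ (IH _ _ (cf v) (cg v))) => x Dx.
by rewrite !deriveE ?diff_pair //; auto; apply: differentiable_pair; auto.
Qed.

Lemma Ck_local (V W : normedModType R) k D (f : V -> W) :
  (forall x, D x -> exists E, [/\ open E, E x & Ck k E f]) -> Ck k D f.
Proof. by move=> h s x sk /h[E [_ Ex cf]]; exact: cf. Qed.

Lemma fst_lin (U W : normedModType R) :
  exists2 g : {linear (U * W)%type -> U}, continuous g & forall p, g p = p.1.
Proof.
have lin : linear (fun p : (U * W)%type => p.1) by [].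
pose M := GRing.isLinear.Build _ _ _ _ _ lin.
pose g : {linear (U * W)%type -> U} := HB.pack (fun p : (U * W)%type => p.1) M.
by exists g => // p; exact: cvg_fst.
Qed.

Lemma snd_lin (U W : normedModType R) :
  exists2 g : {linear (U * W)%type -> W}, continuous g & forall p, g p = p.2.
Proof.
have lin : linear (fun p : (U * W)%type => p.2) by [].
pose M := GRing.isLinear.Build _ _ _ _ _ lin.
pose g : {linear (U * W)%type -> W} := HB.pack (fun p : (U * W)%type => p.2) M.
by exists g => // p; exact: cvg_snd.
Qed.

End CkComp.

(** * Mean value estimates *)

Section MatrixNorm.
Context {R : realType}.

Lemma mx_norm_entry m n (A : 'M[R]_(m, n)) i j : `|A i j| <= `|A|.
Proof.
rewrite [leRHS]/Num.Def.normr /= mx_normrE.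
exact: (le_bigmax _ (fun ij : 'I_m * 'I_n => `|A ij.1 ij.2|) (i, j)).
Qed.

Lemma mx_norm_le m n (A : 'M[R]_(m, n)) C :
  0 <= C -> (forall i j, `|A i j| <= C) -> `|A| <= C.
Proof.
move=> C0 AC; rewrite /Num.Def.normr /= mx_normrE.
by apply/bigmax_leP; split=> // -[i j] _; exact: AC.
Qed.

Lemma mx_norm_mul m n p (A : 'M[R]_(m, n)) (B : 'M[R]_(n, p)) :
  `|A *m B| <= n%:R * `|A| * `|B|.
Proof.
apply: mx_norm_le => [|i j]; first by rewrite !mulr_ge0.
rewrite mxE (le_trans (ler_norm_sum _ _ _)) // -mulrA mulr_natl.
rewrite -[X in _ <= _ *+ X]card_ord -sumr_const.
apply: ler_sum => l _; rewrite normrM.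
by apply: ler_pM => //; exact: mx_norm_entry.
Qed.

Lemma linear_rV_continuous n (W : normedModType R) (f : {linear 'rV[R]_n -> W}) :
  continuous f.
Proof.
have -> : (f : 'rV[R]_n -> W) = fun u => \sum_i u 0 i *: f (delta_mx 0 i).
  apply/funext => u; rewrite {1}(row_sum_delta u) linear_sum.
  by apply: eq_bigr => i _; rewrite linearZ.
move=> u; apply: differentiable_continuous.
apply: differentiable_sumf => i; apply: differentiable_scaler.
  exact: differentiable_coord.
exact: differentiable_cst.
Qed.

End MatrixNorm.

Section MeanValue.
Context {R : realType} {V : normedModType R}.

Lemma differentiable_eps (W : normedModType R) (f : V -> W) x :
  differentiable f x -> forall e : R, 0 < e -> exists2 d : R, 0 < d &
    forall w, `|w| < d -> `|f (x + w) - f x - 'd f x w| <= e * `|w|.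
Proof.
move=> df e e0; have /eqaddoP/(_ _ e0) := diff_locally df.
move=> /nbhs_norm0P[d /= d0 hd]; exists d => // w wd.
by have := hd w wd; rewrite !fctE /= opprD addrA [w + x]addrC.
Qed.

Lemma eps_differentiable (W : normedModType R) (f : V -> W) (x : V) (L : {linear V -> W}) :
  continuous L ->
  (forall e : R, 0 < e -> exists2 d : R, 0 < d &
    forall w, `|w| < d -> `|f (x + w) - f x - L w| <= e * `|w|) ->
  differentiable f x /\ 'd f x = L :> (V -> W).
Proof.
move=> cL h.
have e : f \o shift x = cst (f x) + L +o_ 0 id.
  apply/eqaddoP => e e0; have [d d0 hd] := h e e0.
  apply/nbhs_norm0P; exists d => //= w wd.
  by rewrite !fctE /= opprD addrA [w + x]addrC; exact: hd.
have eqd : 'd f x = L :> (V -> W) by apply: diff_unique.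
by split=> //; apply/diff_locallyP; rewrite eqd.
Qed.

Lemma open_add (D : set V) (x : V) : open D -> D x ->
  exists2 d : R, 0 < d & forall y, `|y| < d -> D (x + y).
Proof.
move=> oD Dx; have /nbhs_normP[d /= d0 hd] := open_nbhs_nbhs (conj oD Dx).
exists d => // y yd; apply: hd => /=.
by rewrite opprD addrA subrr sub0r normrN.
Qed.

Lemma mvt_dir (f : V -> R) (x h : V) :
  (forall t : R, 0 <= t <= 1 -> differentiable f (x + t *: h)) ->
  exists2 t : R, 0 <= t <= 1 & f (x + h) - f x = 'D_h f (x + t *: h).
Proof.
move=> df.
pose l (t : R) := x + t *: h.
have dl t : differentiable l t.
  apply: differentiableD => //; exact: differentiable_scaler.
have Dl t : 'D_1 l t = h.
  have dk : differentiable (fun t : R => t *: h) t by exact: differentiable_scaler.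
  rewrite /l derive_addf //.
  by rewrite derive_cst add0r derive_scaler // derive_cst scaler0 add0r derive_id scale1r.
have fl (t : R) : 0 <= t <= 1 -> is_derive t 1 (f \o l) ('D_h f (l t)).
  move=> t01; have dfl := df _ t01.
  split; first by apply: diff_derivable; exact: differentiable_comp.
  by rewrite derive_comp // Dl.
have [|||t] := @MVT_segment R (f \o l) (fun t => 'D_h f (l t)) 0 1.
- exact: ler01.
- by move=> t; rewrite in_itv /= => /andP[t0 t1]; apply: fl; rewrite !ltW.
- apply: continuous_in_subspaceT => t; rewrite inE /= in_itv /= => t01.
  apply: differentiable_continuous; apply: differentiable_comp => //.
  exact: df.
- rewrite in_itv /= => t01; rewrite subr0 mulr1 /l /= scale1r scale0r addr0 => e.
  by exists t.
Qed.

(** The norm is the maximum over the entries, so each entry may use its own intermediate point in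
    the scalar mean value theorem. *)
Lemma mvi m n (f : V -> 'M[R]_(m, n)) (x h : V) (C : R) :
  (forall t : R, 0 <= t <= 1 -> differentiable f (x + t *: h)) ->
  (forall t : R, 0 <= t <= 1 -> `|'D_h f (x + t *: h)| <= C) ->
  `|f (x + h) - f x| <= C.
Proof.
move=> df dC; apply: mx_norm_le => [|i j].
  by apply: le_trans (dC 0 _); rewrite ?lexx ?ler01.
have [|t t01] := @mvt_dir (fun y => f y i j) x h.
  by move=> t t01; exact: (differentiable_mxP _ _).1 (df t t01) i j.
rewrite !mxE => ->; apply: le_trans (dC t t01).
rewrite -derive_mxE; [exact: mx_norm_entry|exact: df].
Qed.

(** The second difference is the increment along [s *: a] of [g u = f (u + s *: b) - f u]. The mean
    value theorem turns it into a difference of two values of ['D_a f], each expanded to first order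
    at [x]. *)
Lemma schwarz_increment (f : V -> R) (x a b : V) (d : R) : 0 < d ->
  (forall y, `|y| < d -> differentiable f (x + y)) ->
  differentiable ('D_a f) x -> forall e : R, 0 < e -> exists2 r : R, 0 < r &
  forall s : R, 0 < s -> s < r ->
  `|f (x + s *: a + s *: b) - f (x + s *: a) - (f (x + s *: b) - f x)
    - s ^+ 2 * 'D_b ('D_a f) x| <= e * s ^+ 2.
Proof.
move=> d0 df dD e e0.
(* All points used lie within [s * N] of [x]; two expansion errors of [e / (2 * N) * (s * N)],
   multiplied by [s], add up to [e * s ^+ 2]. *)
pose N := `|a| + `|b| + 1.
have N0 : 0 < N by rewrite ltr_wpDl // addr_ge0.
have [r r0 hr] := differentiable_eps dD (e := e / (2 * N)) (divr_gt0 e0 (mulr_gt0 (ltr0Sn R 1) N0)).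
exists (Num.min r d / N); first by rewrite divr_gt0 // lt_min r0.
move=> s s0; rewrite ltr_pdivlMr // lt_min => /andP[sr sd].
have wN (t c : R) : 0 <= t <= 1 -> 0 <= c <= 1 -> `|t *: (s *: a) + c *: (s *: b)| <= s * N.
  move=> /andP[t0 t1] /andP[c0 c1]; rewrite (le_trans (ler_normD _ _)) //.
  rewrite !normrZ (ger0_norm t0) (ger0_norm c0) (gtr0_norm s0) /N !mulrDr.
  rewrite mulr1 -[leLHS]addr0; apply: lerD; last exact: ltW.
  by apply: lerD; apply: ler_piMl => //; rewrite mulr_ge0 // ltW.
pose g u := f (u + s *: b) - f u.
have d1 (t : R) : 0 <= t <= 1 -> differentiable f (x + t *: (s *: a)).
  move=> t01; apply: df; rewrite -[X in `|X|]addr0 -(scale0r (s *: b)).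
  by rewrite (le_lt_trans (wN _ _ t01 _)) // lexx ler01.
have d2 (t : R) : 0 <= t <= 1 -> differentiable f (x + t *: (s *: a) + s *: b).
  move=> t01; rewrite -addrA; apply: df; rewrite -(scale1r (s *: b)).
  by rewrite (le_lt_trans (wN _ _ t01 _)) // lexx ler01.
have d3 (t : R) : 0 <= t <= 1 ->
    differentiable (fun u => f (u + s *: b)) (x + t *: (s *: a)) /\
    'D_(s *: a) (fun u => f (u + s *: b)) (x + t *: (s *: a)) =
    s * 'D_a f (x + t *: (s *: a) + s *: b).
  move=> t01.
  have dt : differentiable (fun u => u + s *: b) (x + t *: (s *: a)).
    exact: differentiableD.
  split; first exact: (@differentiable_comp _ _ _ _ (fun u => u + s *: b) f _ dt (d2 _ t01)).
  rewrite (derive_comp (s *: a) dt (d2 t t01)).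
  by rewrite derive_addf // derive_id derive_cst addr0 derive_dirZ //; exact: d2.
have [|t t01 gt] := @mvt_dir g x (s *: a).
  move=> t t01; apply: differentiableB; [by have [] := d3 t t01|exact: d1].
have [d4 D4] := d3 t t01.
rewrite [X in `|X - _|](_ : _ = g (x + s *: a) - g x) // gt.
rewrite /g derive_subf //; last exact: d1.
rewrite D4 derive_dirZ; last exact: d1.
rewrite -[s *: 'D_a f _]/(s * 'D_a f (x + t *: (s *: a))).
set p := 'D_a f _; set q := 'D_a f _.
have hw w : `|w| <= s * N ->
    `|'D_a f (x + w) - 'D_a f x - 'd ('D_a f) x w| <= e / (2 * N) * (s * N).
  move=> wN'; apply: le_trans (hr _ (le_lt_trans wN' sr)) _.
  by rewrite ler_wpM2l // divr_ge0 ?mulr_ge0 ?ltW.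
have h1 : `|p - 'D_a f x - 'd ('D_a f) x (t *: (s *: a) + s *: b)| <= e / (2 * N) * (s * N).
  rewrite /p -(addrA x); apply: hw.
  by rewrite -[X in _ + X](scale1r (s *: b)) wN // lexx ler01.
have h2 : `|q - 'D_a f x - 'd ('D_a f) x (t *: (s *: a))| <= e / (2 * N) * (s * N).
  by apply: hw; rewrite -[X in `|X|]addr0 -(scale0r (s *: b)) wN // lexx ler01.
rewrite deriveE //.
have -> : s * p - s * q - s ^+ 2 * 'd ('D_a f) x b =
  s * ((p - 'D_a f x - 'd ('D_a f) x (t *: (s *: a) + s *: b)) -
       (q - 'D_a f x - 'd ('D_a f) x (t *: (s *: a)))).
  have lb : 'd ('D_a f) x (s *: b) = s * 'd ('D_a f) x b by exact: linearZ.
  by rewrite linearD lb; ring.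
rewrite normrM (gtr0_norm s0) expr2 mulrCA ler_wpM2l ?(ltW s0) //.
rewrite (le_trans (ler_normB _ _)) // (le_trans (lerD h1 h2)) //.
rewrite le_eqVlt; apply/orP; left; apply/eqP; field.
by rewrite gt_eqF.
Qed.

(** The second difference is symmetric in [a] and [b], so its two expansions can be compared at one
    small [s]. *)
Lemma schwarz (f : V -> R) (x a b : V) (d : R) : 0 < d ->
  (forall y, `|y| < d -> differentiable f (x + y)) ->
  differentiable ('D_a f) x -> differentiable ('D_b f) x ->
  'D_b ('D_a f) x = 'D_a ('D_b f) x.
Proof.
move=> d0 df da db; apply/eqP; rewrite -subr_eq0 -normr_le0.
apply/ler_addgt0Pl => e e0; rewrite addr0.
have [r r0 hr] := schwarz_increment b d0 df da (e := e / 2) (divr_gt0 e0 (ltr0Sn R 1)).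
have [r' r'0 hr'] := schwarz_increment a d0 df db (e := e / 2) (divr_gt0 e0 (ltr0Sn R 1)).
pose s := Num.min r r' / 2.
have m0 : 0 < Num.min r r' by rewrite lt_min r0.
have s0 : 0 < s by rewrite divr_gt0.
have sm : s < Num.min r r' by rewrite ltr_pdivrMr // ltr_pMr // ltr1n.
have := hr s s0; have := hr' s s0.
move: sm; rewrite lt_min => /andP[-> ->] /(_ isT) h1 /(_ isT) h2.
rewrite -(ler_pM2l (exprn_gt0 2 s0)) -[X in X * `|_|](gtr0_norm (exprn_gt0 2 s0)) -normrM.
have h := le_trans (ler_normB _ _) (lerD h2 h1).
move: h; rewrite (addrAC x (s *: b) (s *: a)).
rewrite (_ : e / 2 * s ^+ 2 + e / 2 * s ^+ 2 = s ^+ 2 * e); last by field.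
set p1 := f _; set p2 := f _; set p3 := f _; set u := 'D_b _ x; set w := 'D_a _ x.
rewrite (_ : p1 - p2 - (p3 - f x) - s ^+ 2 * u - (p1 - p3 - (p2 - f x) - s ^+ 2 * w)
  = - (s ^+ 2 * (u - w))); last by ring.
by rewrite normrN.
Qed.

Lemma schwarz_mx m n k D (f : V -> 'M[R]_(m, n)) x a b :
  open D -> D x -> Ck k.+1 D f -> 'D_b ('D_a f) x = 'D_a ('D_b f) x.
Proof.
move=> oD Dx /CkS[df cf].
have [d d0 dD] := open_add oD Dx.
apply/matrixP => i j.
have Dij c : {near x, (fun y => 'D_c f y i j) =1 'D_c (fun y => f y i j)}.
  by apply: filterS (open_nbhs_nbhs (conj oD Dx)) => y Dy; apply: derive_mxE; exact: df.
have dD' c : differentiable ('D_c f) x by exact: (Ck_differentiable (cf c)).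
have dij c : differentiable ('D_c (fun y => f y i j)) x.
  exact: (near_eq_differentiable (Dij c) ((differentiable_mxP _ _).1 (dD' c) i j)).
have Eij c c' : 'D_c ('D_c' f) x i j = 'D_c ('D_c' (fun y => f y i j)) x.
  by apply: etrans (derive_mxE _ _ _ (dD' c')) _; exact: near_eq_derive.
apply: etrans (Eij b a) _; apply: etrans _ (esym (Eij a b)).
apply: (schwarz d0) => // y yd.
by apply: (differentiable_mxP _ _).1; apply: df; exact: dD.
Qed.

End MeanValue.

(** * Flat linear connections *)

Section GeometricSequence.
Context {R : realType}.

Lemma geometric_small (C q e : R) : 0 <= q < 1 -> 0 < e ->
  exists k, C * q ^+ k < e.
Proof.
move=> /andP[q0 q1] e0.
have : geometric C q @ \oo --> (0 : R) by apply: cvg_geometric; rewrite ger0_norm.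
move=> /cvgr0Pnorm_lt/(_ e e0)[k _ hk].
by exists k; apply: le_lt_trans (ler_norm _) (hk k _) => /=.
Qed.

Lemma geometric_limit (W : completeNormedModType R) (u : nat -> W) (C : R) :
  (forall k, `|u k.+1 - u k| <= C * 2^-1 ^+ k) ->
  exists l, forall k, `|l - u k| <= 2 * C * 2^-1 ^+ k.
Proof.
move=> du.
have C0 : 0 <= C by have := le_trans (normr_ge0 _) (du 0%N); rewrite expr0 mulr1.
have h0 k : 0 <= 2^-1 ^+ k :> R by rewrite exprn_ge0 // invr_ge0.
have dist k p : `|u (k + p)%N - u k| <= 2 * C * 2^-1 ^+ k.
  suff : `|u (k + p)%N - u k| <= 2 * C * 2^-1 ^+ k * (1 - 2^-1 ^+ p).
    by move/le_trans; apply; rewrite ler_piMr ?mulr_ge0 // gerBl.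
  elim: p => [|p IH]; first by rewrite addn0 subrr normr0 expr0 subrr mulr0.
  rewrite addnS -(subrKA (u (k + p)%N)) (le_trans (ler_normD _ _)) //.
  apply: le_trans (lerD (du _) IH) _.
  rewrite exprD exprS le_eqVlt; apply/orP; left; apply/eqP.
  by set a := _ ^+ k; set b := _ ^+ p; field.
have cu : cvg (u @ \oo).
  apply/cauchy_cvgP; apply: cauchy_exP => e e0.
  have [K hK] : exists K, 2 * C * 2^-1 ^+ K < e.
    by apply: geometric_small => //; rewrite invr_ge0 ler0n invf_lt1 // ltr1n.
  exists (u K); exists K => // i /= Ki; rewrite -ball_normE /= distrC.
  by rewrite -(subnKC Ki); exact: le_lt_trans (dist K _) hK.
exists (lim (u @ \oo)) => k.
rewrite distrC; have cl : (fun i => `|u k - u i|) @ \oo --> `|u k - lim (u @ \oo)|.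
  by apply: cvg_norm; apply: cvgB => //; exact: cvg_cst.
have -> : `|u k - lim (u @ \oo)| = lim ((fun i => `|u k - u i|) @ \oo).
  by apply/esym/cvg_lim.
apply: limr_le; first by apply/cvg_ex; exists `|u k - lim (u @ \oo)|.
near=> i; have ki : (k <= i)%N by near: i; exact: nbhs_infty_ge.
by rewrite distrC -{1}(subnKC ki).
Unshelve. all: by end_near.
Qed.

Lemma norm_half (W : normedModType R) (x : W) : `|2^-1 *: x| = 2^-1 * `|x|.
Proof. by rewrite normrZ ger0_norm // invr_ge0. Qed.

End GeometricSequence.

HB.instance Definition _ (R : realType) (m n : nat) :=
  Uniform_isComplete.Build 'M[R]_(m, n) (@mx_complete R m n).

Section FlatTransport.
Context {R : realType} {n N : nat}.
Implicit Types (x y z : 'rV[R]_n) (T E : 'M[R]_N).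

Definition mid x y : 'rV[R]_n := 2^-1 *: (x + y).

Lemma mid_subl x y : mid x y - x = 2^-1 *: (y - x).
Proof.
by apply/rowP => i; rewrite !mxE; field.
Qed.

Lemma mid_subr x y : y - mid x y = 2^-1 *: (y - x).
Proof.
by apply/rowP => i; rewrite !mxE; field.
Qed.

(** The loss of [9 / 8] per factor has to be outweighed by the gain of [1 / 8] that halving a length
    brings to a cubic error. *)
Lemma near1_mull T E : N%:R * `|T - 1%:M| <= 8^-1 -> `|T *m E| <= 9 / 8 * `|E|.
Proof.
move=> hT; rewrite -[T](subrK 1%:M) mulmxDl mul1mx (le_trans (ler_normD _ _)) //.
have := le_trans (mx_norm_mul (T - 1%:M) E) (ler_wpM2r (normr_ge0 E) hT).
lra.
Qed.

Lemma near1_mulr T E : N%:R * `|T - 1%:M| <= 8^-1 -> `|E *m T| <= 9 / 8 * `|E|.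
Proof.
move=> hT; rewrite -[T](subrK 1%:M) mulmxDr mulmx1 (le_trans (ler_normD _ _)) //.
have := mx_norm_mul E (T - 1%:M).
have := ler_wpM2r (normr_ge0 E) hT.
set e := `|E|; set t := `|_ - _|; rewrite -mulrA (mulrC e) mulrA; lra.
Qed.

(** The ordered product of [mu] over [2 ^ k] equal pieces of the segment, a multiplicative Riemann
    sum. *)
Fixpoint dyadic (mu : 'rV[R]_n -> 'rV[R]_n -> 'M[R]_N) (k : nat) x y : 'M[R]_N :=
  if k is k'.+1 then dyadic mu k' x (mid x y) *m dyadic mu k' (mid x y) y
  else mu x y.

Variables (B : set 'rV[R]_n) (mu : 'rV[R]_n -> 'rV[R]_n -> 'M[R]_N) (K r : R).
Hypothesis K0 : 0 <= K.
Hypothesis Bmid : forall x y, B x -> B y -> B (mid x y).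
Hypothesis mu1 : forall x y, B x -> B y -> N%:R * `|mu x y - 1%:M| <= 16^-1.
Hypothesis Br : forall x y, B x -> B y -> `|y - x| <= r.
Hypothesis rK : N%:R * (2 * K * r ^+ 3) <= 16^-1.
Hypothesis mu3 : forall x y z (d : R), B x -> B y -> B z ->
  `|y - x| <= d -> `|z - y| <= d -> `|z - x| <= d ->
  `|mu x y *m mu y z - mu x z| <= K * d ^+ 3.

Let near1 T := N%:R * `|T - 1%:M| <= 8^-1.

(** The bounds [1 / 16] of [mu1] and of [rK] add up to the [1 / 8] of [near1]; every approximation
    below stays in this cubic neighbourhood of [mu]. *)
Lemma close_mu_near1 x y T : B x -> B y ->
  `|T - mu x y| <= 2 * K * `|y - x| ^+ 3 -> near1 T.
Proof.
move=> Bx By hT; rewrite /near1 -(subrKA (mu x y)).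
have h1 : N%:R * `|T - mu x y| <= 16^-1.
  apply: le_trans rK; apply: ler_wpM2l => //; apply: le_trans hT _.
  apply: ler_wpM2l; first by rewrite mulr_ge0.
  by rewrite ler_pXn2r ?nnegrE ?Br //; apply: le_trans (normr_ge0 _) (Br Bx By).
have := ler_wpM2l (ler0n R N) (ler_normD (T - mu x y) (mu x y - 1%:M)).
move=> /le_trans; apply; rewrite mulrDr.
by apply: le_trans (lerD h1 (mu1 Bx By)) _; lra.
Qed.

Lemma cubic_ge0 x : 0 <= 2 * K * `|x| ^+ 3.
Proof. by rewrite mulr_ge0 ?exprn_ge0 // mulr_ge0. Qed.

Lemma half_pow_le1 k : 1 - 2^-1 ^+ k <= 1 :> R.
Proof. by rewrite gerBl exprn_ge0 // invr_ge0. Qed.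

(** Refining both halves costs two errors, each multiplied by at most [1 / 8 * (9 / 8)]. Since
    [2 * (9 / 64) < 1 / 2], successive refinements converge geometrically. *)
Lemma dyadic_close k x y : B x -> B y ->
  `|dyadic mu k.+1 x y - dyadic mu k x y| <= K * `|y - x| ^+ 3 * 2^-1 ^+ k /\
  `|dyadic mu k x y - mu x y| <= 2 * K * `|y - x| ^+ 3.
Proof.
(* The factor [1 - 2^-1 ^+ k] is the partial sum of the geometric series and makes the second bound
   inductive. *)
move=> Bx By; suff [h1 h2] :
    `|dyadic mu k.+1 x y - dyadic mu k x y| <= K * `|y - x| ^+ 3 * 2^-1 ^+ k /\
    `|dyadic mu k x y - mu x y| <= 2 * K * `|y - x| ^+ 3 * (1 - 2^-1 ^+ k).
  by split=> //; apply: le_trans h2 _; rewrite ler_piMr ?cubic_ge0 ?half_pow_le1.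
elim: k x y Bx By => [|k IH] x y Bx By.
  rewrite /= subrr normr0 expr0 subrr mulr0 mulr1; split=> //.
  have Bm := Bmid Bx By.
  apply: mu3 => //; rewrite ?mid_subl ?mid_subr norm_half.
    by have := normr_ge0 (y - x); lra.
  by have := normr_ge0 (y - x); lra.
have pos : 0 <= K * `|y - x| ^+ 3 * 2^-1 ^+ k.
  by rewrite !mulr_ge0 ?exprn_ge0 // invr_ge0.
have Bm := Bmid Bx By.
have [d1 c1] := IH x (mid x y) Bx Bm.
have [d2 c2] := IH (mid x y) y Bm By.
have [d0 c0] := IH x y Bx By.
have c01 : `|dyadic mu k.+1 x y - mu x y| <=
    2 * K * `|y - x| ^+ 3 * (1 - 2^-1 ^+ k.+1).
  rewrite -(subrKA (dyadic mu k x y)) (le_trans (ler_normD _ _)) //.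
  apply: le_trans (lerD d0 c0) _; rewrite (exprS _ k).
  set a := _ ^+ 3; set b := _ ^+ k; rewrite le_eqVlt; apply/orP; left.
  by apply/eqP; field.
split=> //.
set m := mid x y; set p := dyadic mu k.+1; set q := dyadic mu k.
rewrite [X in `|X|](_ : _ = (p x m - q x m) *m p m y + q x m *m (p m y - q m y)); last first.
  by rewrite mulmxBl mulmxBr addrA subrK.
have n1 : near1 (p m y).
  apply: (close_mu_near1 Bm By).
  rewrite -(subrKA (q m y)) (le_trans (ler_normD _ _)) //.
  apply: le_trans (lerD d2 c2) _.
  have h0 : 0 <= K * `|y - m| ^+ 3 * 2^-1 ^+ k.
    by rewrite !mulr_ge0 ?exprn_ge0 // invr_ge0.
  by move: h0; rewrite -/m; set a := _ ^+ 3; set b := _ ^+ k; lra.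
have n2 : near1 (q x m).
  apply: (close_mu_near1 Bx Bm); apply: le_trans c1 _.
  by rewrite ler_piMr ?cubic_ge0 ?half_pow_le1.
rewrite (le_trans (ler_normD _ _)) //.
apply: le_trans (lerD (near1_mulr _ n1) (near1_mull _ n2)) _.
move: d1 d2; rewrite mid_subl mid_subr norm_half -/m -/p -/q (exprS _ k) exprMn.
move: pos; set a := _ ^+ 3; set b := _ ^+ k => pos d1 d2.
set s := K * a * b in pos.
have e1 : K * (2^-1 ^+ 3 * a) * b = 8^-1 * s by rewrite /s; field.
have -> : K * a * (2^-1 * b) = 2^-1 * s by rewrite /s; field.
rewrite !e1 in d1 d2; lra.
Qed.

(* Goursat's argument: the midpoints cut a triangle into four triangles of half
   the size, whose defects of multiplicativity add up to that of the whole; as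
   the defect is cubic in the size it vanishes. *)
Lemma flat_transport : exists T : 'rV[R]_n -> 'rV[R]_n -> 'M[R]_N,
  (forall x y z, B x -> B y -> B z -> T x y *m T y z = T x z) /\
  (forall x y, B x -> B y -> `|T x y - mu x y| <= 2 * K * `|y - x| ^+ 3).
Proof.
have /choice[T hT] : forall xy : 'rV[R]_n * 'rV[R]_n, exists t : 'M[R]_N,
    B xy.1 -> B xy.2 -> forall k, `|t - dyadic mu k xy.1 xy.2| <=
      2 * (K * `|xy.2 - xy.1| ^+ 3) * 2^-1 ^+ k.
  move=> [x y] /=; have [[Bx By]|nB] := pselect (B x /\ B y); last first.
    by exists 0 => Bx By; exfalso; apply: nB.
  have [|t ht] := @geometric_limit R 'M[R]_N (fun k => dyadic mu k x y) (K * `|y - x| ^+ 3).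
    by move=> k; exact: (dyadic_close k Bx By).1.
  by exists t.
pose t x y := T (x, y).
have tk x y k : B x -> B y -> `|t x y - dyadic mu k x y| <=
    2 * K * `|y - x| ^+ 3 * 2^-1 ^+ k.
  by move=> Bx By; rewrite -(mulrA 2 K); exact: (hT (x, y)).
have tmu x y : B x -> B y -> `|t x y - mu x y| <= 2 * K * `|y - x| ^+ 3.
  by move=> Bx By; have := tk x y 0%N Bx By; rewrite expr0 mulr1.
have t1 x y : B x -> B y -> near1 (t x y).
  by move=> Bx By; apply: (close_mu_near1 Bx By); exact: tmu.
have d1 k x y : B x -> B y -> near1 (dyadic mu k x y).
  move=> Bx By; apply: (close_mu_near1 Bx By); exact: (dyadic_close k Bx By).2.
have small (s : R) C : 0 <= s -> (forall k, s <= C * (3 / 4) ^+ k) -> s = 0.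
  move=> s0 hs; apply/eqP; rewrite eq_le s0 andbT; apply/ler_addgt0Pl => e e0.
  rewrite addr0; have [|k hk] := geometric_small C (q := 3 / 4) _ e0; first lra.
  exact: le_trans (hs k) (ltW hk).
(* The approximation of order [k.+1] is by definition the product of those of order [k] on the two
   halves, so the identity survives in the limit. *)
have tmid x y : B x -> B y -> t x y = t x (mid x y) *m t (mid x y) y.
  move=> Bx By; apply/eqP; rewrite -subr_eq0 -normr_eq0; apply/eqP.
  have Bm := Bmid Bx By; set m := mid x y in Bm *.
  apply: (small _ (8 * K * `|y - x| ^+ 3)) => // k.
  have h := tk x y k.+1 Bx By.
  have h1 := tk x m k Bx Bm; have h2 := tk m y k Bm By.
  rewrite [X in `|X|](_ : _ = (t x y - dyadic mu k.+1 x y)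
    - ((t x m - dyadic mu k x m) *m t m y + dyadic mu k x m *m (t m y - dyadic mu k m y))); last first.
    rewrite /= -/m mulmxBl mulmxBr; set a := _ *m _; set b := _ *m _; set c := _ *m _.
    apply/matrixP => i j; rewrite !mxE; ring.
  apply: le_trans (ler_normB _ _) _.
  apply: le_trans (lerD h (ler_normD _ _)) _.
  apply: le_trans (lerD (lexx _) (lerD (near1_mulr _ (t1 _ _ Bm By)) (near1_mull _ (d1 k _ _ Bx Bm)))) _.
  have hk : 2^-1 ^+ k <= (3 / 4) ^+ k :> R.
    by apply: lerXn2r; rewrite ?nnegrE; lra.
  move: h1 h2; rewrite mid_subl mid_subr norm_half exprMn (exprS _ k).
  have a0 : 0 <= K * `|y - x| ^+ 3 by rewrite mulr_ge0 // exprn_ge0.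
  have := ler_wpM2l a0 hk.
  have : 0 <= K * `|y - x| ^+ 3 * 2^-1 ^+ k.
    by rewrite mulr_ge0 // exprn_ge0 // invr_ge0.
  by move: a0; set a := _ ^+ 3; set b := 2^-1 ^+ k; set c := (3 / 4) ^+ k; lra.
exists t; split=> // x y z Bx By Bz.
apply/eqP; rewrite -subr_eq0 -normr_eq0; apply/eqP.
(* The cost of replacing [t] by [mu] on the three sides, two of which occur in a product, plus the
   defect of [mu] itself. *)
pose L := 2 * K * (9 / 8 + 9 / 8 + 1) + K.
have L0 : 0 <= L by have := K0; rewrite /L; lra.
(* Each half-size defect carries [1 / 8] and at most two transport factors; their sum weighs
   [(3 * (9 / 8) ^ 2 + 9 / 8) / 8 < 3 / 4]. *)
have main k : forall x y z (d : R), B x -> B y -> B z ->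
    `|y - x| <= d -> `|z - y| <= d -> `|z - x| <= d ->
    `|t x y *m t y z - t x z| <= L * d ^+ 3 * (3 / 4) ^+ k.
  elim: k => [|k IH] {Bx By Bz}x {}y {}z d Bx By Bz xy yz xz.
    have d0 : 0 <= d by exact: le_trans (normr_ge0 _) xy.
    have cub u v : B u -> B v -> `|v - u| <= d -> `|t u v - mu u v| <= 2 * K * d ^+ 3.
      move=> Bu Bv uv; apply: le_trans (tmu _ _ Bu Bv) _.
      by apply: ler_wpM2l; [rewrite mulr_ge0|apply: lerXn2r; rewrite ?nnegrE].
    rewrite [X in `|X|](_ : _ = (t x y - mu x y) *m t y z + mu x y *m (t y z - mu y z)
      + (mu x y *m mu y z - mu x z) - (t x z - mu x z)); last first.
      rewrite mulmxBl mulmxBr; set a := _ *m _; set b := _ *m _; set c := _ *m _.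
      by apply/matrixP => i j; rewrite !mxE; ring.
    have h1 := near1_mulr (t x y - mu x y) (t1 _ _ By Bz).
    have h2 := near1_mull (t y z - mu y z) (d1 0%N _ _ Bx By).
    have h3 := mu3 Bx By Bz xy yz xz.
    have c1 := cub _ _ Bx By xy; have c2 := cub _ _ By Bz yz; have c3 := cub _ _ Bx Bz xz.
    apply: le_trans (ler_normB _ _) _; apply: le_trans (lerD (ler_normD _ _) (lexx _)) _.
    apply: le_trans (lerD (lerD (ler_normD _ _) (lexx _)) (lexx _)) _.
    rewrite expr0 mulr1 /L.
    rewrite (mulrDl _ _ (d ^+ 3)) -[2 * K * (_ + _) * _]mulrAC /=.
    move: h1 h2 h3 c1 c2 c3; rewrite /=; set u := d ^+ 3.
    set s := 2 * K * u; lra.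
  have d0 : 0 <= d by exact: le_trans (normr_ge0 _) xy.
  pose a := mid x y; pose b := mid y z; pose c := mid x z.
  have Ba : B a := Bmid Bx By. have Bb : B b := Bmid By Bz.
  have Bc : B c := Bmid Bx Bz.
  have half (u : 'rV[R]_n) : `|u| <= d -> `|2^-1 *: u| <= 2^-1 * d.
    by rewrite norm_half; lra.
  have ab : b - a = 2^-1 *: (z - x).
    by apply/rowP => i; rewrite !mxE; field.
  have ac : c - a = 2^-1 *: (z - y).
    by apply/rowP => i; rewrite !mxE; field.
  have cb : b - c = 2^-1 *: (y - x).
    by apply/rowP => i; rewrite !mxE; field.
  have E1 : `|t a y *m t y b - t a b| <= L * (2^-1 * d) ^+ 3 * (3 / 4) ^+ k.
    by apply: IH => //; rewrite ?ab ?mid_subr ?mid_subl; exact: half.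
  have E2 : `|t a c *m t c b - t a b| <= L * (2^-1 * d) ^+ 3 * (3 / 4) ^+ k.
    by apply: IH => //; rewrite ?ab ?ac ?cb; exact: half.
  have E3 : `|t x a *m t a c - t x c| <= L * (2^-1 * d) ^+ 3 * (3 / 4) ^+ k.
    by apply: IH => //; rewrite ?ac ?mid_subr ?mid_subl; exact: half.
  have E4 : `|t c b *m t b z - t c z| <= L * (2^-1 * d) ^+ 3 * (3 / 4) ^+ k.
    by apply: IH => //; rewrite ?cb ?mid_subr ?mid_subl; exact: half.
  rewrite (tmid x y) // (tmid y z) // (tmid x z) // -/a -/b -/c.
  rewrite [X in `|X|](_ : _ =
    t x a *m (t a y *m t y b - t a b) *m t b z
    - t x a *m (t a c *m t c b - t a b) *m t b z
    + (t x a *m t a c - t x c) *m t c b *m t b z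
    + t x c *m (t c b *m t b z - t c z)); last first.
    rewrite !mulmxBr !mulmxBl !mulmxA.
    set p1 := _ *m _; set p2 := _ *m _; set p3 := _ *m _; set p4 := _ *m _; set p5 := _ *m _.
    by apply/matrixP => i j; rewrite !mxE; ring.
  have g1 := near1_mull (t a y *m t y b - t a b) (t1 _ _ Bx Ba).
  have g1' := near1_mulr (t x a *m (t a y *m t y b - t a b)) (t1 _ _ Bb Bz).
  have g2 := near1_mull (t a c *m t c b - t a b) (t1 _ _ Bx Ba).
  have g2' := near1_mulr (t x a *m (t a c *m t c b - t a b)) (t1 _ _ Bb Bz).
  have g3 := near1_mulr (t x a *m t a c - t x c) (t1 _ _ Bc Bb).
  have g3' := near1_mulr ((t x a *m t a c - t x c) *m t c b) (t1 _ _ Bb Bz).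
  have g4 := near1_mull (t c b *m t b z - t c z) (t1 _ _ Bx Bc).
  apply: le_trans (ler_normD _ _) _; apply: le_trans (lerD (ler_normD _ _) (lexx _)) _.
  apply: le_trans (lerD (lerD (ler_normB _ _) (lexx _)) (lexx _)) _.
  have q0 : 0 <= (3 / 4) ^+ k :> R by rewrite exprn_ge0 //; lra.
  have s0 : 0 <= L * d ^+ 3 * (3 / 4) ^+ k by rewrite !mulr_ge0 ?exprn_ge0.
  move: E1 E2 E3 E4; rewrite exprMn (exprS _ k).
  have -> : L * (2^-1 ^+ 3 * d ^+ 3) * (3 / 4) ^+ k = 8^-1 * (L * d ^+ 3 * (3 / 4) ^+ k) by field.
  have -> : L * d ^+ 3 * (3 / 4 * (3 / 4) ^+ k) = 3 / 4 * (L * d ^+ 3 * (3 / 4) ^+ k) by field.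
  move: s0; set s := L * _ * _; lra.
apply: (small _ (L * (Num.max `|y - x| (Num.max `|z - y| `|z - x|)) ^+ 3)) => // k.
by apply: main => //; rewrite !le_max lexx ?orbT.
Qed.

End FlatTransport.

(** * Integrability of flat linear systems *)

Section Balls.
Context {R : realType} {V : normedModType R}.
Implicit Types (x y h : V) (r : R).

Lemma ball_segment y x h r (t : R) : ball y r x -> ball y r (x + h) ->
  0 <= t <= 1 -> ball y r (x + t *: h).
Proof.
rewrite -ball_normE /= => hx hh /andP[t0 t1].
have -> : y - (x + t *: h) = (1 - t) *: (y - x) + t *: (y - (x + h)).
  by rewrite !opprD !addrA [t *: (_ - _)]scalerBr addrA -scalerDl subrK scale1r.
rewrite (le_lt_trans (ler_normD _ _)) // !normrZ !ger0_norm ?subr_ge0 //.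
have [->|t_neq0] := eqVneq t 0; first by rewrite mul0r addr0 subr0 mul1r.
have : t * `|y - (x + h)| < t * r by rewrite ltr_pM2l // lt_def t_neq0.
have : (1 - t) * `|y - x| <= (1 - t) * r by rewrite ler_wpM2l ?subr_ge0 // ltW.
lra.
Qed.

Lemma ball_dist y x x' r : ball y r x -> ball y r x' -> `|x' - x| <= 2 * r.
Proof.
rewrite -ball_normE /= => hx hx'.
rewrite -(subrKA y) (le_trans (ler_normD _ _)) // distrC.
by move: hx hx'; lra.
Qed.

End Balls.

Section Frobenius.
Context {R : realType} {n N : nat}.
Implicit Types (y h : 'rV[R]_n).

Lemma mvi_taylor m p (f : 'rV[R]_n -> 'M[R]_(m, p)) y h (C : R) :
  (forall t : R, 0 <= t <= 1 -> differentiable f (y + t *: h)) ->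
  (forall t : R, 0 <= t <= 1 -> `|'D_h f (y + t *: h) - 'D_h f y| <= C) ->
  `|f (y + h) - f y - 'D_h f y| <= C.
Proof.
move=> df dC; apply: mx_norm_le => [|i j].
  by apply: le_trans (dC 0 _); rewrite ?lexx ?ler01.
have [|t t01] := @mvt_dir R _ (fun z => f z i j) y h.
  by move=> t t01; exact: (differentiable_mxP _ _).1 (df t t01) i j.
have d0 : differentiable f y by rewrite -[y]addr0 -(scale0r h); apply: df; rewrite lexx ler01.
have e1 : ('D_h f (y + t *: h)) i j = 'D_h (fun z => f z i j) (y + t *: h).
  by apply: derive_mxE; exact: df.
move=> e2; have -> : (f (y + h) - f y - 'D_h f y) i j = ('D_h f (y + t *: h) - 'D_h f y) i j.
  by rewrite !mxE e1 -e2.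
exact: le_trans (mx_norm_entry _ _ _) (dC t t01).
Qed.

Lemma lin_bound m p (F : 'rV[R]_n -> 'M[R]_(m, p)) (c : R) :
  (forall h, F h = \sum_i h 0 i *: F (delta_mx 0 i)) ->
  (forall i, `|F (delta_mx 0 i)| <= c) -> forall h, `|F h| <= n%:R * c * `|h|.
Proof.
move=> lF cF h; rewrite lF (le_trans (ler_norm_sum _ _ _)) //.
rewrite -mulrA mulr_natl -[X in _ <= _ *+ X]card_ord -sumr_const.
apply: ler_sum => i _; rewrite normrZ mulrC; apply: ler_pM => //.
exact: mx_norm_entry.
Qed.

Lemma locally_bounded (I : finType) (W : normedModType R) (f : I -> 'rV[R]_n -> W) y :
  (forall i, {for y, continuous (f i)}) ->
  exists2 C : R, 0 <= C & \forall z \near y, forall i, `|f i z| <= C.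
Proof.
move=> cf; exists (\sum_i (`|f i y| + 1)).
  by apply: sumr_ge0 => i _; rewrite addr_ge0.
apply: (@filter_forall _ I (fun i z => `|f i z| <= \sum_j (`|f j y| + 1)) (nbhs y)) => i.
have : \forall z \near y, `|f i y - f i z| < 1.
  by have /cvgrPdist_lt/(_ 1 ltr01) := cf i.
apply: filterS => z hz.
rewrite (bigD1 i) //= -[leLHS]addr0; apply: lerD.
  rewrite -lerBlDl (le_trans (lerB_dist _ _)) // distrC; exact: ltW.
by apply: sumr_ge0 => j _; rewrite addr_ge0.
Qed.

Variables (D : set 'rV[R]_n) (A : 'rV[R]_n -> 'rV[R]_n -> 'M[R]_N) (y0 : 'rV[R]_n).
Hypothesis oD : open D.
Hypothesis Dy0 : D y0.
Hypothesis smoothA : forall b k, Ck k D (A b).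
Hypothesis linA : forall b y, D y -> A b y = \sum_i b 0 i *: A (delta_mx 0 i) y.
Hypothesis flatA : forall a b y, D y ->
  'D_a (A b) y + A a y *m A b y = 'D_b (A a) y + A b y *m A a y.

Lemma dlinA b l y : D y ->
  'D_l (A b) y = \sum_i b 0 i *: 'D_l (A (delta_mx 0 i)) y.
Proof.
move=> Dy.
have dA i : differentiable (A (delta_mx 0 i)) y by exact: (Ck_differentiable (@smoothA (delta_mx 0 i) 0%N) Dy).
have e : {near y, A b =1 (fun z => \sum_i b 0 i *: A (delta_mx 0 i) z)}.
  by apply: filterS (open_nbhs_nbhs (conj oD Dy)) => z; exact: linA.
rewrite (near_eq_derive _ e) derive_sumf => [|i]; last exact: differentiable_scaler.
apply: eq_bigr => i _; rewrite derive_scaler // derive_cst scale0r addr0 //.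
Qed.

Lemma ddlinA b l h y : D y ->
  'D_h ('D_l (A b)) y = \sum_i b 0 i *: 'D_h ('D_l (A (delta_mx 0 i))) y.
Proof.
move=> Dy.
have dA i : differentiable ('D_l (A (delta_mx 0 i))) y.
  by have /CkS[_ c] := @smoothA (delta_mx 0 i) 1%N; exact: (Ck_differentiable (c l) Dy).
have e : {near y, 'D_l (A b) =1 (fun z => \sum_i b 0 i *: 'D_l (A (delta_mx 0 i)) z)}.
  by apply: filterS (open_nbhs_nbhs (conj oD Dy)) => z; exact: dlinA.
rewrite (near_eq_derive _ e) derive_sumf => [|i]; last exact: differentiable_scaler.
apply: eq_bigr => i _; rewrite derive_scaler // derive_cst scale0r addr0 //.
Qed.

Lemma derive_sum_dir m p (f : 'rV[R]_n -> 'M[R]_(m, p)) h y : differentiable f y ->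
  'D_h f y = \sum_i h 0 i *: 'D_(delta_mx 0 i) f y.
Proof.
move=> df; rewrite {1}(row_sum_delta h) derive_dir_sum //.
by apply: eq_bigr => i _; rewrite derive_dirZ.
Qed.

(** Continuity bounds the finitely many values on basis directions near [y0]; linearity in each slot
    extends the bound to all directions at the price of a factor [n] per slot. *)
Lemma connection_bounds : exists r C : R, [/\ 0 < r, 0 <= C, ball y0 r `<=` D &
  forall y, ball y0 r y ->
   [/\ forall b, `|A b y| <= C * `|b|,
      forall b h, `|'D_h (A b) y| <= C * `|h| * `|b| &
      forall b l h, `|'D_h ('D_l (A b)) y| <= C * `|h| * `|l| * `|b|]].
Proof.
pose e i : 'rV[R]_n := delta_mx 0 i.
have dd b l y : D y -> differentiable ('D_l (A b)) y.
  by move=> Dy; have /CkS[_ c] := @smoothA b 1%N; exact: (Ck_differentiable (c l) Dy).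
have ddd b l h y : D y -> differentiable ('D_h ('D_l (A b))) y.
  move=> Dy; have /CkS[_ /(_ l)/CkS[_ c]] := @smoothA b 2%N.
  exact: (Ck_differentiable (c h) Dy).
have d0 b y : D y -> differentiable (A b) y.
  by move=> Dy; exact: (Ck_differentiable (@smoothA b 0%N) Dy).
have [C1 C10 h1] := @locally_bounded 'I_n _ (fun i => A (e i)) y0
  (fun i => differentiable_continuous (d0 _ _ Dy0)).
have [C2 C20 h2] := @locally_bounded ('I_n * 'I_n)%type _ (fun i => 'D_(e i.1) (A (e i.2))) y0
  (fun i => differentiable_continuous (dd _ _ _ Dy0)).
have [C3 C30 h3] := @locally_bounded ('I_n * 'I_n * 'I_n)%type _
  (fun i => 'D_(e i.1.1) ('D_(e i.1.2) (A (e i.2)))) y0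
  (fun i => differentiable_continuous (ddd _ _ _ _ Dy0)).
have : \forall z \near y0, [/\ D z, forall i, `|A (e i) z| <= C1,
   forall i : 'I_n * 'I_n, `|'D_(e i.1) (A (e i.2)) z| <= C2 &
   forall i : 'I_n * 'I_n * 'I_n, `|'D_(e i.1.1) ('D_(e i.1.2) (A (e i.2))) z| <= C3].
  by near=> z; split; near: z => //; exact: (open_nbhs_nbhs (conj oD Dy0)).
move=> /nbhs_ballP[r /= r0 hr].
pose m := n%:R : R; have m0 : 0 <= m by [].
exists r, (m * C1 + m * (m * C2) + m * (m * (m * C3))).
have p1 : 0 <= m * C1 by exact: mulr_ge0.
have p2 : 0 <= m * (m * C2) by rewrite !mulr_ge0.
have p3 : 0 <= m * (m * (m * C3)) by rewrite !mulr_ge0.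
split=> //; [by rewrite !addr_ge0|by move=> z /hr[]|].
move=> y /hr[Dy b1 b2 b3]; split.
- move=> b; apply: le_trans (lin_bound (F := fun b => A b y) (c := C1) _ _ b) _.
  + by move=> h; exact: linA.
  + by move=> i; exact: b1.
  + by apply: ler_wpM2r => //; rewrite /m in p1 p2 p3 *; lra.
- move=> b h; apply: le_trans (lin_bound (F := fun b => 'D_h (A b) y)
    (c := m * C2 * `|h|) _ _ b) _.
  + by move=> l; exact: dlinA.
  + move=> i; apply: (lin_bound (F := fun h => 'D_h (A (delta_mx 0 i)) y)).
      by move=> l; apply: derive_sum_dir; exact: d0.
    by move=> j; exact: (b2 (j, i)).
  + rewrite mulrA; do 2!apply: ler_wpM2r => //; rewrite /m in p1 p2 p3 *; lra.
- move=> b l h; apply: le_trans (lin_bound (F := fun b => 'D_h ('D_l (A b)) y)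
    (c := m * (m * C3 * `|h|) * `|l|) _ _ b) _.
  + by move=> k; exact: ddlinA.
  + move=> i; apply: (lin_bound (F := fun l => 'D_h ('D_l (A (delta_mx 0 i))) y)).
      move=> k.
      have E : {near y, 'D_k (A (delta_mx 0 i)) =1
          (fun z => \sum_j k 0 j *: 'D_(delta_mx 0 j) (A (delta_mx 0 i)) z)}.
        apply: filterS (open_nbhs_nbhs (conj oD Dy)) => z Dz.
        by apply: derive_sum_dir; exact: d0.
      rewrite (near_eq_derive _ E) derive_sumf => [|j].
        by apply: eq_bigr => j _; rewrite derive_scaler ?derive_cst ?scale0r ?addr0 //; exact: dd.
      by apply: differentiable_scaler => //; exact: dd.
    move=> j; apply: (lin_bound (F := fun h => 'D_h ('D_(delta_mx 0 j) (A (delta_mx 0 i))) y)).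
      by move=> k; apply: derive_sum_dir; exact: dd.
    by move=> k; exact: (b3 ((k, j), i)).
  + rewrite (_ : _ * _ = m * (m * (m * C3)) * `|h| * `|l| * `|b|).
      by do 3!apply: ler_wpM2r => //; lra.
    by rewrite /m; ring.
Unshelve. all: by end_near.
Qed.


(** Here [a], [b] and [b'] stand for [A h x], [A l x] and [A l y], the letters [c], [c'], [p], [q],
    [q'] for first derivatives. The hypothesis on [c] and [c'] is flatness: it removes all terms of
    order at most two, and what remains on the right is small to third order. *)
Lemma defect_identity (a b b' c c' p q q' s X : 'M[R]_N) :
  c + a *m b = c' + b *m a ->
  X = 2^-1 *: (p + a *m a) -> s = 2^-1 *: (q' + b' *m b') ->
  (1%:M + a + X) *m (1%:M + b' + s)
    - (1%:M + (a + b) + 2^-1 *: (p + c + (c' + q) + (a + b) *m (a + b))) =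
  (b' - b - c) + 2^-1 *: (q' - q) + a *m (b' - b)
  + 2^-1 *: (b' *m (b' - b) + (b' - b) *m b) + a *m s + X *m (b' + s).
Proof.
rewrite !(mulmxDl, mulmxDr, mulmxN, mulNmx, mulmx1, mul1mx).
move: (a *m b) (b *m a) (a *m a) (b' *m b') (a *m b') (a *m s) (X *m b') (X *m s).
move: (b *m b) (b' *m b) => m1 m2 m3 m4 m5 m6 m7 m8 m9 m10 e1 -> ->.
have -> : c = c' + m4 - m3 by rewrite -e1 addrK.
by apply/matrixP => i j; rewrite !mxE; field.
Qed.

(* Second order Taylor polynomial of the parallel transport from [x] to [y]: flatness
   makes it multiplicative up to a cubic error. *)
Definition approx_transport (x y : 'rV[R]_n) : 'M[R]_N :=
  1%:M + A (y - x) x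
  + 2^-1 *: ('D_(y - x) (A (y - x)) x + A (y - x) x *m A (y - x) x).

Variables (r C : R).
Hypothesis C0 : 0 <= C.
Hypothesis BD : ball y0 r `<=` D.
Hypothesis CA : forall y, ball y0 r y -> forall b, `|A b y| <= C * `|b|.
Hypothesis CdA : forall y, ball y0 r y -> forall b h, `|'D_h (A b) y| <= C * `|h| * `|b|.
Hypothesis CddA : forall y, ball y0 r y -> forall b l h,
  `|'D_h ('D_l (A b)) y| <= C * `|h| * `|l| * `|b|.

Variable M : R.
Hypothesis ME : M = C + N%:R * C ^+ 2.

Lemma dA_differentiable b l y : D y -> differentiable ('D_l (A b)) y.
Proof.
by move=> Dy; have /CkS[_ c] := @smoothA b 1%N; exact: (Ck_differentiable (c l) Dy).
Qed.

Lemma A_differentiable b y : D y -> differentiable (A b) y.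
Proof. by move=> Dy; exact: (Ck_differentiable (@smoothA b 0%N) Dy). Qed.

Lemma linAD a b y : D y -> A (a + b) y = A a y + A b y.
Proof.
move=> Dy; rewrite !(linA _ Dy) -big_split /=; apply: eq_bigr => i _.
by rewrite mxE scalerDl.
Qed.

Lemma linAZ (c : R) b y : D y -> A (c *: b) y = c *: A b y.
Proof.
move=> Dy; rewrite !(linA _ Dy) scaler_sumr; apply: eq_bigr => i _.
by rewrite mxE scalerA.
Qed.

Lemma dlinAD a b l y : D y -> 'D_l (A (a + b)) y = 'D_l (A a) y + 'D_l (A b) y.
Proof.
move=> Dy; rewrite !(dlinA _ _ Dy) -big_split /=; apply: eq_bigr => i _.
by rewrite mxE scalerDl.
Qed.

Lemma second_order_bound (d : R) y h : ball y0 r y -> `|h| <= d -> 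
  `|2^-1 *: ('D_h (A h) y + A h y *m A h y)| <= 2^-1 * (M * d ^+ 2).
Proof.
move=> By hd; rewrite norm_half; apply: ler_wpM2l; first by rewrite invr_ge0.
have d0 : 0 <= d by exact: le_trans (normr_ge0 _) hd.
have h2 : `|h| ^+ 2 <= d ^+ 2 by apply: lerXn2r; rewrite ?nnegrE.
apply: le_trans (ler_normD _ _) _.
apply: le_trans (lerD (CdA By h h) (mx_norm_mul _ _)) _.
have a1 : `|A h y| ^+ 2 <= C ^+ 2 * d ^+ 2.
  rewrite -exprMn; apply: lerXn2r; rewrite ?nnegrE ?mulr_ge0 //.
  by apply: le_trans (CA By h) _; apply: ler_wpM2l.
rewrite ME mulrDl; apply: lerD; first by rewrite -mulrA -expr2; exact: ler_wpM2l.
by rewrite -(mulrA N%:R (C ^+ 2)) -(mulrA N%:R) -(expr2 `|A h y|); exact: ler_wpM2l.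
Qed.

Lemma C_le_M : C <= M.
Proof. by rewrite ME lerDl mulr_ge0 // exprn_ge0. Qed.

Lemma linear_quadratic_bound (d : R) : 0 <= d -> d <= 1 ->
  C * d + 2^-1 * (M * d ^+ 2) <= 2 * M * d.
Proof.
move=> d0 d1; have M0 : 0 <= M by exact: le_trans C_le_M.
have dd : d ^+ 2 <= d by rewrite expr2 ler_piMl.
by have := ler_wpM2r d0 C_le_M; have := ler_wpM2l M0 dd; have := mulr_ge0 M0 d0; lra.
Qed.

(** With [C <= M] the terms linear in [C] have total weight [1 + 1 / 2 <= 2] and the quadratic ones
    [1 + 1 + 1 / 2 + 1 <= 4]. *)
Lemma defect_arith (d v1 v2 v3 v4 v5 v6 : R) : 0 <= d ->
  v1 <= C * d ^+ 3 -> v2 <= C * d ^+ 3 ->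
  v3 <= N%:R * (C * d * (C * d ^+ 2)) ->
  v4 <= N%:R * (C * d * (C * d ^+ 2)) + N%:R * (C * d ^+ 2 * (C * d)) ->
  v5 <= N%:R * (C * d * (2^-1 * (M * d ^+ 2))) ->
  v6 <= N%:R * (2^-1 * (M * d ^+ 2) * (2 * M * d)) ->
  v1 + 2^-1 * v2 + v3 + 2^-1 * v4 + v5 + v6 <= (2 * C + 4 * (N%:R * (M * M))) * d ^+ 3.
Proof.
move=> d0 h1 h2 h3 h4 h5 h6.
have N0 : 0 <= N%:R :> R by [].
have M0 : 0 <= M by exact: le_trans C_le_M.
have CM := C_le_M.
have CC : N%:R * (C * C) <= N%:R * (M * M) by apply: ler_wpM2l => //; exact: ler_pM.
have CM' : N%:R * (C * M) <= N%:R * (M * M).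
  by apply: ler_wpM2l => //; exact: ler_wpM2r.
have d3 : 0 <= d ^+ 3 by rewrite exprn_ge0.
have k1 := ler_wpM2r d3 CC; have k2 := ler_wpM2r d3 CM'.
have k3 : 0 <= C * d ^+ 3 by rewrite mulr_ge0.
have e1 : N%:R * (C * d * (C * d ^+ 2)) = N%:R * (C * C) * d ^+ 3 by ring.
have e2 : N%:R * (C * d ^+ 2 * (C * d)) = N%:R * (C * C) * d ^+ 3 by ring.
have e3 : N%:R * (C * d * (2^-1 * (M * d ^+ 2))) = 2^-1 * (N%:R * (C * M) * d ^+ 3) by ring.
have e4 : N%:R * (2^-1 * (M * d ^+ 2) * (2 * M * d)) = N%:R * (M * M) * d ^+ 3 by field.
have k4 : 0 <= N%:R * (M * M) * d ^+ 3 by rewrite !mulr_ge0.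
rewrite e1 in h3; rewrite e3 in h5; rewrite e4 in h6; rewrite e1 e2 in h4.
rewrite mulrDl -(mulrA 4) -(mulrA 2).
move: h1 h2 h3 h4 h5 h6 k1 k2 k3 k4.
set w1 := N%:R * (C * C) * _; set w2 := N%:R * (C * M) * _; set w3 := N%:R * (M * M) * _.
set w4 := C * _; move: w1 w2 w3 w4 => w1 w2 w3 w4.
by lra.
Qed.

Lemma approx_transport_defect (x y z : 'rV[R]_n) (d : R) :
  ball y0 r x -> ball y0 r y -> ball y0 r z -> d <= 1 ->
  `|y - x| <= d -> `|z - y| <= d -> `|z - x| <= d ->
  `|approx_transport x y *m approx_transport y z - approx_transport x z|
   <= (2 * C + 4 * (N%:R * (M * M))) * d ^+ 3.
Proof.
move=> Bx By Bz d1 xy yz xz.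
have d0 : 0 <= d by exact: le_trans (normr_ge0 _) xy.
have [h hE] : exists h, h = y - x by exists (y - x).
have [l lE] : exists l, l = z - y by exists (z - y).
have hy : y = x + h by rewrite hE addrC subrK.
have zx : z - x = h + l by rewrite hE lE [RHS]addrC subrKA.
rewrite -hE in xy; rewrite -lE in yz.
have Dx := BD Bx; have Dy := BD By.
have Bt (t : R) : 0 <= t <= 1 -> ball y0 r (x + t *: h).
  by apply: ball_segment => //; rewrite -hy.
have E1 : A (h + l) x = A h x + A l x by exact: linAD.
have E2 : 'D_(h + l) (A (h + l)) x =
    'D_h (A h) x + 'D_h (A l) x + ('D_l (A h) x + 'D_l (A l) x).
  rewrite (derive_dirD h l (A_differentiable (h + l) Dx)).
  by rewrite (dlinAD h l h Dx) (dlinAD h l l Dx).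
have CAd k u : ball y0 r u -> `|k| <= d -> `|A k u| <= C * d.
  by move=> Bu kd; apply: le_trans (CA Bu k) _; exact: ler_wpM2l.
have [X XE] : exists X, X = 2^-1 *: ('D_h (A h) x + A h x *m A h x) by eexists.
have [s sE] : exists s, s = 2^-1 *: ('D_l (A l) y + A l y *m A l y) by eexists.
have -> : approx_transport x y *m approx_transport y z - approx_transport x z =
    (1%:M + A h x + X) *m (1%:M + A l y + s) - (1%:M + (A h x + A l x) + 2^-1 *:
    ('D_h (A h) x + 'D_h (A l) x + ('D_l (A h) x + 'D_l (A l) x)
     + (A h x + A l x) *m (A h x + A l x))).
  by rewrite /approx_transport zx -hE -lE E1 E2 -XE -sE.
rewrite (defect_identity _ (flatA h l Dx) XE sE).
have ha := CAd h x Bx xy; have hb := CAd l x Bx yz; have hb' := CAd l y By yz.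
have hbb : `|A l y - A l x| <= C * d ^+ 2.
  rewrite hy; apply: (@mvi R _ N N (A l) x h) => t t01; first exact: A_differentiable (BD (Bt t t01)).
  apply: le_trans (CdA (Bt t t01) l h) _; rewrite expr2 mulrA.
  by apply: ler_pM => //; rewrite ?mulr_ge0 //; apply: ler_wpM2l.
have hdd k : `|k| <= d -> forall t : R, 0 <= t <= 1 ->
    `|'D_k (A l) (x + t *: h) - 'D_k (A l) x| <= C * d ^+ 3.
  move=> kd t t01; apply: (@mvi R _ N N ('D_k (A l)) x (t *: h)) => u u01.
    apply: dA_differentiable; apply: BD; apply: ball_segment => //; exact: Bt.
  have Bu : ball y0 r (x + u *: (t *: h)) by apply: ball_segment => //; exact: Bt.
  apply: le_trans (CddA Bu l k (t *: h)) _.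
  have th : `|t *: h| <= d.
    rewrite normrZ; move: t01 => /andP[t0 t1]; rewrite ger0_norm //.
    by apply: le_trans xy; rewrite ler_piMl.
  rewrite (_ : C * d ^+ 3 = C * d * d * d); last by ring.
  by do 2!(apply: ler_pM => //; rewrite ?mulr_ge0 //); exact: ler_wpM2l.
have hr1 : `|A l y - A l x - 'D_h (A l) x| <= C * d ^+ 3.
  rewrite hy; apply: (@mvi_taylor N N (A l) x h) => t t01; first exact: A_differentiable (BD (Bt t t01)).
  exact: hdd.
have hr2 : `|'D_l (A l) y - 'D_l (A l) x| <= C * d ^+ 3.
  have := hdd l yz 1; rewrite scale1r -hy; apply; by rewrite lexx ler01.
have hX : `|X| <= 2^-1 * (M * d ^+ 2) by rewrite XE; exact: second_order_bound.
have hs : `|s| <= 2^-1 * (M * d ^+ 2) by rewrite sE; exact: second_order_bound.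
have hbs : `|A l y + s| <= 2 * M * d.
  apply: le_trans (ler_normD _ _) _; apply: le_trans (lerD hb' hs) _.
  exact: linear_quadratic_bound.
have prod (U W : 'M[R]_N) u w : `|U| <= u -> `|W| <= w -> `|U *m W| <= N%:R * (u * w).
  move=> hu hw; apply: le_trans (mx_norm_mul _ _) _; rewrite -mulrA.
  by apply: ler_wpM2l => //; apply: ler_pM.
have h3 := prod _ _ _ _ ha hbb.
have h4 := prod _ _ _ _ hb' hbb.
have h4' := prod _ _ _ _ hbb hb.
have h5 := prod _ _ _ _ ha hs.
have h6 := prod _ _ _ _ hX hbs.
apply: le_trans (ler_normD _ _) _; apply: le_trans (lerD (ler_normD _ _) (lexx _)) _.
apply: le_trans (lerD (lerD (ler_normD _ _) (lexx _)) (lexx _)) _.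
apply: le_trans (lerD (lerD (lerD (ler_normD _ _) (lexx _)) (lexx _)) (lexx _)) _.
apply: le_trans (lerD (lerD (lerD (lerD (ler_normD _ _) (lexx _)) (lexx _)) (lexx _)) (lexx _)) _.
rewrite !norm_half.
exact: (defect_arith d0 hr1 hr2 h3
  (le_trans (ler_normD (A l y *m (A l y - A l x)) ((A l y - A l x) *m A l x)) (lerD h4 h4')) h5 h6).
Qed.

Lemma approx_transport_near1 (x y : 'rV[R]_n) (d : R) : ball y0 r x -> ball y0 r y ->
  d <= 1 -> `|y - x| <= d -> `|approx_transport x y - 1%:M| <= 2 * M * d.
Proof.
move=> Bx By d1 xy.
have d0 : 0 <= d by exact: le_trans (normr_ge0 _) xy.
have -> : approx_transport x y - 1%:M = A (y - x) x +
    2^-1 *: ('D_(y - x) (A (y - x)) x + A (y - x) x *m A (y - x) x).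
  by rewrite /approx_transport -(addrA 1%:M) [LHS]addrC addKr.
apply: le_trans (ler_normD _ _) _.
have h1 : `|A (y - x) x| <= C * d.
  by apply: le_trans (CA Bx _) _; exact: ler_wpM2l.
apply: le_trans (lerD h1 (second_order_bound Bx xy)) _.
exact: linear_quadratic_bound.
Qed.

Let K : R := 2 * C + 4 * (N%:R * (M * M)).
Hypothesis r_gt0 : 0 < r.
Hypothesis r_small : 2 * r <= 1.
Hypothesis r_near1 : N%:R * (2 * M * (2 * r)) <= 16^-1.
Hypothesis r_defect : N%:R * (2 * K * (2 * r) ^+ 3) <= 16^-1.

(** The remainder of the first order expansion is [W y] times the error of [approx_transport] and
    its second order term, hence quadratic in the increment. *)
Lemma transport_derivative (W : 'rV[R]_n -> 'M[R]_N) T y :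
  (forall x z, ball y0 r x -> ball y0 r z -> W z = W x *m T x z) ->
  (forall x z, ball y0 r x -> ball y0 r z ->
    `|T x z - approx_transport x z| <= 2 * K * `|z - x| ^+ 3) ->
  ball y0 r y ->
  differentiable W y /\ forall a, 'D_a W y = W y *m A a y.
Proof.
move=> WT TA By; have Dy := BD By.
have lin : linear (fun a : 'rV[R]_n => W y *m A a y).
  by move=> c a b; rewrite linAD // linAZ // mulmxDr -scalemxAr.
pose LM := GRing.isLinear.Build _ _ _ _ _ lin.
pose L : {linear 'rV[R]_n -> 'M[R]_N} := HB.pack (fun a : 'rV[R]_n => W y *m A a y) LM.
have K0 : 0 <= K.
  have M0 : 0 <= M := le_trans C0 C_le_M.
  by rewrite /K addr_ge0 // ?mulr_ge0.
have M0 : 0 <= M := le_trans C0 C_le_M.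
pose Q := N%:R * `|W y| * (2 * K + 2^-1 * M).
have Q0 : 0 <= Q by rewrite /Q !mulr_ge0 // addr_ge0 // !mulr_ge0 // invr_ge0.
have est w : ball y0 r (y + w) -> `|W (y + w) - W y - L w| <= Q * `|w| * `|w|.
  move=> Bw.
  have -> : W (y + w) - W y - L w = W y *m (T y (y + w) - approx_transport y (y + w)
      + 2^-1 *: ('D_w (A w) y + A w y *m A w y)).
    rewrite (WT _ _ By Bw) /= /approx_transport (addrC y w) addrK.
    rewrite !mulmxDr mulmxN !mulmxDr mulmx1.
    set p := _ *m T _ _; set q := _ *m A w y; set s := _ *m (_ *: _).
    by apply/matrixP => i j; rewrite !mxE; ring.
  apply: le_trans (mx_norm_mul _ _) _.
  have w2 : `|w| <= 2 * r.
    by have := ball_dist By Bw; rewrite (addrC y w) addrK.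
  have w1 : `|w| <= 1 by exact: le_trans w2 r_small.
  have h1 : `|T y (y + w) - approx_transport y (y + w)| <= 2 * K * `|w| ^+ 2.
    apply: le_trans (TA _ _ By Bw) _; rewrite (addrC y w) addrK exprS.
    by apply: ler_wpM2l; rewrite ?mulr_ge0 // ler_piMl // exprn_ge0.
  have h2 := second_order_bound By (lexx `|w|).
  have h3 := le_trans (ler_normD _ _) (lerD h1 h2).
  have h4 := ler_wpM2l (mulr_ge0 (ler0n R N) (normr_ge0 (W y))) h3.
  apply: le_trans h4 _; rewrite /Q le_eqVlt; apply/orP; left; apply/eqP.
  by rewrite expr2; ring.
have [d1 d10 hd1] := open_add (ball_open y0 r) By.
have [|dW dWE] := @eps_differentiable R _ _ W y L (@linear_rV_continuous R n _ L).
  move=> e e0; exists (Num.min d1 (e / (Q + 1))).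
    by rewrite lt_min d10 divr_gt0 // ltr_wpDl.
  move=> w; rewrite lt_min => /andP[wd we].
  apply: le_trans (est _ (hd1 _ wd)) _; apply: ler_wpM2r => //.
  rewrite ltr_pdivlMr ?ltr_wpDl // in we.
  by apply: le_trans (ltW we); rewrite mulrC; apply: ler_wpM2l => //; rewrite lerDl.
by split=> // a; rewrite deriveE // dWE.
Qed.

(** Bootstrapping: the equation expresses the derivatives of [W] by [W] and the smooth [A]. *)
Lemma parallel_Ck (W : 'rV[R]_n -> 'M[R]_N) :
  (forall y, ball y0 r y -> differentiable W y /\ forall a, 'D_a W y = W y *m A a y) ->
  forall k, Ck k (ball y0 r) W.
Proof.
move=> dW; elim=> [|k IH]; first by apply/Ck0 => y /dW[].
apply/CkS; split=> [y /dW[]//|a].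
have oB : open (ball y0 r) := ball_open y0 r.
have cA : Ck k (ball y0 r) (A a) := Ck_subset BD (@smoothA a k).
apply: (Ck_ext oB _ (Ck_mulmx oB IH cA)) => y By.
by have [_ ->] := dW y By.
Qed.

Lemma small_frobenius : exists W : 'rV[R]_n -> 'M[R]_N,
  [/\ W y0 = 1%:M, forall k, Ck k (ball y0 r) W &
   forall y, ball y0 r y -> forall a, 'D_a W y = W y *m A a y].
Proof.
have M0 : 0 <= M := le_trans C0 C_le_M.
have K0 : 0 <= K by rewrite /K addr_ge0 // ?mulr_ge0.
have Bmid x y : ball y0 r x -> ball y0 r y -> ball y0 r (mid x y).
  move=> Bx By; have -> : mid x y = x + 2^-1 *: (y - x).
    by rewrite -mid_subl addrC subrK.
  apply: ball_segment => //; first by rewrite addrC subrK.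
  by rewrite invr_ge0 ler0n invf_le1 // ler1n.
have mu1 x y : ball y0 r x -> ball y0 r y ->
    N%:R * `|approx_transport x y - 1%:M| <= 16^-1.
  move=> Bx By; apply: le_trans r_near1; apply: ler_wpM2l => //.
  exact: approx_transport_near1 (ball_dist Bx By).
have mu3 x y z (d : R) : ball y0 r x -> ball y0 r y -> ball y0 r z ->
    `|y - x| <= d -> `|z - y| <= d -> `|z - x| <= d ->
    `|approx_transport x y *m approx_transport y z - approx_transport x z| <= K * d ^+ 3.
  move=> Bx By Bz xy yz xz.
  (* The bound is wanted for every [d], but the estimate requires [d <= 1]; the longest side
     satisfies this because the ball is small. *)
  pose e := Num.max `|y - x| (Num.max `|z - y| `|z - x|).
  have ed : e <= d by rewrite !ge_max xy yz xz.
  have e0 : 0 <= e by rewrite !le_max normr_ge0.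
  apply: le_trans (ler_wpM2l K0 (lerXn2r 3 _ _ ed)); rewrite ?nnegrE //; last first.
    exact: le_trans ed.
  apply: approx_transport_defect => //; rewrite ?le_max ?lexx ?orbT //.
  have le1 u w : ball y0 r u -> ball y0 r w -> `|w - u| <= 1.
    by move=> Bu Bw; exact: le_trans (ball_dist Bu Bw) r_small.
  by rewrite !ge_max !le1.
have [T [TM TA]] := flat_transport K0 Bmid mu1 (fun x y => @ball_dist R _ y0 x y r) r_defect mu3.
have B0 : ball y0 r y0 by exact: ballxx.
(* The error bound is cubic in the distance, hence zero here, and [approx_transport y0 y0] is the
   identity. *)
have T1 : T y0 y0 = 1%:M.
  apply/eqP; rewrite -subr_eq0 -normr_le0.
  have := TA _ _ B0 B0; rewrite subrr normr0 expr0n mulr0.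
  have A0 : A 0 y0 = 0 by rewrite -(scale0r 0) (linAZ _ _ Dy0) scale0r.
  by rewrite /approx_transport subrr A0 derive0 mul0mx !addr0 scaler0 addr0.
have WT x z : ball y0 r x -> ball y0 r z -> T y0 z = T y0 x *m T x z.
  by move=> Bx Bz; rewrite TM.
have dW y := @transport_derivative (T y0) T y WT TA.
exists (T y0); split=> //; first exact: parallel_Ck.
by move=> y By a; have [_ ->] := dW y By.
Qed.

End Frobenius.

(** The last hypothesis is the equality of mixed derivatives of a solution: differentiating
    [W *m A a] along [b] gives [W *m ('D_b (A a) + A b *m A a)]. *)
Lemma frobenius (R : realType) (n N : nat) (D : set 'rV[R]_n)
    (A : 'rV[R]_n -> 'rV[R]_n -> 'M[R]_N) (y0 : 'rV[R]_n) :
  open D -> D y0 -> (forall b k, Ck k D (A b)) ->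
  (forall b y, D y -> A b y = \sum_i b 0 i *: A (delta_mx 0 i) y) ->
  (forall a b y, D y ->
    'D_a (A b) y + A a y *m A b y = 'D_b (A a) y + A b y *m A a y) ->
  exists (r : R) (W : 'rV[R]_n -> 'M[R]_N), [/\ 0 < r, ball y0 r `<=` D, W y0 = 1%:M,
    forall k, Ck k (ball y0 r) W &
    forall y, ball y0 r y -> forall a, 'D_a W y = W y *m A a y].
Proof.
move=> oD Dy0 sA lA fA.
have [r0 [C [r00 C0 BD bnd]]] := connection_bounds oD Dy0 sA lA.
pose M := C + N%:R * C ^+ 2.
pose K := 2 * C + 4 * (N%:R * (M * M)).
have M0 : 0 <= M by rewrite /M addr_ge0 // mulr_ge0 // exprn_ge0.
have K0 : 0 <= K by rewrite /K addr_ge0 // ?mulr_ge0.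
(* With [2 * r <= X^-1] all three smallness conditions on [r] hold; the cubic one is weakened to a
   linear one by [2 * r <= 1]. *)
pose X := 1 + 16 * (N%:R * (2 * M)) + 16 * (N%:R * (2 * K)).
have p1 : 0 <= N%:R * (2 * M) by rewrite !mulr_ge0.
have p2 : 0 <= N%:R * (2 * K) by rewrite !mulr_ge0.
have X1 : 1 <= X by rewrite /X; lra.
have X0 : 0 < X by lra.
pose r := Num.min r0 (X^-1 / 2).
have r_gt0 : 0 < r by rewrite lt_min r00 divr_gt0 // invr_gt0.
have rr0 : r <= r0 by rewrite ge_min lexx.
have rX : 2 * r <= X^-1.
  have : r <= X^-1 / 2 by rewrite ge_min lexx orbT.
  lra.
have r1 : 2 * r <= 1 by apply: le_trans rX _; rewrite invf_le1.
have sub : ball y0 r `<=` ball y0 r0 by exact: le_ball.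
have XrX : X * (2 * r) <= 1 by rewrite -ler_pdivlMl // mulr1.
have bound c : 0 <= c -> 16 * c <= X -> c * (2 * r) <= 16^-1.
  move=> c0 cX; have r20 : 0 <= 2 * r by lra.
  by have := ler_wpM2r r20 cX; lra.
have [W [W0 Wk WD]] : exists W : 'rV[R]_n -> 'M[R]_N,
  [/\ W y0 = 1%:M, forall k, Ck k (ball y0 r) W &
   forall y, ball y0 r y -> forall a, 'D_a W y = W y *m A a y].
  apply: (@small_frobenius R n N D A y0 oD Dy0 sA lA fA r C C0 _ _ _ _ M erefl) => //.
  - exact: subset_trans BD.
  - by move=> y /sub/bnd[].
  - by move=> y /sub/bnd[].
  - by move=> y /sub/bnd[].
  - by rewrite mulrA; apply: bound => //; rewrite /X; lra.
  - rewrite -/K mulrA; apply: le_trans (bound _ p2 _); last by rewrite /X; lra.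
    apply: ler_wpM2l => //; rewrite -[leRHS]expr1; apply: ler_wiXn2l => //; lra.
exists r, W; split=> //; exact: subset_trans BD.
Qed.

(** * The inverse function theorem *)

Section InverseFunction.
Context {R : realType} {n : nat}.
Implicit Types (z h : 'rV[R]_n).

Lemma jacobian_entry m (F : 'rV[R]_n -> 'rV[R]_m) z i j : differentiable F z ->
  jacobian F z i j = 'D_(delta_mx 0 i) F z 0 j.
Proof. by move=> dF; rewrite deriveE // /jacobian mxE. Qed.

Lemma Ck_jacobian m (F : 'rV[R]_n -> 'rV[R]_m) k D : open D -> Ck k.+1 D F ->
  Ck k D (jacobian F).
Proof.
move=> oD /CkS[dF cF]; apply/Ck_mxP => // i j.
apply: (Ck_ext oD _ ((Ck_mxP _ _ oD).1 (cF (delta_mx 0 i)) 0 j)) => z Dz.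
by rewrite jacobian_entry //; exact: dF.
Qed.

Lemma inj_unitmx (J : 'M[R]_n) :
  (forall h : 'rV[R]_n, h *m J = 0 -> h = 0) -> J \in unitmx.
Proof. by move=> hJ; rewrite -row_free_unit; exact: inj_row_free. Qed.

(** Fixed point iteration of [u |-> w - g u] from [z]. The first step has length [C < rho / 2], so
    the iterates and their limit stay within [2 * C < rho] of [z]. *)
Lemma perturbation_of_id_onto (B : set 'rV[R]_n) (g : 'rV[R]_n -> 'rV[R]_n) z w (rho : R) :
  (forall u v, B u -> B v -> `|g u - g v| <= 2^-1 * `|u - v|) ->
  ball z rho `<=` B -> `|w - (g z + z)| < rho / 2 ->
  exists2 u, ball z rho u & g u + u = w.
Proof.
move=> gB sB hw; pose C := `|w - (g z + z)|.
pose T u := w - g u; pose u k := iter k T z.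
have half0 k : 0 <= 2^-1 ^+ k :> R by rewrite exprn_ge0 // invr_ge0.
have C0 : 0 <= C by exact: normr_ge0.
have inB v : `|v - z| <= 2 * C -> ball z rho v.
  by rewrite -ball_normE /= distrC => /le_lt_trans; apply; move: hw; rewrite -/C; lra.
have [st cl] : (forall k, `|u k.+1 - u k| <= C * 2^-1 ^+ k) /\
    (forall k, `|u k - z| <= 2 * C * (1 - 2^-1 ^+ k)).
  suff : forall k, `|u k.+1 - u k| <= C * 2^-1 ^+ k /\ `|u k - z| <= 2 * C * (1 - 2^-1 ^+ k).
    by move=> h; split=> k; case: (h k).
  elim=> [|k [IH1 IH2]].
    rewrite expr0 mulr1 (subrr 1) mulr0 /u /= subrr normr0; split=> //.
    by rewrite /T /C opprD addrA.
  have cS : `|u k.+1 - z| <= 2 * C * (1 - 2^-1 ^+ k.+1).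
    rewrite -(subrKA (u k)) (le_trans (ler_normD _ _)) //.
    apply: le_trans (lerD IH1 IH2) _; rewrite (exprS _ k).
    by set b := _ ^+ k; rewrite le_eqVlt; apply/orP; left; apply/eqP; field.
  have le2C j : `|u j - z| <= 2 * C * (1 - 2^-1 ^+ j) -> B (u j).
    move=> hj; apply/sB/inB; apply: le_trans hj _.
    by rewrite ler_piMr ?mulr_ge0 // gerBl.
  split=> //; rewrite [X in `|X|](_ : _ = - (g (u k.+1) - g (u k))); last first.
    by rewrite [u k.+2]iterS [X in _ - X]iterS /T opprB addrC subrKA opprB.
  rewrite normrN (le_trans (gB _ _ (le2C _ cS) (le2C _ IH2))) // (exprS _ k).
  by move: IH1; set b := _ ^+ k; lra.
have [l hl] := @geometric_limit R 'rV[R]_n u C st.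
have lz : `|l - z| <= 2 * C by have := hl 0%N; rewrite expr0 mulr1.
have Bl := inB _ lz; exists l => //.
apply/eqP; rewrite -subr_eq0 -normr_le0; apply/ler_addgt0Pl => e e0; rewrite addr0.
have [|k hk] := geometric_small (4 * C) (q := 2^-1) _ e0.
  by rewrite invr_ge0 ler0n invf_lt1 // ltr1n.
have Bu : B (u k).
  apply/sB/inB; apply: le_trans (cl k) _.
  by rewrite ler_piMr ?mulr_ge0 // gerBl.
rewrite [X in `|X|](_ : _ = (g l - g (u k)) + (l - u k.+1)); last first.
  by rewrite [u k.+1]iterS /T; move: (g l) (g _) => a b; apply/rowP => i; rewrite !mxE; ring.
apply: le_trans (ler_normD _ _) _; apply: le_trans (ltW hk).
have h1 := le_trans (gB _ _ (sB _ Bl) Bu) (ler_wpM2l _ (hl k)).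
apply: le_trans (lerD (h1 _) (hl k.+1)) _; first by rewrite invr_ge0.
rewrite (exprS _ k); have := mulr_ge0 C0 (half0 k).
by set b := _ ^+ k; lra.
Qed.

Lemma inverse_function (F : 'rV[R]_n -> 'rV[R]_n) (D : set 'rV[R]_n) z0 :
  open D -> D z0 -> (forall k, Ck k D F) ->
  (forall h, 'D_h F z0 = 0 -> h = 0) ->
  exists (r : R) (G : 'rV[R]_n -> 'rV[R]_n),
    [/\ 0 < r, ball z0 r `<=` D, open (F @` ball z0 r),
        forall z, ball z0 r z -> G (F z) = z & forall k, Ck k (F @` ball z0 r) G].
Proof.
move=> oD Dz0 cF injF.
have dF z : D z -> differentiable F z by exact: (Ck_differentiable (cF 0%N)).
pose J := jacobian F z0.
have uJ : J \in unitmx.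
  by apply: inj_unitmx => h; rewrite -deriveEjacobian; [exact: injF|exact: dF].
(* After normalization by the derivative at [z0], [F] is a perturbation of the identity by [g],
   whose derivative vanishes at [z0] and which is therefore a contraction nearby. *)
pose g z := F z *m invmx J - z.
have dg z : D z -> differentiable g z /\ forall h, 'D_h g z = 'D_h F z *m invmx J - h.
  move=> Dz.
  have d1 : differentiable (fun z => F z *m invmx J) z.
    by apply: differentiable_mulmx; [exact: dF|exact: differentiable_cst].
  have d2 : differentiable (fun z : 'rV[R]_n => z) z by [].
  split; first exact: (differentiableB d1 d2).
  move=> h; have e1 : 'D_h (fun z => F z *m invmx J) z = 'D_h F z *m invmx J.
    by apply: derive_mulmxr; exact: dF.
  by have := derive_subf h d1 d2; rewrite e1 derive_id.
have [r r0 [BD small]] : exists2 r : R, 0 < r & ball z0 r `<=` D /\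
    forall z, ball z0 r z -> forall h, `|'D_h g z| <= 2^-1 * `|h|.
  (* Chosen so that [n * c <= 1 / 2]; the successor avoids a division by zero in dimension 0. *)
  pose c : R := (2 * n.+1%:R)^-1.
  have c0 : 0 < c by rewrite invr_gt0 mulr_gt0.
  have cDF i : {for z0, continuous ('D_(delta_mx 0 i) F)}.
    apply: differentiable_continuous.
    by have /CkS[_ cF1] := cF 1%N; exact: (Ck_differentiable (cF1 _) Dz0).
  pose K : R := n%:R * `|invmx J| + 1.
  have K0 : 0 < K by rewrite ltr_wpDl // mulr_ge0.
  have nearD : \forall z \near z0, D z /\
      forall i : 'I_n, `|'D_(delta_mx 0 i) F z0 - 'D_(delta_mx 0 i) F z| < c / K.
    near=> z; split; first by near: z; exact: (open_nbhs_nbhs (conj oD Dz0)).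
    near: z; apply: (@filter_forall _ 'I_n
      (fun i z => `|'D_(delta_mx 0 i) F z0 - 'D_(delta_mx 0 i) F z| < c / K) (nbhs z0)) => i.
    by have /cvgrPdist_lt/(_ _ (divr_gt0 c0 K0)) := cDF i.
  move/nbhs_ballP: nearD => [r /= r0 hr]; exists r => //; split; first by move=> z /hr[].
  move=> z /hr[Dz hz] h; have [dgz Dgz] := dg z Dz.
  have lin v : 'D_v g z = \sum_i v 0 i *: 'D_(delta_mx 0 i) g z by exact: derive_sum_dir.
  have bnd i : `|'D_(delta_mx 0 i) g z| <= c.
    have e0 : 'D_(delta_mx 0 i) F z0 *m invmx J = delta_mx 0 i.
      by rewrite deriveEjacobian ?mulmxK //; exact: dF.
    rewrite Dgz -{2}e0 -mulmxBl (le_trans (mx_norm_mul _ _)) //.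
    have hzi : `|'D_(delta_mx 0 i) F z - 'D_(delta_mx 0 i) F z0| <= c / K.
      by rewrite -normrN opprB; exact: ltW (hz i).
    have := ler_wpM2l (ltW K0) hzi; rewrite mulrCA divff ?gt_eqF // mulr1.
    apply: le_trans; rewrite mulrAC; apply: ler_wpM2r => //.
    by rewrite /K lerDl.
  apply: le_trans (lin_bound (F := fun h => 'D_h g z) lin bnd h) _.
  apply: ler_wpM2r => //; rewrite /c invfM mulrCA ler_piMr ?invr_ge0 //.
  by rewrite ler_pdivrMr // mul1r ler_nat.
have BDz z : ball z0 r z -> D z by exact: BD.
have seg u v (t : R) : ball z0 r u -> ball z0 r v -> 0 <= t <= 1 ->
    ball z0 r (u + t *: (v - u)).
  by move=> Bu Bv; apply: ball_segment => //; rewrite addrC subrK.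
have contr u v : ball z0 r u -> ball z0 r v -> `|g u - g v| <= 2^-1 * `|u - v|.
  move=> Bu Bv; have {1}-> : u = v + (u - v) by rewrite addrC subrK.
  apply: (@mvi R _ 1 n g v (u - v)) => t t01.
    by have [] := dg _ (BDz _ (seg _ _ _ Bv Bu t01)).
  exact: small _ (seg _ _ _ Bv Bu t01) _.
have HE z : F z *m invmx J = g z + z by rewrite /g subrK.
have lip (u v : 'rV[R]_n) : ball z0 r u -> ball z0 r v ->
    `|u - v| <= 2 * n%:R * `|invmx J| * `|F u - F v|.
  move=> Bu Bv.
  have e1 : u - v = (F u - F v) *m invmx J - (g u - g v).
    rewrite mulmxBl !HE; move: (g u) (g v) => a b.
    by apply/rowP => i; rewrite !mxE; ring.
  have h1 := ler_normB ((F u - F v) *m invmx J) (g u - g v); rewrite -e1 in h1.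
  have h2 := contr u v Bu Bv; have h3 := mx_norm_mul (F u - F v) (invmx J).
  move: h1 h2 h3; set a := `|u - v|; set b := `|g u - g v|; set c := `|_ *m _|.
  set d := `|invmx J|; set e := `|F u - F v| => h1 h2 h3.
  have -> : 2 * n%:R * d * e = 2 * (n%:R * e * d) by ring.
  lra.
pose G w := xget z0 [set z | ball z0 r z /\ F z = w].
have GF z : ball z0 r z -> G (F z) = z.
  move=> Bz; rewrite /G; case: xgetP => [u _ [Bu Fu]|/(_ z)]; last by case.
  apply/eqP; rewrite -subr_eq0 -normr_le0.
  by have := lip u z Bu Bz; rewrite Fu subrr normr0 mulr0.
pose O := F @` ball z0 r.
have oO : open O.
  rewrite openE => _ [z Bz <-].
  have [rho rho0 hrho] := open_add (ball_open z0 r) Bz.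
  have sub : ball z rho `<=` ball z0 r.
    move=> u hu; have -> : u = z + (u - z) by rewrite addrC subrK.
    by apply: hrho; move: hu; rewrite -ball_normE /= distrC.
  pose K : R := n%:R * `|invmx J| + 1.
  have K0 : 0 < K by rewrite ltr_wpDl // mulr_ge0.
  apply/nbhs_ballP; exists (rho / 2 / K); first exact: (divr_gt0 (divr_gt0 rho0 (ltr0Sn R 1)) K0).
  move=> w; rewrite -ball_normE /= => hw.
  have [|u Bu uE] := @perturbation_of_id_onto (ball z0 r) g z (w *m invmx J) rho contr sub.
    rewrite -(HE z) -mulmxBl; apply: le_lt_trans (mx_norm_mul _ _) _.
    rewrite ltr_pdivlMr // in hw; apply: le_lt_trans hw.
    by rewrite (distrC w) mulrAC mulrC; apply: ler_wpM2l => //; rewrite lerDl.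
  exists u; first exact: sub.
  by have := congr1 (mulmxr J) uE; rewrite /= -(HE u) !mulmxKV.
(* A vector killed by the derivative of [F] is sent by that of [g] to its opposite, against the
   contraction bound. The ball thus serves all orders of differentiability. *)
have uJz z : ball z0 r z -> jacobian F z \in unitmx.
  move=> Bz; apply: inj_unitmx => h; rewrite -deriveEjacobian; last exact: dF (BDz _ Bz).
  move=> e0; have [_ Dgz] := dg z (BDz _ Bz).
  have := small z Bz h; rewrite Dgz e0 mul0mx sub0r normrN => hh.
  by apply/eqP; rewrite -normr_le0; lra.
have dG z : ball z0 r z -> differentiable G (F z) /\
    forall v, 'D_v G (F z) = v *m invmx (jacobian F z).
  move=> Bz; pose L := mulmxr (invmx (jacobian F z)) : {linear 'rV[R]_n -> 'rV[R]_n}.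
  have OFz : O (F z) by exists z.
  have [d1 d10 hd1] := open_add oO OFz.
  have [|dGz dGE] := @eps_differentiable R _ _ G (F z) L (@linear_rV_continuous R n _ L).
    move=> e e0.
    have [La LaE] : exists La : R, La = 2 * n%:R * `|invmx J| + 1 by exact: (ex_intro _ _ erefl).
    have La0 : 0 < La by rewrite LaE ltr_wpDl // !mulr_ge0.
    have [K KE] : exists K : R, K = n%:R * `|invmx (jacobian F z)| + 1 by exact: (ex_intro _ _ erefl).
    have K0 : 0 < K by rewrite KE; exact: (ltr_wpDl (mulr_ge0 (ler0n R n) (normr_ge0 _)) ltr01).
    have e'0 : 0 < e / (K * La) := divr_gt0 e0 (mulr_gt0 K0 La0).
    have [d2 d20 hd2] := differentiable_eps (dF z (BDz _ Bz)) e'0.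
    exists (Num.min d1 (d2 / La)); first by rewrite lt_min d10 (divr_gt0 d20 La0).
    move=> v; rewrite lt_min => /andP[vd1 vd2].
    have [u Bu uE] := hd1 v vd1.
    suff : `|G (F z + v) - G (F z) - v *m invmx (jacobian F z)| <= e * `|v| by [].
    rewrite -uE (GF u Bu) (GF z Bz).
    have uv : `|u - z| <= La * `|v|.
      have Fv : F u - F z = v by rewrite uE (addrC (F z)) addrK.
      have := lip u z Bu Bz; rewrite Fv => /le_trans; apply.
      by apply: ler_wpM2r => //; rewrite LaE lerDl.
    have -> : u - z - v *m invmx (jacobian F z) =
        - ((F (z + (u - z)) - F z - 'd F z (u - z)) *m invmx (jacobian F z)).
      have Fv : F u - F z = v by rewrite uE (addrC (F z)) addrK.
      have zu : z + (u - z) = u by rewrite addrC subrK.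
      have du : 'd F z (u - z) = (u - z) *m jacobian F z.
        by rewrite -deriveE ?deriveEjacobian //; exact: dF (BDz _ Bz).
      by rewrite zu du Fv mulmxBl mulmxK ?uJz // opprB.
    rewrite normrN; apply: le_trans (mx_norm_mul _ _) _.
    have uzd : `|u - z| < d2.
      by apply: le_lt_trans uv _; rewrite mulrC -ltr_pdivlMr.
    have h1 := le_trans (hd2 _ uzd) (ler_wpM2l (ltW e'0) uv).
    have h2 := ler_wpM2l (ltW K0) h1.
    have e1 : K * (e / (K * La) * (La * `|v|)) = e * `|v|.
      by field; rewrite !gt_eqF.
    rewrite e1 in h2; apply: le_trans h2; rewrite mulrAC; apply: ler_wpM2r => //.
    by rewrite KE lerDl.
  by split=> // v; rewrite deriveE // dGE.
exists r, G; split=> // k.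
have GB y : O y -> ball z0 r (G y) by move=> [z Bz <-]; rewrite GF.
(* The derivative of [G] is the inverse Jacobian of [F] composed with [G], so one order of
   regularity is gained at each step. *)
elim: k => [|k IH]; first by apply/Ck0 => _ [z Bz <-]; have [] := dG z Bz.
apply/CkS; split=> [_ [z Bz <-]|v]; first by have [] := dG z Bz.
have cJ : Ck k O (jacobian F \o G).
  apply: (Ck_comp oO GB IH); apply: (Ck_subset BD).
  exact: Ck_jacobian.
have cI : Ck k O (fun y => v *m invmx ((jacobian F \o G) y)).
  apply: Ck_mulmx => //; first exact: Ck_cst.
  by apply: Ck_invmx; [exact: oO|move=> y /GB; exact: uJz|exact: cJ].
apply: (Ck_ext oO _ cI) => _ [z Bz <-]; have [_ ->] := dG z Bz.
by rewrite /= GF.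
Unshelve. all: by end_near.
Qed.

End InverseFunction.

(** * Linear algebra *)

Section Dot.
Context {R : realType}.

Lemma dotE m (u v : 'rV[R]_m) : dot u v = \sum_i u 0 i * v 0 i.
Proof. by rewrite /dot mxE; apply: eq_bigr => i _; rewrite mxE. Qed.

Lemma dot_ge0 m (u : 'rV[R]_m) : 0 <= dot u u.
Proof. by rewrite dotE; apply: sumr_ge0 => i _; rewrite -expr2 sqr_ge0. Qed.

Lemma dot_eq0 m (u : 'rV[R]_m) : dot u u = 0 -> u = 0.
Proof.
rewrite dotE => /eqP; rewrite psumr_eq0 => [/allP h|i _]; last by rewrite -expr2 sqr_ge0.
apply/rowP => i; rewrite mxE; apply/eqP; rewrite -sqrf_eq0 expr2.
by apply: h; rewrite mem_index_enum.
Qed.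

Lemma dot_gt0 m (u : 'rV[R]_m) : u != 0 -> 0 < dot u u.
Proof. by move=> u0; rewrite lt_def dot_ge0 andbT; apply: contraNneq u0 => /dot_eq0->. Qed.

Lemma dotC m (u v : 'rV[R]_m) : dot u v = dot v u.
Proof. by rewrite !dotE; apply: eq_bigr => i _; rewrite mulrC. Qed.

Lemma dot_mulmxl m p (u : 'rV[R]_m) (A : 'M[R]_(m, p)) v :
  dot (u *m A) v = dot u (v *m A^T).
Proof. by rewrite /dot trmx_mul trmxK mulmxA. Qed.

Lemma mulmx_tr_eq0 m p (A : 'M[R]_(m, p)) : A *m A^T = 0 -> A = 0.
Proof.
move=> AA; apply/row_matrixP => i; rewrite row0; apply: dot_eq0.
have := congr1 (fun B : 'M[R]_m => B i i) AA; rewrite !mxE => <-.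
by rewrite dotE; apply: eq_bigr => l _; rewrite !mxE.
Qed.

End Dot.

(** * The Cauchy-Binet formula *)

Section CauchyBinet.
Context {R : realType} {n m : nat}.
Implicit Types (a c : 'M[R]_(n, m)).

Lemma det_mul_sum a c : \det (a *m c^T) =
  \sum_(f : {ffun 'I_n -> 'I_m}) (\prod_i a i (f i)) * \det (colsub f c).
Proof.
rewrite /determinant.
transitivity (\sum_(s : 'S_n) \sum_(f : {ffun 'I_n -> 'I_m})
    (-1) ^+ s * \prod_i (a i (f i) * c (s i) (f i))).
  apply: eq_bigr => s _; rewrite -big_distrr /=; congr (_ * _).
  rewrite -(bigA_distr_bigA (fun i j => a i j * c (s i) j)).
  by apply: eq_bigr => i _; rewrite mxE; apply: eq_bigr => j _; rewrite mxE.
rewrite exchange_big /=; apply: eq_bigr => f _.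
rewrite -[X in _ = _ * X]/(\det (colsub f c)) -det_tr /determinant.
rewrite big_distrr /=; apply: eq_bigr => s _.
rewrite big_split /= mulrCA; congr (_ * (_ * _)).
by apply: eq_bigr => i _; rewrite !mxE.
Qed.

Lemma det_colsub_noninj (f : {ffun 'I_n -> 'I_m}) c :
  ~~ injectiveb f -> \det (colsub f c) = 0.
Proof.
move=> /injectivePn[i [j ij fij]]; rewrite -det_tr.
by apply: (determinant_alternate ij) => l; rewrite !mxE fij.
Qed.

Lemma det_colsub_perm (f : 'I_n -> 'I_m) (s : 'S_n) c :
  \det (colsub (f \o s) c) = (-1) ^+ s * \det (colsub f c).
Proof.
have -> : colsub (f \o s) c = col_perm s (colsub f c).
  by apply/matrixP => i j; rewrite !mxE.
by rewrite col_permE det_mulmx det_perm odd_permV mulrC.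
Qed.

Lemma multi_indexP (J : multi_index n m) (i j : 'I_n) : (i < j)%N -> (val J i < val J j)%N.
Proof. by move=> ij; have /forallP/(_ i)/forallP/(_ j)/implyP := valP J; apply. Qed.

Lemma multi_index_inj (J : multi_index n m) : injective (val J).
Proof.
move=> i j Jij; apply: val_inj.
case: (ltngtP i j) => // ij; have := @multi_indexP J _ _ ij.
  by rewrite (congr1 val Jij) ltnn.
by rewrite (congr1 val Jij) ltnn.
Qed.

Let arrange (p : multi_index n m * 'S_n) : {ffun 'I_n -> 'I_m} :=
  [ffun i => val p.1 (p.2 i)].

Let lto : rel 'I_m := fun i j => (i < j)%N.

(** The set of values determines the increasing multi-index, since two sorted lists with the same
    elements agree; the permutation then follows by injectivity. *)
Lemma arrange_inj : injective arrange.
Proof.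
move=> [J s] [J' s'] /ffunP e.
have e' i : val J (s i) = val J' (s' i) by have := e i; rewrite !ffunE.
have sJ (K : multi_index n m) : sorted lto [seq val K i | i <- enum 'I_n].
  have : sorted (fun i j : 'I_n => (i < j)%N) (enum 'I_n).
    by have := iota_ltn_sorted 0 n; rewrite -val_enum_ord sorted_map.
  apply: homo_sorted => i j; exact: multi_indexP.
have eJ : [seq val J i | i <- enum 'I_n] = [seq val J' i | i <- enum 'I_n].
  apply: (@irr_sorted_eq _ lto) => //.
  - by move=> x y z; exact: ltn_trans.
  - by move=> x; rewrite /lto ltnn.
  - move=> x; apply/mapP/mapP => -[i _ ->].
      by exists (s' (s^-1 i)%g); rewrite ?mem_enum // -e' permKV.
    by exists (s (s'^-1 i)%g); rewrite ?mem_enum // e' permKV.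
have JJ : J = J'.
  apply: val_inj; apply/ffunP => i.
  have nthJ (K : multi_index n m) (l : 'I_n) x :
      nth x [seq val K i | i <- enum 'I_n] l = val K l.
    by rewrite (nth_map l) ?size_enum_ord // nth_ord_enum.
  by rewrite -(nthJ J i (val J i)) eJ nthJ.
subst J'; congr (_, _); apply/permP => i; exact: (multi_index_inj (e' i)).
Qed.

(** For injective [f], sorting its values gives the multi-index, and the rank of each [f i] among
    them gives the permutation. *)
Lemma arrange_image : [set arrange p | p in [set: multi_index n m * 'S_n]]%SET =
  [set f : {ffun 'I_n -> 'I_m} | injectiveb f]%SET.
Proof.
apply/setP => f; rewrite inE; apply/imsetP/injectiveP => [[[J s] _ ->] i j|fi].
  by rewrite !ffunE /= => /multi_index_inj/perm_inj.
pose q := sort (fun a b : 'I_m => (a <= b)%N) (codom f).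
have qu : uniq q by rewrite sort_uniq; apply/injectiveP.
have qs : size q = n by rewrite size_sort size_codom card_ord.
have qlt : sorted lto q.
  have : sorted (fun a b : 'I_m => (a <= b)%N) q.
    by apply: sort_sorted => a b; exact: leq_total.
  move=> sq; have : sorted ltn (map val q).
    by rewrite ltn_sorted_uniq_leq (map_inj_uniq val_inj) qu /= sorted_map.
  by rewrite sorted_map.
have fq i : f i \in q by rewrite mem_sort codom_f.
have iq i : (index (f i) q < n)%N by rewrite -[X in (_ < X)%N]qs index_mem.
pose J : {ffun 'I_n -> 'I_m} := [ffun i => nth (f i) q i].
have JP : [forall i : 'I_n, forall j : 'I_n, (i < j)%N ==> (J i < J j)%N].
  apply/forallP => i; apply/forallP => j; apply/implyP => ij; rewrite !ffunE.
  rewrite (set_nth_default (f j)) ?qs //.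
  by apply: (sorted_ltn_nth _ (f j) qlt) => //; [by move=> x y z; exact: ltn_trans| |]; rewrite inE qs.
have si : injective (fun i => Ordinal (iq i)).
  move=> i j /(congr1 val) /= e; apply: fi.
  by rewrite -(nth_index (f i) (fq i)) e nth_index.
exists (exist _ J JP, perm si) => //.
by apply/ffunP => i; rewrite !ffunE /= permE ?ffunE /= nth_index.
Qed.

(** Expanding the determinant produces a sum over all index functions. Those that are not injective
    give a minor with two equal columns; the others are a multi-index followed by a permutation,
    whose sign reassembles the minor of [a]. *)
Lemma dot_wedge a c : dot (wedge a) (wedge c) = \det (a *m c^T).
Proof.
rewrite det_mul_sum (bigID (fun f : {ffun 'I_n -> 'I_m} => injectiveb f)) /=.
rewrite [X in _ + X]big1 ?addr0; last first.
  by move=> f fi; rewrite det_colsub_noninj // mulr0.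
transitivity (\sum_(f in [set f : {ffun 'I_n -> 'I_m} | injectiveb f]%SET)
    (\prod_i a i (f i)) * \det (colsub f c)); last first.
  by apply: eq_bigl => f; rewrite inE.
rewrite -arrange_image big_imset /=; last by move=> p q _ _; exact: arrange_inj.
transitivity (\sum_(J : multi_index n m) \sum_(s : 'S_n)
    (\prod_i a i (arrange (J, s) i)) * \det (colsub (arrange (J, s)) c)); last first.
  rewrite pair_big /=; apply: eq_big => [p|[J s] _ //]; by rewrite inE.
rewrite dotE; under eq_bigr do rewrite !mxE.
rewrite -(big_enum_val (A := {: multi_index n m}) (fun J =>
  \det (colsub (val J) a) * \det (colsub (val J) c))) /=.
apply: eq_bigr => J _.
rewrite {1}/determinant big_distrl /=; apply: eq_bigr => s _.
have -> : colsub (arrange (J, s)) c = colsub (val J \o s) c.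
  by apply/matrixP => i j; rewrite !mxE ffunE.
rewrite det_colsub_perm mulrA; congr (_ * _); rewrite mulrC; congr (_ * _).
by apply: eq_bigr => i _; rewrite !mxE ffunE.
Qed.

End CauchyBinet.

(** * Gram matrices and generic combinations of commuting symmetric matrices *)

Section Gram.
Context {R : realType}.

(** Cholesky reduction: [L] clears the first row and column and leaves the Schur complement [D'],
    again positive definite. The sign of the determinant is recorded because orthonormalization must
    preserve orientations. *)
Lemma spd_congruence n (S : 'M[R]_n) : S^T = S ->
  (forall x : 'rV[R]_n, x != 0 -> 0 < (x *m S *m x^T) 0 0) ->
  exists G : 'M[R]_n, G *m S *m G^T = 1%:M /\ 0 < \det G.
Proof.
elim: n S => [|n IH] S sS pS.
  exists 1%:M; split; first by apply/matrixP => -[].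
  by rewrite det1.
move: S sS pS; rewrite -[n.+1]/(1 + n)%N => S sS pS.
pose s := S 0 0; pose u := ursubmx S; pose D := drsubmx S.
have ulS : ulsubmx S = s%:M.
  by apply/matrixP => i j; rewrite !ord1 !mxE /= mulr1n; congr (S _ _); apply: val_inj.
have dlS : dlsubmx S = u^T by rewrite /u trmx_ursub sS.
have SE : S = block_mx s%:M u u^T D by rewrite -ulS -dlS submxK.
have sD : D^T = D by rewrite /D trmx_drsub sS.
have s0 : 0 < s.
  have := pS (row_mx 1%:M 0); rewrite SE mul_row_block tr_row_mx mul_row_col.
  rewrite trmx1 trmx0 !mul1mx !mul0mx !addr0 mulmx1 mulmx0 addr0 mxE mulr1n; apply.
  rewrite row_mx_eq0 negb_and; apply/orP; left.
  by apply/eqP => /matrixP/(_ 0 0); rewrite !mxE => /eqP; rewrite oner_eq0.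
pose L : 'M[R]_(1 + n) := block_mx 1%:M 0 (- s^-1 *: u^T) 1%:M.
pose D' := D - s^-1 *: (u^T *m u).
have LS : L *m S *m L^T = block_mx s%:M 0 0 D'.
  rewrite SE /L tr_block_mx !trmx1 trmx0 mulmx_block.
  rewrite !mul1mx !mul0mx !addr0 mulmx_block.
  rewrite !mulmx1 !mulmx0 !addr0.
  have e1 : - s^-1 *: u^T *m s%:M + u^T = 0.
    by rewrite mul_mx_scalar scalerA mulrN divff ?gt_eqF // scaleN1r addNr.
  have e2 : s%:M *m (- s^-1 *: u^T)^T + u = 0.
    by rewrite mul_scalar_mx linearZ /= trmxK scalerA mulrN divff ?gt_eqF // scaleN1r addNr.
  rewrite e1 e2 mul0mx add0r; congr (block_mx _ _ _ _).
  by rewrite /D' -scalemxAl scaleNr addrC.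
have [|x x0|G [GS Gd]] := IH D'.
- by rewrite /D' linearB /= linearZ /= trmx_mul trmxK sD.
- have := pS (row_mx 0 x *m L).
  rewrite trmx_mul !mulmxA -(mulmxA _ L S) -(mulmxA _ (L *m S)) LS.
  rewrite mul_row_block tr_row_mx mul_row_col trmx0 !(mul0mx, add0r, mulmx0).
  rewrite mul_mx_row mulmx0 mul_row_col mul0mx add0r; apply.
  by rewrite mulmx1 row_mx_eq0 negb_and x0 orbT.
pose G' : 'M[R]_(1 + n) := block_mx (Num.sqrt s)^-1%:M 0 0 G.
have sq0 : 0 < Num.sqrt s by rewrite sqrtr_gt0.
exists (G' *m L); split.
  rewrite trmx_mul !mulmxA -(mulmxA _ L S) -(mulmxA _ (L *m S)) LS.
  rewrite /G' tr_block_mx trmx0 tr_scalar_mx trmx0 !mulmx_block.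
  rewrite !(mul0mx, mulmx0, addr0, add0r) GS.
  rewrite -!scalar_mxM [RHS]scalar_mx_block; congr (block_mx _%:M _ _ _).
  by rewrite mulrAC -invfM -expr2 sqr_sqrtr ?(ltW s0) // mulVf ?gt_eqF.
rewrite det_mulmx /G' /L !det_lblock !det1 !mulr1 det_scalar expr1.
by rewrite mulr_gt0 // invr_gt0.
Qed.

Lemma gram_schmidt r m (e : 'M[R]_(r, m)) : row_free e ->
  exists G : 'M[R]_r, (G *m e) *m (G *m e)^T = 1%:M /\ 0 < \det G.
Proof.
move=> fe; have [||G [GS Gd]] := @spd_congruence r (e *m e^T).
- by rewrite trmx_mul trmxK.
- move=> x x0; have := @dot_gt0 R m (x *m e).
  rewrite /dot trmx_mul !mulmxA; apply; apply: contraNneq x0 => xe.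
  by apply/eqP/(row_free_inj fe); rewrite xe mul0mx.
by exists G; rewrite trmx_mul mulmxA -(mulmxA G) GS.
Qed.

Lemma row_free_gram_unit r m (e : 'M[R]_(r, m)) : row_free e -> e *m e^T \in unitmx.
Proof.
move=> fe; rewrite -row_free_unit; apply: inj_row_free => x xe.
have e0 : x *m e = 0.
  by apply: dot_eq0; rewrite /dot trmx_mul mulmxA -(mulmxA x) xe mul0mx mxE.
by apply: (row_free_inj fe); rewrite e0 mul0mx.
Qed.

(** The determinant is continuous in [e]. A nonzero [e] is demanded because its users divide by
    it. *)
Lemma unit_perturb n (N B : 'M[R]_n) : N \in unitmx ->
  exists2 e : R, e != 0 & N + e *: B \in unitmx.
Proof.
move=> uN; pose g (e : R) := \det (N + e *: B).
have cg : Ck 0 [set: R] g.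
  apply: Ck_det; first exact: openT.
  move=> i j; under eq_fun do rewrite !mxE.
  apply: Ck_add; [exact: openT|exact: Ck_cst|].
  by apply: Ck_mulf; [exact: openT|exact: Ck_id|exact: Ck_cst].
have g0 : g 0 != 0 by rewrite /g scale0r addr0 -unitfE -unitmxE.
have dg : differentiable g 0 by exact: (Ck_differentiable cg).
have := differentiable_continuous dg => /cvgrPdist_lt.
have p0 : 0 < `|g 0| by rewrite normr_gt0.
move=> /(_ _ p0)/nbhs_norm0P[d /= d0 hd].
have d2 : 0 < d / 2 by rewrite divr_gt0.
exists (d / 2); first by rewrite gt_eqF.
rewrite unitmxE unitfE; apply/eqP => e0; have ge0 : g (d / 2) = 0 by exact: e0.
have /= := hd (d / 2); rewrite gtr0_norm // ge0 subr0 ltxx.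
by rewrite gtr_pMr // invf_lt1 // ltr1n => /(_ isT).
Qed.

(** As [S] is symmetric, adding [P], which lives on its kernel, makes it invertible, and this
    persists after adding a small multiple of [B]. *)
Lemma commuting_sym_kernel n (S B : 'M[R]_n) : S^T = S -> B^T = B ->
  S *m B = B *m S ->
  exists e : R, forall x : 'rV[R]_n, x *m (S + e *: B) = 0 -> x *m S = 0 /\ x *m B = 0.
Proof.
move=> sS sB SB; pose k := kermx S; pose P := k^T *m k.
have kS : k *m S = 0 by exact: mulmx_ker.
have Sk : S *m k^T = 0 by rewrite -{1}sS -trmx_mul kS trmx0.
have SP : S *m P = 0 by rewrite /P mulmxA Sk mul0mx.
have PS : P *m S = 0 by rewrite /P -mulmxA kS mulmx0.
have SS0 (x : 'rV[R]_n) : x *m S *m S = 0 -> x *m S = 0.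
  by move=> h; apply: mulmx_tr_eq0; rewrite trmx_mul sS mulmxA h mul0mx.
have inK (x : 'rV[R]_n) : x *m S = 0 -> x *m k^T = 0 -> x = 0.
  move=> xS xk; have /sub_kermxP/submxP[c xE] := xS.
  apply: mulmx_tr_eq0; rewrite {2}xE trmx_mul mulmxA xk mul0mx //.
have uN : S + P \in unitmx.
  rewrite -row_free_unit; apply: inj_row_free => x; rewrite mulmxDr => xN.
  have xS : x *m S = 0.
    apply: SS0; have := congr1 (mulmxr S) xN.
    by rewrite /= mulmxDl -(mulmxA x P) PS mulmx0 addr0 mul0mx.
  have xP : x *m P = 0 by move: xN; rewrite xS add0r.
  apply: inK => //; apply: mulmx_tr_eq0.
  have -> : (x *m k^T)^T = k *m x^T by rewrite trmx_mul trmxK.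
  by rewrite mulmxA -(mulmxA x) xP mul0mx.
have [e e0 ue] := unit_perturb B uN.
exists e => x xe.
(* Commutation makes [S + e *: B] kill [x *m S], and [P] kills it because [S *m P = 0];
   invertibility then gives [x *m S = 0]. *)
have xSS : x *m S *m (S + P + e *: B) = 0.
  rewrite !mulmxDr -(mulmxA x S P) SP mulmx0 addr0 -mulmxDr -mulmxA.
  have -> : S *m (S + e *: B) = (S + e *: B) *m S.
    by rewrite mulmxDr mulmxDl -scalemxAr -scalemxAl SB.
  by rewrite mulmxA xe mul0mx.
have xS : x *m S = 0 by rewrite -[LHS](mulmxK ue) xSS mul0mx.
split=> //; move: xe; rewrite mulmxDr xS add0r -scalemxAr => /eqP.
by rewrite scaler_eq0 (negPf e0) => /eqP.
Qed.

(** The combination found for all members but one is symmetric and commutes with the remaining one,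
    so the case of two matrices applies. *)
Lemma commuting_family_kernel n k (S : 'I_k -> 'M[R]_n) :
  (forall j, (S j)^T = S j) -> (forall i j, S i *m S j = S j *m S i) ->
  exists t : 'I_k -> R, forall x : 'rV[R]_n,
    x *m (\sum_j t j *: S j) = 0 -> forall j, x *m S j = 0.
Proof.
elim: k S => [|k IH] S sS cS; first by exists (fun=> 0) => x _ [].
have [t ht] := IH (fun j => S (lift ord0 j)) (fun j => sS _) (fun i j => cS _ _).
have [|||e he] := @commuting_sym_kernel n (\sum_j t j *: S (lift ord0 j)) (S ord0).
- by rewrite linear_sum; apply: eq_bigr => j _; rewrite linearZ /= sS.
- exact: sS.
- rewrite mulmx_suml mulmx_sumr; apply: eq_bigr => j _.
  by rewrite -scalemxAl -scalemxAr cS.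
exists (fun i => if unlift ord0 i is Some j then t j else e) => x.
rewrite big_ord_recl unlift_none.
under eq_bigr do rewrite liftK.
rewrite addrC => /he[xS x0] i; case: (unliftP ord0 i) => [j ->|-> //].
exact: ht.
Qed.

(* The matrices [invmx Q *m K j] are symmetric and commute. *)
Lemma pencil_unit n k (K : 'I_k -> 'M[R]_n) (Q : 'M[R]_n) : Q \in unitmx ->
  (forall j, (Q *m (K j)^T)^T = Q *m (K j)^T) ->
  (forall i j, (K i *m (K j)^T)^T = K i *m (K j)^T) ->
  (forall x : 'rV[R]_n, (forall j, x *m K j = 0) -> x = 0) ->
  exists t : 'I_k -> R, \sum_j t j *: K j \in unitmx.
Proof.
move=> uQ QK KK inj; pose S j := invmx Q *m K j.
have QK' j : K j *m Q^T = Q *m (K j)^T by rewrite -QK trmx_mul trmxK.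
have sS j : (S j)^T = S j.
  rewrite /S trmx_mul -[(K j)^T](mulKmx uQ) -QK' mulmxA -!mulmxA trmx_inv mulmxV.
    by rewrite mulmx1.
  by rewrite unitmx_tr.
have cS i j : S i *m S j = S j *m S i.
  rewrite -{1}(sS j) -{2}(sS i) /S !trmx_mul !mulmxA -(mulmxA _ (K i)) -(mulmxA _ (K j)).
  by rewrite -KK trmx_mul trmxK.
have [t ht] := commuting_family_kernel sS cS.
exists t; have -> : \sum_j t j *: K j = Q *m \sum_j t j *: S j.
  rewrite mulmx_sumr; apply: eq_bigr => j _.
  by rewrite -scalemxAr /S mulKVmx.
rewrite unitmx_mul uQ -row_free_unit; apply: inj_row_free => x /ht hx.
have x0 : x *m invmx Q = 0 by apply: inj => j; rewrite -mulmxA; exact: hx.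
by rewrite -[x](mulmxKV uQ) x0 mul0mx.
Qed.

End Gram.

(** * The Grassmannian *)

Section WedgeAlgebra.
Context {R : realType} {n m : nat}.
Implicit Types (e c : 'M[R]_(n, m)) (p : ext R n m).

Definition replace_row e (i : 'I_n) (w : 'rV[R]_m) : 'M[R]_(n, m) :=
  \matrix_(j < n) (if j == i then w else row j e).

Lemma wedge_mul (g : 'M[R]_n) e : wedge (g *m e) = \det g *: wedge e.
Proof.
apply/rowP => l; rewrite !mxE -det_mulmx; congr (\det _).
by apply/matrixP => i j; rewrite !mxE; apply: eq_bigr => s _; rewrite !mxE.
Qed.

Lemma wedge_replace0 e i : wedge (replace_row e i 0) = 0.
Proof.
apply/rowP => l; rewrite !mxE; apply/eqP.
rewrite -[X in \det X]trmxK det_tr; apply/eqP.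
rewrite (expand_det_col _ i) big1 // => j _.
by rewrite !mxE eqxx mxE mul0r.
Qed.

(* By Cauchy-Binet and Cramer's rule, the linear map [contract e0] sends [wedge e]
   to a matrix with the same rows as [e] up to an invertible factor, so the plane
   is recovered smoothly from its Pluecker coordinates. *)
Definition contract e0 p : 'M[R]_(n, m) :=
  \matrix_(i, l) dot p (wedge (replace_row e0 i (delta_mx 0 l))).

Lemma contract_wedge e0 e : contract e0 (wedge e) = \adj (e *m e0^T) *m e.
Proof.
apply/matrixP => i l; rewrite mxE dot_wedge (expand_det_col _ i) mxE.
apply: eq_bigr => j _; rewrite mxE mulrC; congr (_ * _).
  rewrite mxE /cofactor; congr (_ * \det _).
  apply/matrixP => a b; rewrite !mxE; apply: eq_bigr => s _; rewrite !mxE.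
  by rewrite eq_sym (negPf (neq_lift _ _)) mxE.
rewrite (bigD1 l) //= !mxE eqxx !mxE !eqxx mulr1 big1 ?addr0 // => s sl.
by rewrite !mxE eqxx !mxE (negPf sl) andbF mulr0.
Qed.

(** The basis of the plane of [p] dual to the rows of [e0]. In contrast with the chosen [frame], it
    is rational in the coordinates of [p] and insensitive to orientation. *)
Definition graph_frame e0 p : 'M[R]_(n, m) :=
  (dot p (wedge e0))^-1 *: contract e0 p.

Lemma graph_frame_wedge e0 e : e *m e0^T \in unitmx ->
  graph_frame e0 (wedge e) = invmx (e *m e0^T) *m e.
Proof.
by move=> ue; rewrite /graph_frame contract_wedge dot_wedge scalemxAl /invmx ue.
Qed.

Lemma framesP p : Qo p -> frame p *m (frame p)^T = 1%:M /\ p = wedge (frame p).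
Proof. by case=> e ep; exact: (getPex (ex_intro _ e ep)). Qed.

Lemma dot_self_Qo p : Qo p -> dot p p = 1.
Proof. by move=> /framesP[ee pe]; rewrite {1 2}pe dot_wedge ee det1. Qed.

Lemma frames_Qo e : e *m e^T = 1%:M -> Qo (wedge e).
Proof. by move=> ee; exists e. Qed.

Lemma dot_frame_unit p e0 : Qo p ->
  (dot p (wedge e0) != 0) = (frame p *m e0^T \in unitmx).
Proof. by move=> /framesP[_ {1}->]; rewrite dot_wedge unitmxE unitfE. Qed.

Lemma graph_frame_unit p e0 : Qo p -> dot p (wedge e0) != 0 ->
  exists g, [/\ g \in unitmx, graph_frame e0 p = g *m frame p &
                graph_frame e0 p *m e0^T = 1%:M].
Proof.
move=> Qp; rewrite dot_frame_unit // => u.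
exists (invmx (frame p *m e0^T)); rewrite unitmx_inv; split=> //.
  by have [_ {1}->] := framesP Qp; rewrite graph_frame_wedge.
by have [_ {1}->] := framesP Qp; rewrite graph_frame_wedge // -mulmxA mulVmx.
Qed.

Lemma projT_span p (C : 'M[R]_(n, m)) (g : 'M[R]_n) : Qo p -> g \in unitmx ->
  C = g *m frame p -> C *m C^T \in unitmx /\
  projT p = C^T *m invmx (C *m C^T) *m C.
Proof.
move=> /framesP[ee _] ug ->.
have gg : g *m frame p *m (g *m frame p)^T = g *m g^T.
  by rewrite trmx_mul mulmxA -(mulmxA g) ee mulmx1.
have ugg : g *m g^T \in unitmx by rewrite unitmx_mul ug unitmx_tr.
rewrite gg; split=> //.
have ig : invmx (g *m g^T) = invmx g^T *m invmx g.
  have h : invmx g^T *m invmx g *m (g *m g^T) = 1%:M.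
    by rewrite mulmxA -(mulmxA _ (invmx g)) mulVmx // mulmx1 mulVmx ?unitmx_tr.
  by rewrite -[RHS](mulmxK ugg) h mul1mx.
rewrite ig trmx_mul !mulmxA -(mulmxA _ g^T) mulmxV ?unitmx_tr // mulmx1.
by rewrite -(mulmxA _ (invmx g)) mulVmx // mulmx1.
Qed.

(** Any orthonormal frame of the oriented plane computes the projection, whichever one [get] has
    chosen. *)
Lemma projT_wedge e : e *m e^T = 1%:M -> projT (wedge e) = e^T *m e.
Proof.
move=> ee; have Q := frames_Qo ee; have [ff wf] := framesP Q.
have d1 : dot (wedge e) (wedge e) = 1 by rewrite dot_wedge ee det1.
have d0 : dot (wedge e) (wedge e) != 0 by rewrite d1 oner_eq0.
have [g [ug gE _]] := graph_frame_unit Q d0.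
have ge : graph_frame e (wedge e) = e.
  by rewrite graph_frame_wedge ee ?unitmx1 // invmx1 mul1mx.
have [_ ->] := projT_span Q ug (etrans (esym ge) gE).
by rewrite ee invmx1 mulmx1.
Qed.

Section Projections.
Variable p : ext R n m.
Hypothesis Qp : Qo p.

Lemma projT_tr : (projT p)^T = projT p.
Proof. by rewrite /projT trmx_mul trmxK. Qed.

Lemma projN_tr : (projN p)^T = projN p.
Proof. by rewrite /projN linearB /= trmx1 projT_tr. Qed.

Lemma projT_idem : projT p *m projT p = projT p.
Proof.
have [ee _] := framesP Qp.
by rewrite /projT mulmxA -(mulmxA _ (frame p)) ee mulmx1.
Qed.

Lemma projTN : projT p *m projN p = 0.
Proof. by rewrite /projN mulmxBr mulmx1 projT_idem subrr. Qed.

Lemma projN_idem : projN p *m projN p = projN p.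
Proof. by rewrite {1}/projN mulmxBl mul1mx projTN subr0. Qed.

Lemma frame_projT : frame p *m projT p = frame p.
Proof. by have [ee _] := framesP Qp; rewrite /projT mulmxA ee mul1mx. Qed.

Lemma frame_projN : frame p *m projN p = 0.
Proof. by rewrite /projN mulmxBr mulmx1 frame_projT subrr. Qed.

Lemma planeP (u : 'rV[R]_m) : plane p u <-> u *m projN p = 0.
Proof.
split=> [/submxP[c ->]|]; first by rewrite -mulmxA frame_projN mulmx0.
rewrite /projN mulmxBr mulmx1 => /eqP; rewrite subr_eq0 => /eqP uE.
by rewrite /plane /= uE /projT mulmxA submxMl.
Qed.

Lemma plane_projT (u : 'rV[R]_m) : plane p u <-> u *m projT p = u.
Proof.
rewrite planeP /projN mulmxBr mulmx1; split=> [/eqP|->]; last by rewrite subrr.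
by rewrite subr_eq0 => /eqP.
Qed.

Lemma orth_planeP (w : 'rV[R]_m) : orth (plane p) w <-> w *m projT p = 0.
Proof.
split=> [ow|wT u /plane_projT uT].
  apply: dot_eq0; rewrite dot_mulmxl projT_tr -mulmxA projT_idem dotC.
  by apply: ow; apply/plane_projT; rewrite -mulmxA projT_idem.
by rewrite -uT dot_mulmxl projT_tr wT /dot trmx0 mulmx0 mxE.
Qed.

Lemma orth_plane_projN (w : 'rV[R]_m) : orth (plane p) w <-> w *m projN p = w.
Proof.
rewrite orth_planeP /projN mulmxBr mulmx1; split=> [->|/eqP]; first by rewrite subr0.
by rewrite subr_eq addrC -subr_eq subrr eq_sym => /eqP.
Qed.

Lemma rank_projN : \rank (projN p) = (m - n)%N.
Proof.
have [ee _] := framesP Qp.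
have -> : (projN p :=: kermx (frame p)^T)%MS.
  apply/eqmxP/andP; split.
    by apply/sub_kermxP; rewrite -projN_tr -trmx_mul frame_projN trmx0.
  apply/row_subP => i; set k := row i _.
  have kf : k *m (frame p)^T = 0 by rewrite -row_mul mulmx_ker row0.
  have -> : k = k *m projN p.
    by rewrite /projN mulmxBr mulmx1 /projT mulmxA kf mul0mx subr0.
  exact: submxMl.
rewrite mxrank_ker mxrank_tr; congr (_ - _)%N.
by apply/eqP/row_freeP; exists (frame p)^T.
Qed.

End Projections.

End WedgeAlgebra.

Lemma open_setI_preimage {V W : topologicalType} (D : set V) (f : V -> W) (O : set W) :
  open D -> open O -> (forall x, D x -> {for x, continuous f}) ->
  open (D `&` f @^-1` O).
Proof.
move=> oD oO cf; rewrite openE => x [Dx Ofx].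
apply: filterI; first exact: (open_nbhs_nbhs (conj oD Dx)).
exact: (cf x Dx _ (open_nbhs_nbhs (conj oO Ofx))).
Qed.

Section OpenSets.
Context {R : realType} {V : normedModType R}.

Lemma open_neq0 (D : set V) (f : V -> R) : open D -> Ck 0 D f ->
  open [set x | D x /\ f x != 0].
Proof.
move=> oD cf.
have -> : [set x | D x /\ f x != 0] = D `&` (fun x => `|f x|) @^-1` [set t : R | 0 < t].
  by apply/seteqP; split=> x [Dx]; rewrite /= normr_gt0.
apply: open_setI_preimage; [exact: oD|exact: (@open_gt R 0)|].
move=> x Dx; apply: cvg_norm; apply: differentiable_continuous.
exact: (Ck_differentiable cf Dx).
Qed.

Lemma open_gt0 (D : set V) (f : V -> R) : open D -> Ck 0 D f ->
  open [set x | D x /\ 0 < f x].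
Proof.
move=> oD cf.
have -> : [set x | D x /\ 0 < f x] = D `&` f @^-1` [set t : R | 0 < t] by [].
apply: open_setI_preimage; [exact: oD|exact: (@open_gt R 0)|].
move=> x Dx; apply: differentiable_continuous; exact: (Ck_differentiable cf Dx).
Qed.

End OpenSets.

(** * Derivatives of wedge products and smoothness of the projections *)

Section DeriveWedge.
Context {R : realType} {V : normedModType R} {n m : nat}.

Lemma diff_prod (I : eqType) (s : seq I) (f : I -> V -> R) x : uniq s ->
  (forall i, differentiable (f i) x) ->
  differentiable (fun y => \prod_(i <- s) f i y) x /\
  forall v, 'D_v (fun y => \prod_(i <- s) f i y) x =
    \sum_(i <- s) \prod_(j <- s) (if j == i then 'D_v (f j) x else f j x).
Proof.
move=> us df; elim: s us => [_|i s IH /= /andP[nis us]].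
  have -> : (fun y => \prod_(i <- [::]) f i y) = cst 1.
    by apply/funext => y; rewrite big_nil.
  by split=> [|v]; [exact: differentiable_cst|rewrite big_nil derive_cst].
have [dp Dp] := IH us.
have -> : (fun y => \prod_(j <- i :: s) f j y) = fun y => f i y * \prod_(j <- s) f j y.
  by apply/funext => y; rewrite big_cons.
split=> [|v]; first exact: differentiable_mulf.
rewrite derive_mulf // Dp big_cons big_cons eqxx addrC; congr (_ * _ + _).
  apply: eq_big_seq => j js; case: eqP => // ji.
  by move: nis; rewrite -ji js.
rewrite big_distrr /=; apply: eq_big_seq => j js; rewrite big_cons.
by case: eqP => // ji; move: nis; rewrite ji js.
Qed.

Lemma diff_det (f : V -> 'M[R]_n) x : differentiable f x ->
  differentiable (fun y => \det (f y)) x /\ forall v, 'D_v (fun y => \det (f y)) x =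
    \sum_i \det (\matrix_(j, l) (if j == i then 'D_v f x j l else f x j l)).
Proof.
move=> df; have df' := (differentiable_mxP f x).1 df.
have dp (s : 'S_n) := diff_prod (index_enum_uniq 'I_n) (fun i => df' i (s i)).
have dt (s : 'S_n) : differentiable (fun y => (-1) ^+ s * \prod_i f y i (s i)) x.
  apply: differentiable_mulf; [exact: differentiable_cst|exact: (dp s).1].
rewrite /determinant; split=> [|v]; first exact: differentiable_sumf.
rewrite derive_sumf // exchange_big /=; apply: eq_bigr => s _.
rewrite derive_mulf ?derive_cst ?mul0r ?addr0; [|exact: differentiable_cst|exact: (dp s).1].
rewrite (dp s).2 big_distrr /=; apply: eq_bigr => i _; congr (_ * _).
by apply: eq_bigr => j _; rewrite mxE derive_mxE.
Qed.

Lemma diff_wedge (C : V -> 'M[R]_(n, m)) x : differentiable C x ->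
  differentiable (fun y => wedge (C y)) x /\ forall v, 'D_v (fun y => wedge (C y)) x =
    \sum_i wedge (replace_row (C x) i (row i ('D_v C x))).
Proof.
move=> dC; have dC' := (differentiable_mxP C x).1 dC.
have ds (J : 'I_n -> 'I_m) : differentiable (fun y => colsub J (C y)) x.
  by apply/differentiable_mxP => i j; under eq_fun do rewrite mxE; exact: dC'.
have dd (J : 'I_n -> 'I_m) := diff_det (ds J).
have dw : differentiable (fun y => wedge (C y)) x.
  by apply/differentiable_mxP => i l; under eq_fun do rewrite mxE; exact: (dd _).1.
split=> // v; apply/rowP => l; rewrite derive_mxE //.
under eq_fun do rewrite mxE.
rewrite (dd _).2 summxE; apply: eq_bigr => i _; rewrite mxE; congr (\det _).
apply/matrixP => a b; rewrite !mxE; case: eqP => [->|_]; last by rewrite !mxE.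
rewrite derive_mxE // mxE derive_mxE //.
by under eq_fun do rewrite mxE.
Qed.

Lemma Ck_wedge k D (C : V -> 'M[R]_(n, m)) : open D -> Ck k D C ->
  Ck k D (fun y => wedge (C y)).
Proof.
move=> oD /(Ck_mxP _ _ oD) cC; apply/Ck_mxP => // i l; under eq_fun do rewrite mxE.
by apply: Ck_det => // a b; under eq_fun do rewrite mxE; exact: cC.
Qed.

Lemma Ck_dot k D (f g : V -> 'rV[R]_m) : open D -> Ck k D f -> Ck k D g ->
  Ck k D (fun y => dot (f y) (g y)).
Proof.
move=> oD cf cg; rewrite /dot.
exact: ((Ck_mxP _ _ oD).1 (Ck_mulmx oD cf (Ck_trmx oD cg)) 0 0).
Qed.

Lemma differentiable_dot (f g : V -> 'rV[R]_m) x : differentiable f x ->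
  differentiable g x -> differentiable (fun y => dot (f y) (g y)) x.
Proof.
move=> df dg; apply: ((differentiable_mxP _ _).1 _ 0 0).
by apply: differentiable_mulmx => //; exact: differentiable_trmx.
Qed.

Lemma derive_dot (f g : V -> 'rV[R]_m) x v : differentiable f x ->
  differentiable g x ->
  'D_v (fun y => dot (f y) (g y)) x = dot ('D_v f x) (g x) + dot (f x) ('D_v g x).
Proof.
move=> df dg; have dt := differentiable_trmx dg.
have h := @derive_mxE R V 1 1 (fun y => f y *m (g y)^T) x v 0 0 (differentiable_mulmx df dt).
by rewrite /dot -h derive_mulmx // derive_trmx // mxE.
Qed.

End DeriveWedge.

Section Planes.
Context {R : realType} {V : normedModType R} {n m : nat}.

Lemma Ck_graph_frame k (E : set V) (psi : V -> ext R n m) e0 : open E -> Ck k E psi ->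
  (forall y, E y -> dot (psi y) (wedge e0) != 0) ->
  Ck k E (fun y => graph_frame e0 (psi y)).
Proof.
move=> oE cpsi h0; apply: Ck_scaler => //.
  by apply: Ck_invf => //; apply: Ck_dot => //; exact: Ck_cst.
apply/Ck_mxP => // i l; under eq_fun do rewrite mxE.
by apply: Ck_dot => //; exact: Ck_cst.
Qed.

Variables (D : set V) (psi : V -> ext R n m).
Hypothesis oD : open D.
Hypothesis psiQ : forall y, D y -> Qo (psi y).
Hypothesis cpsi : forall k, Ck k D psi.

(** By Cauchy-Binet, the points where [frame (psi y) *m e0^T] is invertible, that is where
    [graph_frame e0] is meaningful. *)
Definition near_plane e0 : set V := [set y | D y /\ dot (psi y) (wedge e0) != 0].

Lemma near_plane_open e0 : open (near_plane e0).
Proof.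
by apply: open_neq0 => //; apply: Ck_dot => //; exact: Ck_cst.
Qed.

Lemma near_plane_sub e0 : near_plane e0 `<=` D. Proof. by move=> y []. Qed.

Lemma near_plane_frame y : D y -> near_plane (frame (psi y)) y.
Proof.
move=> Dy; split=> //; have [_ <-] := framesP (psiQ Dy).
by rewrite dot_self_Qo ?oner_eq0 //; exact: psiQ.
Qed.

Lemma near_plane_graph e0 y : near_plane e0 y ->
  exists g, [/\ g \in unitmx, graph_frame e0 (psi y) = g *m frame (psi y) &
                graph_frame e0 (psi y) *m e0^T = 1%:M].
Proof. by move=> [Dy d0]; exact: graph_frame_unit (psiQ Dy) d0. Qed.

Lemma near_plane_Ck k e0 : Ck k (near_plane e0) (fun y => graph_frame e0 (psi y)).
Proof.
apply: Ck_graph_frame; [exact: near_plane_open| |by move=> z []].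
exact: Ck_subset (@near_plane_sub e0) (@cpsi k).
Qed.

Let gram e0 y := invmx (graph_frame e0 (psi y) *m (graph_frame e0 (psi y))^T).

Lemma near_plane_Ck_gram k e0 : Ck k (near_plane e0) (gram e0).
Proof.
have oE := near_plane_open e0; have cC := @near_plane_Ck k e0.
apply: Ck_invmx => //; last by apply: Ck_mulmx => //; exact: Ck_trmx.
move=> y Ey; have [g [ug gE _]] := near_plane_graph Ey.
by have [] := projT_span (psiQ (near_plane_sub Ey)) ug gE.
Qed.

Lemma near_plane_projT e0 y : near_plane e0 y -> projT (psi y) =
  (graph_frame e0 (psi y))^T *m gram e0 y *m graph_frame e0 (psi y).
Proof.
move=> Ey; have [g [ug gE _]] := near_plane_graph Ey.
by have [] := projT_span (psiQ (near_plane_sub Ey)) ug gE.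
Qed.

Lemma Ck_projT k : Ck k D (fun y => projT (psi y)).
Proof.
apply: Ck_local => y Dy; set e0 := frame (psi y).
have oE := near_plane_open e0.
exists (near_plane e0); split=> //; first exact: near_plane_frame.
have cC := @near_plane_Ck k e0; have cG := @near_plane_Ck_gram k e0.
apply: (Ck_ext oE _ (Ck_mulmx oE (Ck_mulmx oE (Ck_trmx oE cC) cG) cC)) => z Ez.
by rewrite (near_plane_projT Ez).
Qed.

Lemma Ck_projN k : Ck k D (fun y => projN (psi y)).
Proof. by apply: Ck_sub => //; [exact: Ck_cst|exact: Ck_projT]. Qed.

Lemma differentiable_projT y : D y -> differentiable (fun y => projT (psi y)) y.
Proof. exact: Ck_differentiable (@Ck_projT 0%N). Qed.

Lemma differentiable_projN y : D y -> differentiable (fun y => projN (psi y)) y.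
Proof. exact: Ck_differentiable (@Ck_projN 0%N). Qed.

Section AtPoint.
Variable y : V.
Hypothesis Dy : D y.
Let p := psi y.
Let e := frame p.
Let C z := graph_frame e (psi z).

Let Ey : near_plane e y. Proof. exact: near_plane_frame. Qed.

Let nearE : \forall z \near y, near_plane e z.
Proof. exact: (open_nbhs_nbhs (conj (near_plane_open e) Ey)). Qed.

Let Qp : Qo p. Proof. exact: psiQ. Qed.
Let ee : e *m e^T = 1%:M. Proof. by have [] := framesP Qp. Qed.
Let pe : p = wedge e. Proof. by have [] := framesP Qp. Qed.

Let Cy : C y = e.
Proof. by rewrite /C -/p pe graph_frame_wedge ee ?unitmx1 // invmx1 mul1mx. Qed.

Let dC : differentiable C y.
Proof. exact: (Ck_differentiable (@near_plane_Ck 0%N e) Ey). Qed.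

Let dCe v : 'D_v C y *m e^T = 0.
Proof.
rewrite -derive_mulmxr //.
have E : {near y, (fun z => C z *m e^T) =1 cst 1%:M}.
  by apply: filterS nearE => z /near_plane_graph[g []].
by rewrite (near_eq_derive _ E) derive_cst.
Qed.

(** Since [C z *m e^T] is constantly the identity, the derivative of [C] at [y] has rows orthogonal
    to the plane. Multiplication by [projN] on the right removes the terms in which the last factor
    [C] is not differentiated. *)
Lemma derive_projT_graph v :
  projT p *m 'D_v (fun z => projT (psi z)) y *m projN p = e^T *m 'D_v C y.
Proof.
have E : {near y, (fun z => projT (psi z)) =1 (fun z => (C z)^T *m gram e z *m C z)}.
  by apply: filterS nearE => z; exact: near_plane_projT.
have dG : differentiable (gram e) y := Ck_differentiable (@near_plane_Ck_gram 0%N e) Ey.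
have dT := differentiable_trmx dC.
rewrite (near_eq_derive _ E) (derive_mulmx v (differentiable_mulmx dT dG) dC).
have Gy : gram e y = 1%:M by rewrite /gram -/(C y) Cy ee invmx1.
rewrite Cy Gy (mulmx1 e^T).
move: (dCe v); move: ('D_v _ y) ('D_v C y) => X Y Ye.
have pe' : projT p *m e^T = e^T by rewrite -(projT_tr p) -trmx_mul (frame_projT Qp).
rewrite (mulmxDr (projT p)) mulmxDl (mulmxA (projT p) X) -(mulmxA _ e) (frame_projN Qp).
rewrite mulmx0 add0r (mulmxA (projT p)) pe' /projN mulmxBr mulmx1 /projT -/e.
by rewrite mulmxA -(mulmxA e^T) Ye mulmx0 mul0mx subr0.
Qed.

(** Combined with [derive_projT_graph], this matches the tangent vector of [psi] with the
    off-diagonal block of the derivative of the projection. *)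
Lemma derive_psi_tangent v :
  'D_v psi y = tangent_of_hom p (e^T *m 'D_v C y).
Proof.
have dpsi : differentiable psi y := Ck_differentiable (@cpsi 0%N) Dy.
pose a z := dot (psi z) (wedge e).
have da : differentiable a y.
  by apply: differentiable_dot => //; exact: differentiable_cst.
have [dw Dw] := diff_wedge dC.
have E : {near y, psi =1 (fun z => a z *: wedge (C z))}.
  apply: filterS nearE => z Ez; have [Dz az] := Ez.
  have [g [ug gE ge]] := near_plane_graph Ez.
  have [_ fz] := framesP (psiQ Dz).
  have gd : \det g * a z = 1.
    by rewrite /a {1}fz dot_wedge -det_mulmx mulmxA -gE ge det1.
  by rewrite /C gE wedge_mul scalerA mulrC gd scale1r -fz.
have ay : a y = 1 by rewrite /a -pe dot_self_Qo.
(* The normalizing factor is stationary at [y] because [psi] takes values in the unit sphere. *)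
have Da0 : 'D_v a y = 0.
  have E1 : {near y, (fun z => dot (psi z) (psi z)) =1 cst 1}.
    apply: filterS (open_nbhs_nbhs (conj oD Dy)) => z Dz.
    by rewrite dot_self_Qo //; exact: psiQ.
  have := near_eq_derive v E1; rewrite derive_cst derive_dot // dotC.
  have dc : differentiable (fun _ : V => wedge e) y by exact: differentiable_cst.
  have -> : 'D_v a y = dot p ('D_v psi y).
    rewrite (derive_dot v dpsi dc) derive_cst -pe dotC.
    by rewrite [X in _ + X]/dot trmx0 mulmx0 mxE addr0.
  by move/eqP; rewrite -mulr2n mulrn_eq0 /= => /eqP.
rewrite (near_eq_derive _ E) (derive_scaler v da dw) Da0 scale0r addr0 ay scale1r Dw.
rewrite /tangent_of_hom; apply: eq_bigr => i _; congr wedge.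
apply/matrixP => j l; rewrite !mxE; case: eqP => [->|_]; last by rewrite Cy.
rewrite mxE -/e; have -> : row i e *m (e^T *m 'D_v C y) = row i ('D_v C y).
  by rewrite mulmxA -row_mul ee row1 -rowE.
by rewrite mxE.
Qed.

End AtPoint.

End Planes.

(** * Tangent vectors of the Grassmannian as linear maps *)

Section TangentOfHom.
Context {R : realType} {n m : nat}.
Variable p : ext R n m.
Hypothesis Qp : Qo p.
Let e := frame p.

Lemma tangent_of_homE (u : 'M[R]_m) :
  tangent_of_hom p u = \sum_i wedge (replace_row e i (row i (e *m u))).
Proof.
rewrite /tangent_of_hom; apply: eq_bigr => i _; congr wedge.
apply/matrixP => j l; rewrite !mxE; case: eqP => [->|_] //.
by rewrite row_mul.
Qed.

(** Along the line [e + s *: (e *m u)], [contract e] inverts [wedge], because the product with [e^T]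
    stays the identity. Differentiating at 0 and using that [contract] is linear gives the formula,
    and with it the injectivity of [tangent_of_hom]. *)
Lemma contract_tangent (u : 'M[R]_m) : homTN p u ->
  contract e (tangent_of_hom p u) = e *m u.
Proof.
rewrite /homTN /= => uE; have [ee _] := framesP Qp; rewrite -/e in ee.
have ue : e *m u *m e^T = 0.
  rewrite uE -!mulmxA; have -> : projN p *m e^T = 0.
    by rewrite -(projN_tr p) -trmx_mul (frame_projN Qp) trmx0.
  by rewrite !mulmx0.
pose C (s : R) := e + s *: (e *m u).
have dC : differentiable C 0.
  apply: differentiableD; first exact: differentiable_cst.
  by apply: differentiable_scaler => //; exact: differentiable_cst.
have DC : 'D_1 C 0 = e *m u.
  have d1 : differentiable (fun s : R => s *: (e *m u)) 0.
    by apply: differentiable_scaler => //; exact: differentiable_cst.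
  have d0 : differentiable (fun _ : R => e) 0 by exact: differentiable_cst.
  rewrite /C (derive_addf (1 : R) d0 d1) derive_cst add0r derive_scaler //.
  by rewrite derive_cst scaler0 add0r derive_id scale1r.
have C0 : C 0 = e by rewrite /C scale0r addr0.
have [dw Dw] := diff_wedge dC.
have cC s : contract e (wedge (C s)) = C s.
  rewrite contract_wedge /C mulmxDl ee -scalemxAl ue scaler0 addr0.
  by have := mul_adj_mx (1%:M : 'M[R]_n); rewrite mulmx1 det1 => ->; rewrite mul1mx.
have -> : tangent_of_hom p u = 'D_1 (fun s => wedge (C s)) 0.
  by rewrite Dw DC C0 tangent_of_homE.
apply/matrixP => i l; rewrite mxE.
set w := wedge _; have dc : differentiable (fun _ : R => w) 0 by exact: differentiable_cst.
have fE : (fun s : R => dot (wedge (C s)) w) = (fun s => C s i l).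
  apply/funext => s.
  by have := congr1 (fun A : 'M[R]_(n, m) => A i l) (cC s); rewrite mxE.
have e1 := derive_dot (1 : R) dw dc.
rewrite derive_cst [X in _ + X]/dot trmx0 mulmx0 mxE addr0 in e1.
rewrite -e1 fE -DC; apply/esym; exact: (derive_mxE (1 : R) i l dC).
Qed.

Lemma homTN_frame (u : 'M[R]_m) : homTN p u -> u = e^T *m (e *m u).
Proof.
rewrite /homTN /= => uE; rewrite {2}uE -(mulmxA (projT p)) (mulmxA e) (frame_projT Qp).
by rewrite -/e (mulmxA e^T) -[e^T *m e]/(projT p) mulmxA -uE.
Qed.

Lemma hom_of_tangentE (u : 'M[R]_m) : homTN p u ->
  hom_of_tangent p (tangent_of_hom p u) = u.
Proof.
move=> hu; have [hu' tu'] : [set v | homTN p v /\ tangent_of_hom p v = tangent_of_hom p u]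
    (hom_of_tangent p (tangent_of_hom p u)).
  by apply: getPex; exists u.
apply: etrans (homTN_frame hu') _; apply: etrans _ (esym (homTN_frame hu)).
by congr (_ *m _); rewrite -(contract_tangent hu') -(contract_tangent hu) tu'.
Qed.

Lemma tangent_of_hom0 : tangent_of_hom p 0 = 0.
Proof.
rewrite tangent_of_homE big1 // => i _.
by rewrite mulmx0 row0 wedge_replace0.
Qed.

End TangentOfHom.

Section HomOfDerivative.
Context {R : realType} {V : normedModType R} {n m : nat}.
Variables (D : set V) (psi : V -> ext R n m).
Hypothesis oD : open D.
Hypothesis psiQ : forall y, D y -> Qo (psi y).
Hypothesis cpsi : forall k, Ck k D psi.
Let PT z := projT (psi z).
Let PN z := projN (psi z).

Lemma derive_projN v y : D y -> 'D_v PN y = - 'D_v PT y.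
Proof.
move=> Dy; have dT : differentiable PT y := differentiable_projT oD psiQ cpsi Dy.
have dc : differentiable (fun _ : V => 1%:M : 'M[R]_m) y by exact: differentiable_cst.
by rewrite /PN (derive_subf v dc dT) derive_cst sub0r.
Qed.

Lemma homTN_PTPN v y : D y -> homTN (psi y) (PT y *m 'D_v PT y *m PN y).
Proof.
move=> Dy; have Q := psiQ Dy.
have := projT_idem Q; have := projN_idem Q; rewrite /homTN /= /PT /PN.
move: (projT (psi y)) (projN (psi y)) ('D_v _ y) => P N X NN PP.
by rewrite !mulmxA PP -(mulmxA _ N) NN.
Qed.

Lemma derive_psi_hom v y : D y ->
  'D_v psi y = tangent_of_hom (psi y) (PT y *m 'D_v PT y *m PN y).
Proof.
move=> Dy; rewrite (derive_psi_tangent oD psiQ cpsi Dy v).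
by rewrite -(derive_projT_graph oD psiQ cpsi Dy v).
Qed.

Lemma hom_of_derivative v y : D y ->
  hom_of_tangent (psi y) ('D_v psi y) = PT y *m 'D_v PT y *m PN y.
Proof.
move=> Dy; rewrite derive_psi_hom // hom_of_tangentE //; first exact: psiQ.
exact: homTN_PTPN.
Qed.

(** Obtained by differentiating [s = s *m projT]. Applied to the second component of a map into
    [Qaff], it turns [alpha] into the normal part of a derivative. *)
Lemma derive_section (s : V -> 'rV[R]_m) v y : D y -> differentiable s y ->
  (forall z, D z -> plane (psi z) (s z)) ->
  s y *m (PT y *m 'D_v PT y *m PN y) = 'D_v s y *m PN y.
Proof.
move=> Dy ds sp; have Q := psiQ Dy.
have dT : differentiable PT y := differentiable_projT oD psiQ cpsi Dy.
have E : {near y, s =1 (fun z => s z *m PT z)}.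
  apply: filterS (open_nbhs_nbhs (conj oD Dy)) => z Dz.
  by apply/esym/(plane_projT (psiQ Dz)); exact: sp.
rewrite [in RHS](near_eq_derive _ E) (derive_mulmx v ds dT) mulmxDl.
rewrite -(mulmxA ('D_v s y)) [PT y *m PN y](projTN Q) mulmx0 add0r.
have := (plane_projT Q (s y)).1 (sp _ Dy).
rewrite /PT; move: (projT (psi y)) => P sP.
by rewrite !mulmxA sP.
Qed.

(* Differentiating [P P = P] shows that [D P] exchanges the two summands. *)
Lemma projN_derive_projN v y : D y -> PN y *m 'D_v PN y *m PN y = 0.
Proof.
move=> Dy; have Q := psiQ Dy.
have dN : differentiable PN y := differentiable_projN oD psiQ cpsi Dy.
have E : {near y, PN =1 (fun z => PN z *m PN z)}.
  apply: filterS (open_nbhs_nbhs (conj oD Dy)) => z Dz.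
  by rewrite [RHS](projN_idem (psiQ Dz)).
have e1 := near_eq_derive v E; rewrite (derive_mulmx v dN dN) in e1.
have := projN_idem Q; move: e1; rewrite -/(PN y).
move: (PN y) ('D_v PN y) => P X XE PP.
have e2 : P *m X *m P = P *m X *m P + P *m X *m P.
  by rewrite {1}XE mulmxDr mulmxDl -!mulmxA PP !mulmxA PP.
by apply/eqP; rewrite -[X in X == _](addrK (P *m X *m P)) -e2 subrr.
Qed.

(* Extends [projT] from a neighbourhood of [wedge e] in the Grassmannian to the
   ambient space, so that the derivative of [projT \o psi] only depends on the
   first derivative of [psi]. *)
Definition ambient_projT (e : 'M[R]_(n, m)) (q : ext R n m) : 'M[R]_m :=
  (graph_frame e q)^T *m invmx (graph_frame e q *m (graph_frame e q)^T)
    *m graph_frame e q.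

Lemma ambient_projT_differentiable y : D y ->
  differentiable (ambient_projT (frame (psi y))) (psi y).
Proof.
move=> Dy; have Q := psiQ Dy; have [ee pe] := framesP Q.
set e := frame (psi y) in ee pe *.
pose E0 : set (ext R n m) := [set q | [set: ext R n m] q /\ dot q (wedge e) != 0].
have oT : open [set: ext R n m] by exact: openT.
have oE0 : open E0.
  by apply: open_neq0 => //; apply: Ck_dot => //; [exact: Ck_id|exact: Ck_cst].
have cC k : Ck k E0 (graph_frame e).
  by apply: (Ck_graph_frame oE0 (@Ck_id R _ k E0)) => q [].
pose G q := graph_frame e q *m (graph_frame e q)^T.
have cG k : Ck k E0 G by apply: Ck_mulmx => //; exact: Ck_trmx.
pose E1 : set (ext R n m) := [set q | E0 q /\ \det (G q) != 0].
have oE1 : open E1.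
  apply: open_neq0 => //; apply: Ck_det => // i j.
  exact: (Ck_mxP _ _ oE0).1 (cG 0%N) i j.
have sub : E1 `<=` E0 by move=> q [].
have E1p : E1 (psi y).
  have d1 : dot (psi y) (wedge e) = 1 by rewrite -pe dot_self_Qo.
  split; first by split=> //; rewrite d1 oner_eq0.
  rewrite /G {1 2}pe graph_frame_wedge ee ?unitmx1 // invmx1 mul1mx ee det1.
  exact: oner_neq0.
have cC1 := Ck_subset sub (cC 0%N).
apply: (@Ck_differentiable _ _ _ 0%N E1 _ _ _ E1p).
apply: Ck_mulmx => //; apply: Ck_mulmx => //; first exact: Ck_trmx.
apply: Ck_invmx => //; last exact: Ck_subset sub (cG 0%N).
by move=> q [_]; rewrite unitmxE unitfE.
Qed.

Lemma derive_projT_ambient v y : D y ->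
  'D_v PT y = 'D_('D_v psi y) (ambient_projT (frame (psi y))) (psi y).
Proof.
move=> Dy; have dA := ambient_projT_differentiable Dy.
have dpsi : differentiable psi y := Ck_differentiable (@cpsi 0%N) Dy.
have Ey := near_plane_frame psiQ Dy.
have E : {near y, PT =1 ambient_projT (frame (psi y)) \o psi}.
  have oE := near_plane_open oD cpsi (frame (psi y)).
  apply: filterS (open_nbhs_nbhs (conj oE Ey)) => z Ez.
  exact: (near_plane_projT psiQ Ez).
by rewrite (near_eq_derive _ E) (derive_comp v dpsi dA).
Qed.

End HomOfDerivative.

(** * The canonical 2-form *)

Section CanonicalForm.
Context {R : realType} {n m : nat}.

(** The value of [omega] with no parametrization left in it. This is possible because the result
    involves first derivatives only, and [ambient_projT] lets these be read off from [xi] and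
    [eta]. *)
Definition curvature_form (p xi eta : affext R n m) : 'rV[R]_m :=
  (xi.2 *m 'D_(eta.1) (ambient_projT (frame p.1)) p.1
   - eta.2 *m 'D_(xi.1) (ambient_projT (frame p.1)) p.1) *m projN p.1.

Section Parametrized.
Context {V : normedModType R}.
Variables (D : set V) (sigma : V -> affext R n m).
Hypothesis oD : open D.
Hypothesis sQ : forall y, D y -> Qaff (sigma y).
Hypothesis cs : forall k, Ck k D sigma.
Let s1 z := (sigma z).1.
Let s2 z := (sigma z).2.

Lemma Ck_fst k : Ck k D s1.
Proof.
have [g cg gE] := fst_lin (ext R n m) 'rV[R]_m.
by apply: (Ck_ext oD _ (Ck_lin_comp oD cg (@cs k))) => z _; exact: gE.
Qed.

Lemma Ck_snd k : Ck k D s2.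
Proof.
have [g cg gE] := snd_lin (ext R n m) 'rV[R]_m.
by apply: (Ck_ext oD _ (Ck_lin_comp oD cg (@cs k))) => z _; exact: gE.
Qed.

Lemma derive_fst_snd v y : D y ->
  ('d sigma y v).1 = 'D_v s1 y /\ ('d sigma y v).2 = 'D_v s2 y.
Proof.
move=> Dy; have ds : differentiable sigma y := Ck_differentiable (@cs 0%N) Dy.
have [g cg gE] := fst_lin (ext R n m) 'rV[R]_m.
have [h ch hE] := snd_lin (ext R n m) 'rV[R]_m.
have e1 := derive_comp_lin v cg ds; have e2 := derive_comp_lin v ch ds.
have f1 : (fun z => g (sigma z)) = s1 by apply/funext => z; rewrite gE.
have f2 : (fun z => h (sigma z)) = s2 by apply/funext => z; rewrite hE.
rewrite f1 in e1; rewrite f2 in e2.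
by split; [rewrite e1 gE|rewrite e2 hE]; rewrite deriveE.
Qed.

Let s1Q y : D y -> Qo (s1 y). Proof. by move=> /sQ[]. Qed.
Let s2p y : D y -> plane (s1 y) (s2 y). Proof. by move=> /sQ[]. Qed.
Let PN z := projN (s1 z).
Let PT z := projT (s1 z).

Lemma alpha_derivative v y : D y -> alpha (sigma y) ('d sigma y v) = 'D_v s2 y *m PN y.
Proof.
move=> Dy; have ds2 : differentiable s2 y := Ck_differentiable (@Ck_snd 0%N) Dy.
have [e1 _] := derive_fst_snd v Dy.
have [g cg gE] := fst_lin (ext R n m) 'rV[R]_m.
have gb : (g : affext R n m -> ext R n m) = @bpi R n m by apply/funext => q; rewrite gE.
have db q xi : 'd (@bpi R n m) q xi = xi.1.
  by rewrite -gb diff_lin // gb.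
rewrite /alpha db e1 (hom_of_derivative oD s1Q Ck_fst v Dy).
exact: (derive_section oD s1Q Ck_fst v Dy ds2 s2p).
Qed.

(** With [alpha] equal to the normal part of the derivative of [s2], the mixed second derivatives of
    [s2] cancel and the bracket of constant fields vanishes; only derivatives of the projection
    survive. *)
Lemma dnabla_alpha a b y : D y ->
  dnabla (fun y => projN (bpi (sigma y))) (fun y c => alpha (sigma y) ('d sigma y c))
    (cst a) (cst b) y = curvature_form (sigma y) ('d sigma y a) ('d sigma y b).
Proof.
move=> Dy.
have dPN : differentiable PN y := differentiable_projN oD s1Q Ck_fst Dy.
have nab c c' : nabla (fun y => projN (bpi (sigma y))) (cst c)
    (fun z => alpha (sigma z) ('d sigma z (cst c' z))) y
    = ('D_c ('D_c' s2) y *m PN y + 'D_c' s2 y *m 'D_c PN y) *m PN y.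
  rewrite /nabla; congr (_ *m _).
  have dd : differentiable ('D_c' s2) y.
    by have /CkS[_ c1] := @Ck_snd 1%N; exact: (Ck_differentiable (c1 c') Dy).
  have dp : differentiable (fun z => 'D_c' s2 z *m PN z) y by exact: differentiable_mulmx.
  have E : {near y, (fun z => 'D_c' s2 z *m PN z) =1
      (fun z => alpha (sigma z) ('d sigma z (cst c' z)))}.
    by apply: filterS (open_nbhs_nbhs (conj oD Dy)) => z Dz; rewrite alpha_derivative.
  by rewrite -(near_eq_diff E dp) -deriveE // (derive_mulmx c dd dPN).
have lie0 : lie (cst a) (cst b) y = 0.
  by rewrite /lie !diff_cst subrr.
have al0 : alpha (sigma y) ('d sigma y 0) = 0.
  by rewrite alpha_derivative // derive0 mul0mx.
rewrite /dnabla lie0 al0 subr0 !nab (schwarz_mx a b oD Dy (@Ck_snd 1%N)).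
rewrite -mulmxBl /curvature_form.
have [a1 a2] := derive_fst_snd a Dy; have [b1 b2] := derive_fst_snd b Dy.
have dT c : 'D_c PN y = - 'D_('D_c s1 y) (ambient_projT (frame (sigma y).1)) (sigma y).1.
  rewrite (derive_projN oD s1Q Ck_fst c Dy); congr (- _).
  exact: (derive_projT_ambient oD s1Q Ck_fst c Dy).
rewrite a1 a2 b1 b2 !dT -/(s1 y) -/(PN y); congr (_ *m _).
set X := 'D_a _ y; rewrite !mulmxN opprD opprK addrACA subrr add0r addrC.
by [].
Qed.

End Parametrized.

Lemma curvature_form_maps (V : normedModType R) (D : set V) (psi : V -> affext R n m) y a b :
  open D -> (forall y, D y -> Qaff (psi y)) -> (forall k, Ck k D psi) -> D y ->
  curvature_form (psi y) ('d psi y a) ('d psi y b) =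
  ('D_b (fun z => (psi z).2) y *m 'D_a (fun z => projN (psi z).1) y
   - 'D_a (fun z => (psi z).2) y *m 'D_b (fun z => projN (psi z).1) y) *m projN (psi y).1.
Proof.
move=> oD pQ cp Dy.
have [a1 a2] := derive_fst_snd cp a Dy; have [b1 b2] := derive_fst_snd cp b Dy.
have Q1 z : D z -> Qo (psi z).1 by move=> /pQ[].
have c1 k := @Ck_fst V D psi oD cp k.
have dT c : 'D_('D_c (fun z => (psi z).1) y) (ambient_projT (frame (psi y).1)) (psi y).1
    = - 'D_c (fun z => projN (psi z).1) y.
  apply: etrans (esym (derive_projT_ambient oD Q1 c1 c Dy)) _.
  by apply/esym/eqP; rewrite eqr_oppLR; apply/eqP; exact: (derive_projN oD Q1 c1 c Dy).
rewrite /curvature_form a1 a2 b1 b2 (dT a) (dT b).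
congr (_ *m _); rewrite 2!mulmxN opprK addrC; reflexivity.
Qed.

End CanonicalForm.

(** * The affine Grassmannian as a submanifold, and the evaluation of [omega] *)

Section AffineChart.
Context {R : realType} {n k : nat}.

Lemma complement_frame (p : ext R n (n + k)) : Qo p ->
  exists ep : 'M[R]_(k, n + k), [/\ ep *m ep^T = 1%:M, ep *m (frame p)^T = 0,
    ep *m projN p = ep & ep^T *m ep = projN p].
Proof.
move=> Q; have rk : \rank (projN p) = k by rewrite (rank_projN Q) addKn.
have [B fB BN] : exists2 B : 'M[R]_(k, n + k), row_free B & (B :=: projN p)%MS.
  exists (castmx (rk, erefl) (row_base (projN p))).
    by rewrite /row_free eqmx_cast eq_row_base rk.
  exact: eqmx_trans (eqmx_cast _ _) (eq_row_base _).
have [G [GB dG]] := gram_schmidt fB.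
have uG : G \in unitmx by rewrite unitmxE unitfE gt_eqF.
have BB : B *m projN p = B.
  have /submxP[X ->] : (B <= projN p)%MS by rewrite BN.
  by rewrite -mulmxA projN_idem.
exists (G *m B); move: (GB); set ep := G *m B => eep.
have epN : ep *m projN p = ep by rewrite /ep -mulmxA BB.
split=> //.
  by rewrite -epN -mulmxA -(projN_tr p) -trmx_mul (frame_projN Q) trmx0 mulmx0.
have /submxP[Y YE] : (projN p <= ep)%MS.
  by rewrite -BN /ep -{1}(mulKmx uG B) submxMl.
have h : projN p *m ep^T *m ep = projN p.
  by rewrite {1}YE -(mulmxA Y) eep mulmx1 YE.
by rewrite -[RHS]h -{1}epN trmx_mul projN_tr.
Qed.

(** Orthonormality gives [\det G ^+ 2 * \det (C *m C^T) = 1], and the positivity of [\det G] selects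
    the square root that keeps the orientation. *)
Lemma wedge_normalize (C : 'M[R]_(n, n + k)) : row_free C ->
  exists2 G : 'M[R]_n, G \in unitmx &
  (G *m C) *m (G *m C)^T = 1%:M /\ (Num.sqrt (\det (C *m C^T)))^-1 *: wedge C = wedge (G *m C).
Proof.
move=> fC; have [G [GC dG]] := gram_schmidt fC.
have uG : G \in unitmx by rewrite unitmxE unitfE gt_eqF.
exists G => //; split=> //; rewrite wedge_mul; congr (_ *: _).
have : \det G ^+ 2 * \det (C *m C^T) = 1.
  rewrite -[RHS](det1 R n) -GC trmx_mul mulmxA -(mulmxA G) det_mulmx det_mulmx det_tr.
  by rewrite expr2; ring.
move=> e1; have dG0 : \det G != 0 by rewrite gt_eqF.
have -> : \det (C *m C^T) = (\det G)^-1 ^+ 2.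
  by rewrite exprVn -[RHS]mulr1 -e1 mulrA mulVf ?mul1r // expf_neq0.
by rewrite sqrtr_sqr ger0_norm ?invrK // invr_ge0 ltW.
Qed.

Lemma row_free_section (C e : 'M[R]_(n, n + k)) : C *m e^T = 1%:M -> row_free C.
Proof. by move=> h; apply/row_freeP; exists e^T. Qed.

Lemma det_gram_gt0 (C : 'M[R]_(n, n + k)) : row_free C -> 0 < \det (C *m C^T).
Proof.
move=> /row_free_gram_unit; rewrite unitmxE unitfE => d0.
by rewrite lt_def d0 -dot_wedge dot_ge0.
Qed.

Lemma Qaff_graph (C : 'M[R]_(n, n + k)) (t : 'rV[R]_n) : row_free C ->
  Qaff ((Num.sqrt (\det (C *m C^T)))^-1 *: wedge C, t *m C).
Proof.
move=> fC; have [G uG [GC ->]] := wedge_normalize fC.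
have Q := frames_Qo GC; split=> //=; apply/(plane_projT Q).
rewrite (projT_wedge GC); have := esym (mulKmx uG C).
move: GC; move: (G *m C) => H HH ->.
by rewrite !mulmxA -(mulmxA _ H) HH mulmx1.
Qed.

Lemma contractZ (e0 : 'M[R]_(n, n + k)) (c : R) p : contract e0 (c *: p) = c *: contract e0 p.
Proof. by apply/matrixP => i j; rewrite !mxE /dot -scalemxAl mxE. Qed.

Lemma graph_frameZ (e0 : 'M[R]_(n, n + k)) (c : R) p : c != 0 ->
  graph_frame e0 (c *: p) = graph_frame e0 p.
Proof.
move=> c0; rewrite /graph_frame contractZ /dot -scalemxAl mxE scalerA.
by rewrite invfM mulrAC mulVf // mul1r.
Qed.
End AffineChart.

Lemma diff_factor {R : realType} {U V W : normedModType R} (f : V -> U) (g : U -> W)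
    (h : V -> W) x v : differentiable f x -> differentiable g (f x) ->
  {near x, g \o f =1 h} -> 'd g (f x) ('d f x v) = 'd h x v.
Proof.
move=> df dg gfh; have dd := differentiable_comp df dg.
by rewrite -(near_eq_diff gfh dd) (diff_comp df dg).
Qed.

Section QaffSubmanifold.
Context {R : realType} {n k : nat}.

Lemma Ck_row_mx {V : normedModType R} {a b c j} D (f : V -> 'M[R]_(a, b)) (g : V -> 'M[R]_(a, c)) :
  open D -> Ck j D f -> Ck j D g -> Ck j D (fun x => row_mx (f x) (g x)).
Proof.
move=> oD /(Ck_mxP _ _ oD) cf /(Ck_mxP _ _ oD) cg; apply/(Ck_mxP _ _ oD) => i l.
under eq_fun do rewrite mxE; case: (fintype.split l) => l'; [exact: cf|exact: cg].
Qed.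

Lemma Ck_mxvec {V : normedModType R} {a b j} D (f : V -> 'M[R]_(a, b)) :
  open D -> Ck j D f -> Ck j D (fun x => mxvec (f x)).
Proof.
move=> oD /(Ck_mxP _ _ oD) cf; apply/(Ck_mxP _ _ oD) => i l.
by case/mxvec_indexP: l => r s; rewrite ord1; under eq_fun do rewrite mxvecE; exact: cf.
Qed.

Lemma Ck_vec_mx {V : normedModType R} {a b j} D (f : V -> 'rV[R]_(a * b)) :
  open D -> Ck j D f -> Ck j D (fun x => vec_mx (f x)).
Proof.
move=> oD /(Ck_mxP _ _ oD) cf; apply/(Ck_mxP _ _ oD) => r s.
by under eq_fun do rewrite mxE; exact: cf.
Qed.

Lemma Ck_lsubmx {V : normedModType R} {a b c j} D (f : V -> 'M[R]_(a, b + c)) :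
  open D -> Ck j D f -> Ck j D (fun x => lsubmx (f x)).
Proof.
move=> oD /(Ck_mxP _ _ oD) cf; apply/(Ck_mxP _ _ oD) => r s.
by under eq_fun do rewrite mxE; exact: cf.
Qed.

Lemma Ck_rsubmx {V : normedModType R} {a b c j} D (f : V -> 'M[R]_(a, b + c)) :
  open D -> Ck j D f -> Ck j D (fun x => rsubmx (f x)).
Proof.
move=> oD /(Ck_mxP _ _ oD) cf; apply/(Ck_mxP _ _ oD) => r s.
by under eq_fun do rewrite mxE; exact: cf.
Qed.

(* The planes close to that of [e] are the graphs of linear maps from it to its
   orthogonal complement. *)
Lemma Qaff_submanifold : submanifold (n * k + n) (@Qaff R n (n + k)).
Proof.
move=> p [Qp pp]; have [ee pe] := framesP Qp.
have [ep [epep epe epN epP]] := complement_frame Qp.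
move: (frame p.1) ee pe epe => e ee pe epe.
have eep : e *m ep^T = 0 by rewrite -[LHS]trmxK trmx_mul trmxK epe trmx0.
have PN : projN p.1 = 1%:M - e^T *m e by rewrite /projN pe projT_wedge.
pose C (y : 'rV[R]_(n * k + n)) : 'M[R]_(n, n + k) := e + vec_mx (lsubmx y) *m ep.
pose sigma y : affext R n (n + k) :=
  ((Num.sqrt (\det (C y *m (C y)^T)))^-1 *: wedge (C y), rsubmx y *m C y).
pose kappa (q : affext R n (n + k)) : 'rV[R]_(n * k + n) :=
  row_mx (mxvec (graph_frame e q.1 *m ep^T)) (q.2 *m e^T).
(* Nonvanishing would not do: a plane with reversed orientation has the same [graph_frame], so
   [kappa] could not be injective. *)
pose W : set (affext R n (n + k)) := 
  [set q | [set: affext R n (n + k)] q /\ 0 < dot q.1 (wedge e)].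
have oT (U : normedModType R) : open [set: U] := openT.
have cid j : Ck j [set: affext R n (n + k)] (fun q => q) by exact: Ck_id.
have c1 j := @Ck_fst R n (n + k) _ _ _ (oT _) cid j.
have c2 j := @Ck_snd R n (n + k) _ _ _ (oT _) cid j.
have cw j : Ck j [set: affext R n (n + k)] (fun q => dot q.1 (wedge e)).
  exact: (Ck_dot (oT _) (c1 j) (@Ck_cst _ _ _ _ _ (wedge e))).
have oW : open W := open_gt0 (oT _) (cw 0%N).
have Ce y : C y *m e^T = 1%:M by rewrite /C mulmxDl ee -mulmxA epe mulmx0 addr0.
have Cep y : C y *m ep^T = vec_mx (lsubmx y).
  by rewrite /C mulmxDl eep add0r -mulmxA epep mulmx1.
have fC y : row_free (C y) := row_free_section (Ce y).
have cC j : Ck j setT C.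
  apply: Ck_add => //; first exact: Ck_cst.
  apply: Ck_mulmx => //; last exact: Ck_cst.
  by apply: Ck_vec_mx => //; apply: Ck_lsubmx => //; exact: Ck_id.
have s0 y : 0 < Num.sqrt (\det (C y *m (C y)^T)) by rewrite sqrtr_gt0 det_gram_gt0.
have csigma j : Ck j setT sigma.
  apply: Ck_pair => //; last first.
    by apply: Ck_mulmx => //; apply: Ck_rsubmx => //; exact: Ck_id.
  apply: Ck_scaler => //; last exact: Ck_wedge.
  apply: Ck_invf => //; first by move=> y _; rewrite gt_eqF.
  apply: Ck_sqrt => //; first by move=> y _; exact: det_gram_gt0.
  have cG := Ck_mulmx (oT _) (cC j) (Ck_trmx (oT _) (cC j)).
  exact: Ck_det (oT _) ((Ck_mxP _ _ (oT _)).1 cG).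
have ckappa j : Ck j W kappa.
  have sW : W `<=` setT by [].
  have q0 q : W q -> dot q.1 (wedge e) != 0 by move=> [_ q0]; rewrite gt_eqF.
  have cg := Ck_graph_frame oW (Ck_subset sW (c1 j)) q0.
  exact: (Ck_row_mx oW (Ck_mxvec oW (Ck_mulmx oW cg (@Ck_cst _ _ _ _ _ ep^T)))
    (Ck_mulmx oW (Ck_subset sW (c2 j)) (@Ck_cst _ _ _ _ _ e^T))).
have kw c y : c != 0 -> graph_frame e (c *: wedge (C y)) = C y.
  by move=> c0; rewrite graph_frameZ // graph_frame_wedge Ce ?unitmx1 // invmx1 mul1mx.
have ks y : kappa (sigma y) = y.
  rewrite /kappa kw ?invr_eq0 ?gt_eqF // Cep /= -mulmxA Ce mulmx1 vec_mxK.
  exact: hsubmxK.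
have W_ y : W (sigma y).
  split=> //=; rewrite /dot -scalemxAl mxE -[X in 0 < _ * X]/(dot _ _) dot_wedge Ce det1.
  by rewrite mulr1 invr_gt0.
have sk q : Qaff q -> W q -> sigma (kappa q) = q.
  move=> [Qq qq] [_ qW]; have qW0 : dot q.1 (wedge e) != 0 by rewrite gt_eqF.
  have [g [ug gE ge]] := graph_frame_unit Qq qW0.
  have [ff fw] := framesP Qq.
  have CE : C (kappa q) = g *m frame q.1.
    rewrite /C /kappa row_mxKl mxvecK -gE -mulmxA epP PN mulmxBr mulmx1 mulmxA ge mul1mx.
    by rewrite addrC subrK.
  have gd : \det g * dot q.1 (wedge e) = 1.
    by rewrite {1}fw dot_wedge -det_mulmx mulmxA -gE ge det1.
  have dg : 0 < \det g by rewrite -(pmulr_lgt0 _ qW) gd.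
  rewrite /sigma CE /kappa row_mxKr [RHS]surjective_pairing; congr pair.
    rewrite trmx_mul mulmxA -(mulmxA g) ff mulmx1 det_mulmx det_tr -expr2 sqrtr_sqr.
    by rewrite gtr0_norm // wedge_mul scalerA mulVf ?gt_eqF // scale1r -fw.
  have /submxP[x xE] : (q.2 <= frame q.1)%MS by [].
  have fe : frame q.1 *m e^T = invmx g.
    by rewrite -[LHS](mulKmx ug) (mulmxA g) -gE ge mulmx1.
  by rewrite xE -(mulmxA x) fe mulmxA -(mulmxA x) mulVmx // mulmx1.
exists W, setT, sigma, kappa; split.
  by split=> //; rewrite pe dot_wedge ee det1 ltr01.
have sE : sigma @` setT = @Qaff R n (n + k) `&` W.
  apply/seteqP; split=> [q [y _ <-]|q [Qq Wq]]; last by exists (kappa q) => //; exact: sk.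
  by split; [exact: Qaff_graph|exact: W_].
exact: (And5 (conj oW (oT _)) ((smooth_onP _ _).2 csigma) ((smooth_onP _ _).2 ckappa) sE
  (fun y _ => ks y)).
Qed.

(** Two things are needed to evaluate the [get]: every admissible parametrization gives the value of
    [curvature_form], and at least one exists. *)
Lemma omega_curvature_form (V : normedModType R) (D : set V)
    (psi : V -> affext R n (n + k)) y a b :
  open D -> (forall y, D y -> Qaff (psi y)) -> (forall k, Ck k D psi) -> D y ->
  omega (psi y) ('d psi y a) ('d psi y b) =
  curvature_form (psi y) ('d psi y a) ('d psi y b).
Proof.
move=> oD psiQ cpsi Dy; set xi := 'd psi y a; set eta := 'd psi y b.
rewrite /omega; set S := [set w | _].
suff [S0 SE] : S !=set0 /\ forall w, S w -> w = curvature_form (psi y) xi eta.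
  by apply: SE; exact: getPex.
split; last first.
  move=> w [W [E [sigma [kappa [[[oW oE] cs ck sE ks] Wp [a' [b' [xiE etaE ->]]]]]]]].
  have : (@Qaff R n (n + k) `&` W) (psi y) by split=> //; exact: psiQ.
  rewrite -sE => -[z Ez zp]; rewrite -zp ks // in xiE etaE *.
  rewrite -xiE -etaE; apply: (dnabla_alpha oE) => //; last exact: (smooth_onP _ _).1 cs.
  move=> z' Ez'; have : (sigma @` E) (sigma z') by exists z'.
  by rewrite sE => -[].
have [W [E0 [sigma [kappa [Wp sc]]]]] := Qaff_submanifold (psiQ _ Dy).
have [[oW oE] cs ck sE ks] := sc.
have : (@Qaff R n (n + k) `&` W) (psi y) by split=> //; exact: psiQ.
rewrite -sE => -[z Ez zp].
have kz : kappa (psi y) = z by rewrite -zp ks.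
have ds : differentiable sigma (kappa (psi y)) by rewrite kz; exact: (cs nil).
have dk : differentiable kappa (psi y) by exact: (ck nil).
have dp : differentiable psi y := Ck_differentiable (@cpsi 0%N) Dy.
have dkp : differentiable (kappa \o psi) y by exact: differentiable_comp.
have nr : {near y, sigma \o (kappa \o psi) =1 psi}.
  have oD' : open (D `&` psi @^-1` W).
    apply: open_setI_preimage => // x Dx; apply: differentiable_continuous.
    exact: Ck_differentiable (@cpsi 0%N) Dx.
  have Dy' : (D `&` psi @^-1` W) y by [].
  apply: filterS (open_nbhs_nbhs (conj oD' Dy')) => x [Dx Wx].
  have : (@Qaff R n (n + k) `&` W) (psi x) by split=> //; exact: psiQ.
  by rewrite -sE => -[x' Ex' xE]; rewrite -[(sigma \o _) x]/(sigma (kappa (psi x))) -xE ks.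
(* Near [y], [psi] factors through [sigma], so its tangent vectors lift to coordinate vectors via
   [kappa \o psi]. *)
have E c := diff_factor c dkp (ds : differentiable sigma ((kappa \o psi) y)) nr.
exists (dnabla (fun y => projN (bpi (sigma y)))
                  (fun y c => alpha (sigma y) ('d sigma y c))
     (cst ('d (kappa \o psi) y a)) (cst ('d (kappa \o psi) y b)) (kappa (psi y))).
exists W, E0, sigma, kappa; split=> //.
by exists ('d (kappa \o psi) y a), ('d (kappa \o psi) y b); split=> //; rewrite E.
Qed.

End QaffSubmanifold.

(** * Charts *)

Section Charts.
Context {R : realType} {n : nat} {M : oriented_manifold R n}.
Implicit Types (c : chart R n M) (x : M).

Lemma cinvK c x : atlas c -> cdom c x -> cinv c (cmap c x) = x.
Proof. by move=> /atlas_chart[_ _ ck _ _] cx; apply: ck; exact: mem_set. Qed.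

Lemma chart_image_open c (U : set M) : atlas c -> open U -> open (cmap c @` (U `&` cdom c)).
Proof.
move=> ac oU; have [oc oi ck cm ci] := atlas_chart ac.
have -> : cmap c @` (U `&` cdom c) = (cmap c @` cdom c) `&` cinv c @^-1` U.
  apply/seteqP; split=> [_ [x [Ux cx] <-]|_ [[x cx <-]]].
    by split; [exists x|rewrite /preimage /= cinvK].
  by rewrite /preimage /= cinvK // => Ux; exists x.
exact: open_setI_preimage.
Qed.

Lemma cdom_open c : atlas c -> open (cdom c).
Proof. by move=> /atlas_chart[]. Qed.

Lemma transition_near c c' x : atlas c -> atlas c' -> cdom c x -> cdom c' x ->
  {near cmap c x, cinv c' \o (cmap c' \o cinv c) =1 cinv c}.
Proof.
move=> ac ac' cx c'x; have oI := chart_image_open ac (cdom_open ac').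
have Ix : (cmap c @` (cdom c' `&` cdom c)) (cmap c x) by exists x.
apply: filterS (open_nbhs_nbhs (conj oI Ix)) => _ [z [c'z cz] <-] /=.
by rewrite !cinvK.
Qed.

Lemma transition_differentiable c c' x : atlas c -> atlas c' -> cdom c x -> cdom c' x ->
  differentiable (cmap c' \o cinv c) (cmap c x).
Proof.
by move=> ac ac' cx c'x; apply: (atlas_smooth ac ac' nil); exists x.
Qed.

Lemma transition_unit c c' x : atlas c -> atlas c' -> cdom c x -> cdom c' x ->
  jacobian (cmap c' \o cinv c) (cmap c x) \in unitmx.
Proof.
move=> ac ac' cx c'x; rewrite unitmxE unitfE gt_eqF //.
exact: (atlas_oriented ac ac').
Qed.

Lemma transition_diffE c c' x a :
  'd (cmap c' \o cinv c) (cmap c x) a = a *m jacobian (cmap c' \o cinv c) (cmap c x).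
Proof. by rewrite /jacobian mul_rV_lin1. Qed.

Lemma msmooth_on_Ck (W : normedModType R) (U : set M) (f : M -> W) c :
  msmooth_on U f -> atlas c -> forall k, Ck k (cmap c @` (U `&` cdom c)) (f \o cinv c).
Proof. by move=> sf ac; apply/smooth_onP; exact: sf. Qed.

Lemma mdiff_chart (W : normedModType R) (U : set M) (f : M -> W) c x a :
  msmooth_on U f -> U x -> atlas c -> cdom c x ->
  'd (f \o cinv c) (cmap c x) a = mdiff f x (coord_vec c a x).
Proof.
move=> sf Ux ac cx; have ac' := chart_at_atlas x; have c'x := chart_at_dom x.
rewrite /mdiff /coord_vec; move: (chart_at x) ac' c'x => c' ac' c'x.
have dt := transition_differentiable ac ac' cx c'x.
have cc : (cmap c' \o cinv c) (cmap c x) = cmap c' x by rewrite /= cinvK.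
have df : differentiable (f \o cinv c') ((cmap c' \o cinv c) (cmap c x)).
  by rewrite cc; apply: (sf _ ac' nil); exists x.
have nr : {near cmap c x, (f \o cinv c') \o (cmap c' \o cinv c) =1 f \o cinv c}.
  by apply: filterS (transition_near ac ac' cx c'x) => z /= ->.
have := diff_factor a dt df nr; rewrite cc => E; exact: esym E.
Qed.

End Charts.

(** * Curvature *)

Section Curvature.
Context {R : realType} {V : normedModType R} {m : nat}.
Variables (D : set V) (P : V -> 'M[R]_m) (s : V -> 'rV[R]_m).
Hypothesis oD : open D.
Hypothesis cP : forall k, Ck k D P.
Hypothesis cs : forall k, Ck k D s.

Lemma curvature_constant a b y : D y -> curvature P (cst a) (cst b) s y =
  ('D_b s y *m 'D_a P y - 'D_a s y *m 'D_b P y) *m P y.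
Proof.
move=> Dy; have dP : differentiable P y := Ck_differentiable (@cP 0%N) Dy.
have nab c c' : nabla P (cst c) (nabla P (cst c') s) y
    = ('D_c ('D_c' s) y *m P y + 'D_c' s y *m 'D_c P y) *m P y.
  rewrite /nabla; congr (_ *m _).
  have /CkS[_ c1] := @cs 1%N.
  have dd : differentiable ('D_c' s) y := Ck_differentiable (c1 c') Dy.
  have dp : differentiable (fun z => 'D_c' s z *m P z) y := differentiable_mulmx dd dP.
  have E : {near y, (fun z => 'D_c' s z *m P z) =1
      (fun z => 'd s z (cst c' z) *m P z)}.
    apply: filterS (open_nbhs_nbhs (conj oD Dy)) => z Dz.
    by rewrite deriveE //; exact: (Ck_differentiable (@cs 0%N) Dz).
  by rewrite -(near_eq_diff E dp) -deriveE // (derive_mulmx c dd dP).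
have lie0 : nabla P (lie (cst a) (cst b)) s y = 0.
  by rewrite /nabla /lie !diff_cst subrr linear0 mul0mx.
rewrite /curvature lie0 subr0 !nab (schwarz_mx a b oD Dy (@cs 1%N)) -mulmxBl.
by congr (_ *m _); rewrite opprD addrACA subrr add0r.
Qed.

End Curvature.

(** * Flatness in a chart, and the Lagrangian condition deduced from leaves *)

Section FlatNormalBundle.
Context {R : realType} {n k : nat} {M : oriented_manifold R n}.
Variable phi : M -> affext R n (n + k).
Hypothesis phi_smooth : msmooth_on [set: M] phi.
Hypothesis phi_Q : forall x, Qaff (phi x).
Hypothesis EN_flat : flat_EN (@bpi R n (n + k) \o phi).

Section InChart.
Variable c : chart R n M.
Hypothesis ac : atlas c.
Let D := cmap c @` cdom c.
Let psi := phi \o cinv c.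
Let v z := (psi z).2.
Let P z := projN (psi z).1.

Lemma chart_domain_open : open D. Proof. by have [_ + _ _ _] := atlas_chart ac. Qed.

Lemma local_Ck j : Ck j D psi.
Proof. by have := msmooth_on_Ck (k := j) phi_smooth ac; rewrite setTI. Qed.

Lemma local_Qaff z : D z -> Qaff (psi z).
Proof. by move=> _; exact: phi_Q. Qed.

Lemma local_Qo z : D z -> Qo (psi z).1.
Proof. by move=> _; have [] := phi_Q (cinv c z). Qed.

Lemma local_Ck_fst j : Ck j D (fun z => (psi z).1).
Proof. exact: (Ck_fst chart_domain_open local_Ck). Qed.

Lemma local_Ck_snd j : Ck j D v.
Proof. exact: (Ck_snd chart_domain_open local_Ck). Qed.

Lemma local_Ck_projN j : Ck j D P.
Proof. exact: (Ck_projN chart_domain_open local_Qo local_Ck_fst). Qed.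

Lemma flat_section (E : set 'rV[R]_n) (s : 'rV[R]_n -> 'rV[R]_(n + k)) a b y :
  open E -> E `<=` D -> (forall j, Ck j E s) ->
  (forall z, E z -> s z *m P z = s z) -> E y ->
  ('D_b s y *m 'D_a P y - 'D_a s y *m 'D_b P y) *m P y = 0.
Proof.
move=> oE ED cs sP Ey.
have cPE j : Ck j E P := Ck_subset ED (@local_Ck_projN j).
rewrite -(curvature_constant oE cPE cs a b Ey).
apply: (EN_flat ac oE ED) => //; try exact: (smooth_onP _ _).2.
- by apply/smooth_onP => j; exact: Ck_cst.
- by apply/smooth_onP => j; exact: Ck_cst.
move=> z Ez; apply/(orth_plane_projN (local_Qo (ED _ Ez))); exact: sP.
Qed.

(** The projections of the constant basis vectors are sections of the normal bundle; flatness on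
    each of them gives one row of the identity. *)
Lemma flat_projN a b y : D y -> ('D_b P y *m 'D_a P y - 'D_a P y *m 'D_b P y) *m P y = 0.
Proof.
move=> Dy; have oD := chart_domain_open.
have dP : differentiable P y := Ck_differentiable (@local_Ck_projN 0%N) Dy.
apply/row_matrixP => i; rewrite row0 rowE; set w := delta_mx 0 i.
have cs j : Ck j D (fun z => w *m P z).
  exact: (Ck_mulmx oD (@Ck_cst _ _ _ _ _ w) (@local_Ck_projN j)).
have sP z : D z -> w *m P z *m P z = w *m P z.
  by move=> Dz; rewrite -mulmxA (projN_idem (local_Qo Dz)).
have Ds d : 'D_d (fun z => w *m P z) y = w *m 'D_d P y by exact: derive_mulmxl.
have := flat_section a b oD (@subset_refl _ D) cs sP Dy.
rewrite !Ds; move: ('D_b P y) ('D_a P y) (P y) => X Y Z.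
by rewrite [w *m (_ *m _)]mulmxA mulmxBr !mulmxA.
Qed.

Lemma local_lagrangian y a b : D y -> lagrangian phi ->
  ('D_b v y *m 'D_a P y - 'D_a v y *m 'D_b P y) *m P y = 0.
Proof.
move=> [x cx <-] L; have Dy : D (cmap c x) by exists x.
have oD := chart_domain_open.
apply: etrans (esym (curvature_form_maps a b oD local_Qaff local_Ck Dy)) _.
apply: etrans (esym (omega_curvature_form a b oD local_Qaff local_Ck Dy)) _.
rewrite /psi (mdiff_chart a phi_smooth I ac cx) (mdiff_chart b phi_smooth I ac cx).
rewrite /= cinvK //; exact: L.
Qed.

End InChart.

Lemma lagrangian_local :
  (forall x a b, let c := chart_at x in let y := cmap c x in
     ('D_b (fun z => (phi (cinv c z)).2) y *m 'D_a (fun z => projN (phi (cinv c z)).1) y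
      - 'D_a (fun z => (phi (cinv c z)).2) y *m 'D_b (fun z => projN (phi (cinv c z)).1) y)
     *m projN (phi x).1 = 0) -> lagrangian phi.
Proof.
move=> h x a b; have ac := chart_at_atlas x; have cx := chart_at_dom x.
have := h x a b => /=; rewrite /mdiff; move: (chart_at x) ac cx => c ac cx hx.
have oD := chart_domain_open ac; have Dy : (cmap c @` cdom c) (cmap c x) by exists x.
have e1 := curvature_form_maps a b oD (local_Qaff (c := c)) (local_Ck ac) Dy.
have e2 := omega_curvature_form a b oD (local_Qaff (c := c)) (local_Ck ac) Dy.
have xE : (phi \o cinv c) (cmap c x) = phi x by rewrite /= cinvK.
rewrite xE in e1 e2; rewrite e2 e1; exact: hx.
Qed.

(* Along a leaf [f = v + s], [s] is a section of [E_N]; the tangency of [f] makes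
   [df] contribute symmetrically, and flatness applied to [s] does the rest. *)
Lemma lagrangian_of_leaves :
  (forall x, exists (U : set M) S, [/\ open U, U x & integral_submanifold phi U S]) ->
  lagrangian phi.
Proof.
move=> leaf; apply: lagrangian_local => x a b /=.
have [U [S [oU Ux [_ [f [[sf _] _ fP]]]]]] := leaf x.
have ac := chart_at_atlas x; have cx := chart_at_dom x.
move: (chart_at x) ac cx => c ac cx.
set D := cmap c @` cdom c; set E := cmap c @` (U `&` cdom c).
have oD : open D := chart_domain_open ac.
have oE : open E by exact: chart_image_open.
have ED : E `<=` D by move=> _ [z [_ cz] <-]; exists z.
have Ey : E (cmap c x) by exists x.
pose psi := phi \o cinv c; pose v z := (psi z).2; pose P z := projN (psi z).1.
pose F := f \o cinv c.
have cF j : Ck j E F by exact: msmooth_on_Ck.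
have cv j : Ck j E v := Ck_subset ED (local_Ck_snd (j := j) ac).
have cP j : Ck j E P := Ck_subset ED (local_Ck_projN (j := j) ac).
have orth0 m (A : set 'rV[R]_m) : orth A 0.
  by move=> u _; rewrite /dot trmx0 mulmx0 mxE.
have FP z : E z -> F z - v z = (F z - v z) *m P z.
  move=> [w [Uw cw] <-]; have [Qw _] := phi_Q w.
  have : affine_plane (phi w) (f w).
    by rewrite (fP _ Uw); exists 0 => //; rewrite ?addr0.
  case=> u /(orth_plane_projN Qw) uP fE.
  by rewrite /F /v /P /psi /= cinvK // -fE addrC addKr.
(* The normal part [X *m N] of a tangent vector [X] is a direction of the affine plane, hence
   orthogonal to [X] itself; but its product with [X] is its squared length. *)
have dFP d z : E z -> 'D_d F z *m P z = 0.
  move=> [w [Uw cw] <-]; have [Qw _] := phi_Q w.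
  have dF : differentiable F (cmap c w).
    by apply: (Ck_differentiable (@cF 0%N)); exists w.
  rewrite deriveE // (mdiff_chart d sf Uw ac cw) /P /psi /= cinvK //.
  set X := mdiff f w _; set N := projN _.
  have NN : N *m N = N := projN_idem Qw.
  have NX : orth (plane (phi w).1) (X *m N).
    by apply/(orth_plane_projN Qw); rewrite -mulmxA NN.
  have FPw := FP (cmap c w) (ex_intro2 _ _ _ (conj Uw cw) erefl).
  rewrite /F /v /P /psi /= cinvK // in FPw.
  have : affine_plane (phi w) (f w + X *m N).
    exists ((f w - (phi w).2) + X *m N); last by rewrite addrA [_ + (_ - _)]addrC subrK.
    by apply/(orth_plane_projN Qw); rewrite mulmxDl -FPw -mulmxA NN.
  rewrite (fP _ Uw) => -[u ou /addrI uE]; rewrite uE in ou.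
  have := ou X (ex_intro2 _ _ _ I erefl).
  rewrite -{1}NN mulmxA dotC dot_mulmxl projN_tr => X0.
  by apply: dot_eq0; rewrite -[in RHS]X0.
have dP z : E z -> differentiable P z := Ck_differentiable (@cP 0%N).
have dv z : E z -> differentiable v z := Ck_differentiable (@cv 0%N).
have dF z : E z -> differentiable F z := Ck_differentiable (@cF 0%N).
pose s z := F z - v z.
have cs j : Ck j E s by exact: (Ck_sub oE (@cF j) (@cv j)).
have sP z : E z -> s z *m P z = s z by move=> Ez; rewrite /s -FP.
have fs := flat_section ac a b oE ED cs sP Ey.
have Ds d : 'D_d s (cmap c x) = 'D_d F (cmap c x) - 'D_d v (cmap c x).
  exact: (derive_subf d (dF _ Ey) (dv _ Ey)).
have sym d d' : 'D_d' ('D_d F) (cmap c x) *m P (cmap c x)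
    = - ('D_d F (cmap c x) *m 'D_d' P (cmap c x)).
  have /CkS[_ c1] := @cF 1%N.
  have dd : differentiable ('D_d F) (cmap c x) := Ck_differentiable (c1 d) Ey.
  have nr : {near cmap c x, (fun z => 'D_d F z *m P z) =1 cst 0}.
    by apply: filterS (open_nbhs_nbhs (conj oE Ey)) => z Ez; rewrite dFP.
  have := near_eq_derive d' nr; rewrite derive_cst (derive_mulmx d' dd (dP _ Ey)).
  by move/eqP; rewrite addr_eq0 => /eqP.
have ab : 'D_b F (cmap c x) *m 'D_a P (cmap c x) = 'D_a F (cmap c x) *m 'D_b P (cmap c x).
  apply: oppr_inj; apply: etrans (esym (sym b a)) (etrans _ (sym a b)).
  exact: (congr1 (mulmx^~ _) (esym (schwarz_mx a b oE Ey (@cF 1%N)))).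
have xE : P (cmap c x) = projN (phi x).1 by rewrite /P /psi /= cinvK.
rewrite (Ds a) (Ds b) in fs; rewrite -xE.
suff : ('D_b v (cmap c x) *m 'D_a P (cmap c x)
  - 'D_a v (cmap c x) *m 'D_b P (cmap c x)) *m P (cmap c x) = 0 by [].
have {}fs : (('D_b F (cmap c x) - 'D_b v (cmap c x)) *m 'D_a P (cmap c x)
  - ('D_a F (cmap c x) - 'D_a v (cmap c x)) *m 'D_b P (cmap c x)) *m P (cmap c x) = 0 := fs.
move: ('D_b F _) ('D_a F _) ('D_b v _) ('D_a v _) ('D_a P _) ('D_b P _) (P _) ab fs.
move=> X Y B A dA dB Q XY; rewrite !mulmxBl XY => h; apply/eqP; rewrite -oppr_eq0 -h.
by apply/eqP/matrixP => i j; rewrite !mxE; ring.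
Qed.

End FlatNormalBundle.

(** * Parallel normal frames *)

Lemma ball_constant {R : realType} {V : normedModType R} {a b} (y0 : V) (r : R)
    (f : V -> 'M[R]_(a, b)) : 0 < r ->
  (forall y, ball y0 r y -> differentiable f y) ->
  (forall y, ball y0 r y -> forall v, 'D_v f y = 0) ->
  forall y, ball y0 r y -> f y = f y0.
Proof.
move=> r0 df Df y By; have B0 : ball y0 r y0 by exact: ballxx.
have seg (t : R) : 0 <= t <= 1 -> ball y0 r (y0 + t *: (y - y0)).
  have By' : ball y0 r (y0 + (y - y0)) by rewrite addrC subrK.
  by move=> t01; exact: (ball_segment B0 By' t01).
have := @mvi R V a b f y0 (y - y0) 0 (fun t t01 => df _ (seg t t01)).
rewrite [y0 + (y - y0)]addrC subrK => h; apply/eqP; rewrite -subr_eq0 -normr_le0.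
by apply: h => t t01; rewrite Df ?normr0 //; exact: seg.
Qed.

(** The rank condition makes the rows of [nu] a basis of the image of [P], and the left side is the
    projection computed from that basis. *)
Lemma proj_span {R : realType} {m k} (P : 'M[R]_m) (ep : 'M[R]_(k, m)) :
  P *m P = P -> P^T = P -> \rank P = k ->
  let nu := ep *m P in nu *m nu^T \in unitmx ->
  nu^T *m invmx (nu *m nu^T) *m nu = P.
Proof.
move=> PP sP rP nu u.
have nP : nu *m P = nu by rewrite /nu -mulmxA PP.
have fn : row_free nu.
  by apply/row_freeP; exists (nu^T *m invmx (nu *m nu^T)); rewrite mulmxA mulmxV.
have /submxP[Y YE] : (P <= nu)%MS.
  have rn : \rank nu = k by apply/eqP.
  have [_ <-] := mxrank_leqif_sup (submxMl ep P : (nu <= P)%MS).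
  by rewrite rn rP.
have Pn : P *m nu^T = nu^T by rewrite -{1}sP -trmx_mul nP.
by rewrite -{1}Pn {1}YE -(mulmxA Y nu) -(mulmxA Y) mulmxV // mulmx1 -YE.
Qed.

Section ParallelFrame.
Context {R : realType} {n m k : nat}.
Variables (D : set 'rV[R]_n) (P : 'rV[R]_n -> 'M[R]_m) (v : 'rV[R]_n -> 'rV[R]_m).
Variables (y0 : 'rV[R]_n) (ep : 'M[R]_(k, m)).
Hypothesis oD : open D.
Hypothesis Dy0 : D y0.
Hypothesis cP : forall j, Ck j D P.
Hypothesis cv : forall j, Ck j D v.
Hypothesis PP : forall y, D y -> P y *m P y = P y.
Hypothesis sP : forall y, D y -> (P y)^T = P y.
Hypothesis rP : forall y, D y -> \rank (P y) = k.
Hypothesis epep : ep *m ep^T = 1%:M.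
Hypothesis epP : ep *m P y0 = ep.
Hypothesis flat : forall a b y, D y ->
  ('D_b P y *m 'D_a P y - 'D_a P y *m 'D_b P y) *m P y = 0.
Hypothesis lagr : forall a b y, D y ->
  ('D_b v y *m 'D_a P y - 'D_a v y *m 'D_b P y) *m P y = 0.

(** [U] extracts the frame rows and [E^T] the last row. The stack [mu] of the moving frame [nu] and
    of [v] carries both systems at once, and [D1] is where [nu] is still a frame. *)
Let U : 'M[R]_(k, k + 1) := row_mx 1%:M 0.
Let E : 'M[R]_(k + 1, 1) := col_mx 0 1%:M.
Let nu y := ep *m P y.
Let mu y : 'M[R]_(k + 1, m) := col_mx (nu y) (v y).
Let S y := nu y *m (nu y)^T.
Let L y := (nu y)^T *m invmx (S y).
Let D1 : set 'rV[R]_n := [set y | D y /\ \det (S y) != 0].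

Let cnu j : Ck j D nu. Proof. exact: (Ck_mulmx oD (@Ck_cst _ _ _ _ _ ep) (@cP j)). Qed.

Let cS j : Ck j D S. Proof. exact: (Ck_mulmx oD (@cnu j) (Ck_trmx oD (@cnu j))). Qed.

Let oD1 : open D1.
Proof. exact: (open_neq0 oD (Ck_det oD ((Ck_mxP _ _ oD).1 (@cS 0%N)))). Qed.

Let D1D : D1 `<=` D. Proof. by move=> y []. Qed.

Let D1y0 : D1 y0.
Proof. by split=> //; rewrite /S /nu epP epep det1 oner_neq0. Qed.

Let uS y : D1 y -> S y \in unitmx. Proof. by rewrite unitmxE unitfE => -[]. Qed.

Let cL j : Ck j D1 L.
Proof.
have cn := Ck_subset D1D (@cnu j); have cs := Ck_subset D1D (@cS j).
exact: (Ck_mulmx oD1 (Ck_trmx oD1 cn) (Ck_invmx oD1 uS cs)).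
Qed.

Let cmu j : Ck j D mu.
Proof.
apply/(Ck_mxP _ _ oD) => i l; under eq_fun do rewrite mxE.
case: (fintype.split i) => i'; first exact: (Ck_mxP _ _ oD).1 (@cnu j) i' l.
exact: (Ck_mxP _ _ oD).1 (@cv j) i' l.
Qed.

Let nuE y : nu y = U *m mu y.
Proof. by rewrite /U /mu mul_row_col mul1mx mul0mx addr0. Qed.

Let nuP y : D y -> nu y *m P y = nu y.
Proof. by move=> Dy; rewrite /nu -mulmxA (PP Dy). Qed.

Let Lnu y : D1 y -> L y *m nu y = P y.
Proof. by move=> D1y; have Dy := D1D D1y; apply: proj_span; auto; exact: uS. Qed.

Let nuL y : D1 y -> nu y *m L y = 1%:M.
Proof. by move=> D1y; rewrite /L mulmxA mulmxV //; exact: uS. Qed.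

Let PL y : D1 y -> P y *m L y = L y.
Proof.
move=> D1y; have Dy := D1D D1y.
by rewrite /L mulmxA -{1}(sP Dy) -trmx_mul (nuP Dy).
Qed.

Let dP y : D y -> differentiable P y. Proof. exact: (Ck_differentiable (@cP 0%N)). Qed.
Let dnu y : D y -> differentiable nu y. Proof. exact: (Ck_differentiable (@cnu 0%N)). Qed.
Let dmu y : D y -> differentiable mu y. Proof. exact: (Ck_differentiable (@cmu 0%N)). Qed.
Let dL y : D1 y -> differentiable L y. Proof. exact: (Ck_differentiable (@cL 0%N)). Qed.

Let Dnu a y : D y -> 'D_a nu y = U *m 'D_a mu y.
Proof.
move=> Dy; have -> : nu = fun z => U *m mu z by apply/funext => z; exact: nuE.
exact: (derive_mulmxl U a (dmu Dy)).
Qed.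

Let DL a y : D1 y -> 'D_a L y = 'D_a P y *m L y - L y *m 'D_a nu y *m L y.
Proof.
move=> D1y; have Dy := D1D D1y.
have nr : {near y, (fun z => L z *m nu z) =1 P}.
  by apply: filterS (open_nbhs_nbhs (conj oD1 D1y)) => z; exact: Lnu.
have := near_eq_derive a nr; rewrite (derive_mulmx a (dL D1y) (dnu Dy)).
move: (nuL D1y); move: ('D_a L y) ('D_a nu y) ('D_a P y) (L y) (nu y) => A B C X Y YX h.
by rewrite -h mulmxDl -(mulmxA A) YX mulmx1 addrK.
Qed.

(* Multiplying the equation [D_a s P = 0] by the right inverse [L] of [nu] turns
   it into a linear system with connection matrix [conn a]. *)
Let conn a y : 'M[R]_(k + 1) := - ('D_a mu y *m L y *m U).

Let cDmu a j : Ck j D ('D_a mu). Proof. by have /CkS[_] := @cmu j.+1; exact. Qed.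

Let cconn a j : Ck j D1 (conn a).
Proof.
have c1 := Ck_subset D1D (@cDmu a j).
exact: (Ck_opp oD1 (Ck_mulmx oD1 (Ck_mulmx oD1 c1 (@cL j)) (@Ck_cst _ _ _ _ _ U))).
Qed.

Let conn_linear b y : D1 y -> conn b y = \sum_i b 0 i *: conn (delta_mx 0 i) y.
Proof.
move=> D1y; have dm := dmu (D1D D1y).
have e := derive_sum_dir b dm.
rewrite /conn e !mulmx_suml -sumrN; apply: eq_bigr => i _.
by rewrite -!scalemxAl scalerN.
Qed.

(** The frame rows of this identity are the flatness of the normal bundle, its last row is the
    vanishing of the 2-form. *)
Let symmetric a b y : D y ->
  'D_b mu y *m 'D_a P y *m P y = 'D_a mu y *m 'D_b P y *m P y.
Proof.
move=> Dy; have Dm c : 'D_c mu y = col_mx (ep *m 'D_c P y) ('D_c v y).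
  have dv : differentiable v y := Ck_differentiable (@cv 0%N) Dy.
  rewrite -[LHS]vsubmxK; congr col_mx.
    have -> : usubmx ('D_c mu y) = U *m 'D_c mu y.
      by rewrite -{2}[ 'D_c mu y]vsubmxK /U mul_row_col mul1mx mul0mx addr0.
    by rewrite -Dnu // (derive_mulmxl ep c (dP Dy)).
  have -> : dsubmx ('D_c mu y) = E^T *m 'D_c mu y.
    rewrite -{2}[ 'D_c mu y]vsubmxK /E tr_col_mx mul_row_col trmx0 trmx1 mul0mx add0r.
    by rewrite mul1mx.
  have fE : (fun z => E^T *m mu z) = v.
    apply/funext => z; rewrite /E /mu tr_col_mx mul_row_col trmx0 trmx1 mul0mx add0r.
    by rewrite mul1mx.
  by have e := derive_mulmxl E^T c (dmu Dy); rewrite fE in e; exact: esym e.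
have f0 := flat a b Dy; have l0 := lagr a b Dy; rewrite (Dm a) (Dm b).
move: ('D_a v y) ('D_b v y) ('D_a P y) ('D_b P y) (P y) f0 l0 => va vb Pa Pb Q.
rewrite !mulmxBl => /eqP; rewrite subr_eq0 => /eqP f0 /eqP; rewrite subr_eq0 => /eqP l0.
rewrite !mul_col_mx l0; congr col_mx.
by rewrite -!mulmxA; congr (_ *m _); rewrite !mulmxA.
Qed.

(** Once everything is expanded, the terms to compare are the mixed derivatives of [mu], equal by
    Schwarz, and ['D_b mu *m 'D_a P *m L], covered by [symmetric] because [L = P *m L]. *)
Let integrable a b y : D1 y ->
  'D_a (conn b) y + conn a y *m conn b y = 'D_b (conn a) y + conn b y *m conn a y.
Proof.
move=> D1y; have Dy := D1D D1y.
have Dc c d : 'D_c (conn d) y = - (('D_c ('D_d mu) y *m L y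
    + ('D_d mu y *m 'D_c P y *m L y - 'D_d mu y *m L y *m 'D_c nu y *m L y)) *m U).
  have dd : differentiable ('D_d mu) y := Ck_differentiable (@cDmu d 0%N) Dy.
  have d1 : differentiable (fun z => 'D_d mu z *m L z) y := differentiable_mulmx dd (dL D1y).
  have d2 : differentiable (fun z => 'D_d mu z *m L z *m U) y.
    exact: (differentiable_mulmx d1 (differentiable_cst U y)).
  rewrite (derive_oppf c d2) (derive_mulmxr U c d1) (derive_mulmx c dd (dL D1y)) (DL c D1y).
  by congr (- (_ *m _)); congr (_ + _); rewrite mulmxBr !mulmxA.
have cc c d : conn c y *m conn d y = 'D_c mu y *m L y *m 'D_d nu y *m L y *m U.
  by rewrite /conn mulNmx mulmxN opprK (Dnu d Dy) !mulmxA.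
have sch := schwarz_mx a b oD Dy (@cmu 1%N).
have := symmetric a b Dy; have := PL D1y; move: sch.
move=> sch' Ql h.
apply: etrans (congr2 +%R (Dc a b) (cc a b))
  (etrans _ (esym (congr2 +%R (Dc b a) (cc b a)))).
move: sch' Ql h.
move: ('D_a ('D_b mu) y) ('D_b ('D_a mu) y) ('D_a mu y) ('D_b mu y) ('D_a P y) ('D_b P y).
move: ('D_a nu y) ('D_b nu y) (P y) (L y) => na nb Q l X X' A B PA PB -> Ql h.
have {}h : B *m PA *m l = A *m PB *m l by rewrite -Ql !mulmxA h.
rewrite h; move: (A *m PB *m l) => Z.
move: (B *m l *m na *m l) (A *m l *m nb *m l) (X *m l) => b' a' x'.
rewrite -[LHS]addrC -[RHS]addrC -!mulmxBl; congr (_ *m _).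
by apply/matrixP => i j; rewrite !mxE; ring.
Qed.

Lemma parallel_frame : exists (r : R) (xi : 'rV[R]_n -> 'M[R]_(k, m)) (g : 'rV[R]_n -> 'rV[R]_m),
  [/\ 0 < r, ball y0 r `<=` D, xi y0 = ep,
      forall j, Ck j (ball y0 r) xi /\ Ck j (ball y0 r) g &
      forall y, ball y0 r y ->
        [/\ xi y *m P y = xi y, xi y *m (xi y)^T = 1%:M, (g y - v y) *m P y = g y - v y,
            forall a, 'D_a xi y *m P y = 0 & forall a, 'D_a g y *m P y = 0]].
Proof.
have [r [W [r0 BD W0 cW DW]]] := frobenius oD1 D1y0 cconn conn_linear integrable.
pose s y := W y *m mu y; pose xi y := U *m s y; pose g y := E^T *m s y.
have oB : open (ball y0 r) by exact: ball_open.
have cs j : Ck j (ball y0 r) s.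
  exact: (Ck_mulmx oB (@cW j) (Ck_subset (fun y By => D1D (BD _ By)) (@cmu j))).
have cxi j : Ck j (ball y0 r) xi := Ck_mulmx oB (@Ck_cst _ _ _ _ _ U) (cs j).
have cg j : Ck j (ball y0 r) g := Ck_mulmx oB (@Ck_cst _ _ _ _ _ E^T) (cs j).
have dW y : ball y0 r y -> differentiable W y := Ck_differentiable (@cW 0%N).
have ds y : ball y0 r y -> differentiable s y := Ck_differentiable (@cs 0%N).
have dxi y : ball y0 r y -> differentiable xi y := Ck_differentiable (@cxi 0%N).
have B0 : ball y0 r y0 := ballxx y0 r0.
have UE : U *m E = 0 by rewrite /U /E mul_row_col mulmx0 mul0mx addr0.
have UU : U^T *m U + E *m E^T = 1%:M.
  rewrite /U /E tr_row_mx tr_col_mx !trmx0 !trmx1 mul_col_row mul_col_row.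
  rewrite !mulmx0 !mul0mx !mul1mx add_block_mx !addr0 !add0r.
  by rewrite -scalar_mx_block.
have EE : E^T *m E = 1%:M.
  by rewrite /E tr_col_mx mul_row_col trmx0 trmx1 mul0mx mul1mx add0r.
have Emu y : E^T *m mu y = v y.
  by rewrite /E /mu tr_col_mx mul_row_col trmx0 trmx1 mul0mx mul1mx add0r.
(* The connection subtracts [W *m 'D_a mu *m L *m nu], and [L *m nu] is the projection [P]. *)
have DsP a y : ball y0 r y -> 'D_a s y *m P y = 0.
  move=> By; have D1y := BD _ By; have Dy := D1D D1y.
  apply: etrans (congr1 (mulmx^~ _) (derive_mulmx a (dW y By) (dmu Dy))) _.
  have := nuE y; have := Lnu D1y; have := PP Dy; have := DW y By a; rewrite /conn.
  move: ('D_a W y) ('D_a mu y) (W y) (mu y) (P y) (L y) (nu y) => A B w u Q l N -> QQ lN NE.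
  rewrite mulmxN mulNmx -!mulmxA -NE lN mulmxDl mulNmx -!mulmxA QQ.
  by rewrite addrC subrr.
(* Every connection matrix ends with [U], which kills [E]. So [v] enters [g] with coefficient 1 and
   does not enter [xi]. *)
have WE y : ball y0 r y -> W y *m E = E.
  move=> By; have dWE z : ball y0 r z -> differentiable (fun z => W z *m E) z.
    by move=> Bz; exact: (differentiable_mulmx (dW z Bz) (differentiable_cst E z)).
  have DWE z : ball y0 r z -> forall a, 'D_a (fun z => W z *m E) z = 0.
    move=> Bz a; apply: etrans (derive_mulmxr E a (dW z Bz)) _.
    by rewrite (DW z Bz) /conn mulmxN mulNmx -!mulmxA UE !mulmx0 oppr0.
  by have := ball_constant r0 dWE DWE By; rewrite W0 mul1mx.
have sE y : ball y0 r y -> s y = (W y *m U^T) *m nu y + E *m v y.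
  move=> By; rewrite /s nuE -(Emu y) !mulmxA -{1}(WE y By).
  by rewrite -mulmxDl -!mulmxA -mulmxDr UU mulmx1.
have xiE y : ball y0 r y -> xi y = (U *m W y *m U^T) *m nu y.
  by move=> By; rewrite /xi sE // mulmxDr !mulmxA UE mul0mx addr0.
have gE y : ball y0 r y -> g y - v y = (E^T *m W y *m U^T) *m nu y.
  by move=> By; rewrite /g sE // mulmxDr !mulmxA EE mul1mx addrK.
have xiP y : ball y0 r y -> xi y *m P y = xi y.
  by move=> By; rewrite xiE // -mulmxA nuP //; exact/D1D/BD.
have DxiP a y : ball y0 r y -> 'D_a xi y *m P y = 0.
  move=> By; apply: etrans (congr1 (mulmx^~ _) (derive_mulmxl U a (ds y By))) _.
  by rewrite -mulmxA DsP // mulmx0.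
have xi0 : xi y0 = ep by rewrite xiE // W0 mulmx1 /nu epP /U tr_row_mx trmx0 trmx1
  mul_row_col mulmx0 addr0 mulmx1 mul1mx.
exists r, xi, g; split=> //; first by move=> y /BD/D1D.
move=> y By; have Dy := D1D (BD _ By); split=> //.
- exact: xiP.
(* The derivative of [xi] is orthogonal to the rows of [xi], so the Gram matrix keeps its initial
   value. *)
- have dxt z : ball y0 r z -> differentiable (fun z => xi z *m (xi z)^T) z.
    by move=> Bz; exact: (differentiable_mulmx (dxi z Bz) (differentiable_trmx (dxi z Bz))).
  have Dxt z : ball y0 r z -> forall a, 'D_a (fun z => xi z *m (xi z)^T) z = 0.
    move=> Bz a; have Dz := D1D (BD _ Bz).
    have dt := differentiable_trmx (dxi z Bz).
    apply: etrans (derive_mulmx a (dxi z Bz) dt) _.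
    apply: etrans (congr1 (fun X => _ + _ *m X) (derive_trmx a (dxi z Bz))) _.
    have := DxiP a z Bz; have := xiP z Bz; have := sP Dz.
    move: ('D_a xi z) (xi z) (P z) => A x Q QT xQ AQ.
    have h : A *m x^T = 0 by rewrite -xQ trmx_mul QT mulmxA AQ mul0mx.
    by rewrite h add0r -[LHS]trmxK trmx_mul trmxK h trmx0.
  by have := ball_constant r0 dxt Dxt By; rewrite xi0 epep.
- by rewrite gE // -mulmxA nuP.
- by move=> a; exact: DxiP.
move=> a; apply: etrans (congr1 (mulmx^~ _) (derive_mulmxl E^T a (ds y By))) _.
by rewrite -mulmxA DsP // mulmx0.
Qed.

End ParallelFrame.

(** * The foliated chart *)

Section Focal.
Context {R : realType} {n k : nat}.
Variables (D : set 'rV[R]_n) (psi : 'rV[R]_n -> ext R n (n + k)) (y0 : 'rV[R]_n).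
Hypothesis oD : open D.
Hypothesis Dy0 : D y0.
Hypothesis psiQ : forall y, D y -> Qo (psi y).
Hypothesis cpsi : forall j, Ck j D psi.
Let P y := projN (psi y).
Hypothesis flat : forall a b, ('D_b P y0 *m 'D_a P y0 - 'D_a P y0 *m 'D_b P y0) *m P y0 = 0.
Hypothesis immersed : forall X, 'D_X psi y0 = 0 -> X = 0.
Variable Phi : 'M[R]_(n, n + k).
Hypothesis PhiT : Phi *m projT (psi y0) = Phi.
Hypothesis Phi_inj : forall X : 'rV[R]_n, X *m Phi = 0 -> X = 0.
Hypothesis Phi_sym : forall X Y : 'rV[R]_n,
  (Y *m Phi) *m hom_of_tangent (psi y0) ('D_X psi y0) =
  (X *m Phi) *m hom_of_tangent (psi y0) ('D_Y psi y0).
Variable ep : 'M[R]_(k, n + k).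
Hypothesis epN : ep *m P y0 = ep.
Hypothesis epP : ep^T *m ep = P y0.

Let e := frame (psi y0).
Let Q0 : Qo (psi y0). Proof. exact: psiQ. Qed.
Let dP : differentiable P y0.
Proof. exact: (differentiable_projN oD psiQ cpsi Dy0). Qed.

(** The tangential part, in the frame [e], of the derivative of a parallel normal field through
    [row j ep]. Source coordinates come from the chart and target ones from [e], so there is no
    reason for symmetry before [Phi] relates the two. *)
Definition shape (j : 'I_k) : 'M[R]_n :=
  \matrix_(i < n) (row j ep *m 'D_(delta_mx 0 i) P y0 *m e^T).

Lemma mul_shape X j : X *m shape j = row j ep *m 'D_X P y0 *m e^T.
Proof.
rewrite /shape mulmx_sum_row (derive_sum_dir X dP) mulmx_sumr mulmx_suml.
by apply: eq_bigr => i _; rewrite rowK -scalemxAr -scalemxAl.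
Qed.

Lemma derive_projN_sym X : ('D_X P y0)^T = 'D_X P y0.
Proof.
have fE : (fun z => (P z)^T) = P by apply/funext => z; exact: projN_tr.
by have h := derive_trmx X dP; rewrite fE in h; exact: esym h.
Qed.

Lemma sym_of_form (A : 'M[R]_n) :
  (forall X Y : 'rV[R]_n, (Y *m A *m X^T) 0 0 = (X *m A *m Y^T) 0 0) -> A^T = A.
Proof.
move=> h; apply/matrixP => i j; rewrite mxE.
have E a b : ((delta_mx 0 a : 'rV[R]_n) *m A *m (delta_mx 0 b : 'rV[R]_n)^T) 0 0 = A a b.
  by rewrite -rowE trmx_delta -colE !mxE.
by rewrite -(E j i) -(E i j) h.
Qed.

(* Through [Phi] the shape operators become symmetric, and flatness (the Ricci
   equation) makes them commute; their common kernel is trivial because [psi] is an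
   immersion. *)
Lemma shape_generic (N0 : 'M[R]_n) : exists t : 'rV[R]_k,
  N0 + \sum_j t 0 j *: shape j \in unitmx.
Proof.
have [ee _] := framesP Q0; rewrite -/e in ee.
pose Q := Phi *m e^T.
have PhiE : Phi = Q *m e by rewrite /Q -mulmxA -[_ *m e]/(projT (psi y0)) PhiT.
have uQ : Q \in unitmx.
  apply: inj_unitmx => X XQ; apply: Phi_inj.
  by rewrite PhiE mulmxA XQ mul0mx.
have PyT : (P y0)^T = P y0 := projN_tr (psi y0).
have epT j : P y0 *m (row j ep)^T = (row j ep)^T.
  by rewrite -{1}PyT -trmx_mul -row_mul epN.
have homE X : hom_of_tangent (psi y0) ('D_X psi y0) = - (projT (psi y0) *m 'D_X P y0 *m P y0).
  apply: etrans (hom_of_derivative oD psiQ cpsi X Dy0) _.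
  have h := derive_projN oD psiQ cpsi X Dy0.
  have -> : 'D_X P y0 = - 'D_X (fun z => projT (psi z)) y0 := h.
  by rewrite mulmxN mulNmx opprK.
have Qsym j : (Q *m (shape j)^T)^T = Q *m (shape j)^T.
  have E (X Y : 'rV[R]_n) : (Y *m (Q *m (shape j)^T) *m X^T) 0 0 =
      (Y *m Phi *m ('D_X P y0 *m P y0 *m (row j ep)^T)) 0 0.
    rewrite -mulmxA -(mulmxA Q) -trmx_mul mul_shape trmx_mul trmxK trmx_mul.
    by rewrite derive_projN_sym -(mulmxA _ (P y0)) epT PhiE !mulmxA.
  apply: sym_of_form => X Y; rewrite !E.
  have h : Y *m Phi *m ('D_X P y0 *m P y0) = X *m Phi *m ('D_Y P y0 *m P y0).
    have := Phi_sym X Y; rewrite (homE X) (homE Y) !mulmxN => /oppr_inj.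
    move: ('D_X P y0) ('D_Y P y0) (P y0) (projT (psi y0)) PhiT => A B N T PT.
    have aux (Z : 'rV[R]_n) (C : 'M[R]_(n + k)) :
        Z *m Phi *m (T *m C *m N) = Z *m Phi *m (C *m N).
      by rewrite -!mulmxA (mulmxA Phi T) PT.
    by rewrite !aux.
  by rewrite mulmxA h -mulmxA.
have PDP X : P y0 *m 'D_X P y0 *m P y0 = 0 := projN_derive_projN oD psiQ cpsi X Dy0.
have epPr j : row j ep *m P y0 = row j ep by rewrite -row_mul epN.
have Ksym i j : (shape i *m (shape j)^T)^T = shape i *m (shape j)^T.
  have E (X Y : 'rV[R]_n) : (Y *m (shape i *m (shape j)^T) *m X^T) 0 0 =
      (row i ep *m ('D_Y P y0 *m 'D_X P y0 *m P y0) *m (row j ep)^T) 0 0.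
    rewrite mulmxA -mulmxA -trmx_mul !mul_shape trmx_mul trmxK trmx_mul derive_projN_sym.
    rewrite -mulmxA (mulmxA e^T) -[e^T *m e]/(projT (psi y0)).
    have -> : projT (psi y0) = 1%:M - P y0 by rewrite /P /projN opprB addrC subrK.
    have := PDP Y; have := epPr i; have := epT j.
    move: ('D_X P y0) ('D_Y P y0) (P y0) (row i ep) ((row j ep)^T) => A B N r c Nc rN NBN.
    have rBN : r *m B *m N = 0 by rewrite -rN -!mulmxA (mulmxA N) NBN mulmx0.
    rewrite mulmxBl mul1mx mulmxBr (mulmxA _ N) rBN mul0mx subr0.
    by rewrite -!mulmxA Nc.
  apply: sym_of_form => X Y; have /eqP := flat X Y.
  rewrite mulmxBl subr_eq0 => /eqP fl; apply: etrans (E X Y) (etrans _ (esym (E Y X))).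
  exact: (congr1 (fun Z => (row i ep *m Z *m (row j ep)^T) 0 0) fl).
have Kinj (X : 'rV[R]_n) : (forall j, X *m shape j = 0) -> X = 0.
  move=> h; apply: immersed; have h0 : ep *m 'D_X P y0 *m e^T = 0.
    by apply/row_matrixP => j; rewrite row0 !row_mul -mul_shape h.
  have h1 : projT (psi y0) *m 'D_X P y0 *m P y0 = 0.
    have h2 : P y0 *m 'D_X P y0 *m projT (psi y0) = 0.
      rewrite -epP /projT -/e; move: ('D_X P y0) h0 => A h0.
      by rewrite -!mulmxA (mulmxA A) (mulmxA ep) (mulmxA ep A) h0 mul0mx mulmx0.
    have := congr1 trmx h2; rewrite trmx_mul [(P y0 *m _)^T]trmx_mul PyT projT_tr.
    by rewrite derive_projN_sym trmx0 mulmxA.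
  have h2 : - (projT (psi y0) *m 'D_X P y0 *m P y0) = 0 by rewrite h1 oppr0.
  have h3 := etrans (esym (hom_of_derivative oD psiQ cpsi X Dy0)) (etrans (homE X) h2).
  apply: etrans (derive_psi_hom oD psiQ cpsi X Dy0) _.
  exact: etrans (congr1 (tangent_of_hom (psi y0)) h3) (tangent_of_hom0 (psi y0)).
have [t ut] := pencil_unit uQ Qsym Ksym Kinj.
(* The generic combination is perturbed by a multiple of [N0]; dividing by [c] moves the weight onto
   the combination. *)
have [c c0 uc] := unit_perturb N0 ut.
exists (\row_j (c^-1 * t j)).
have -> : N0 + \sum_j (\row_j (c^-1 * t j)) 0 j *: shape j =
    c^-1 *: (\sum_j t j *: shape j + c *: N0).
  rewrite scalerDr scalerA mulVf // scale1r addrC scaler_sumr; congr (_ + _).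
  by apply: eq_bigr => j _; rewrite mxE scalerA.
by rewrite unitmxZ // unitfE invr_eq0.
Qed.

End Focal.

Section ProductBall.
Context {R : realType} {n k : nat}.
Implicit Types (z : 'rV[R]_(n + k)).

(** The maximum norm makes balls products of balls, so every slice of a ball at constant [t] is
    parametrized by the same ball around [y0]. *)
Lemma ball_row_mx (y0 : 'rV[R]_n) (t0 : 'rV[R]_k) (r : R) z :
  ball (row_mx y0 t0) r z <-> ball y0 r (lsubmx z) /\ ball t0 r (rsubmx z).
Proof.
split=> [[r0 b]|[[r0 by0] [_ bt0]]].
  split; split=> // i j; rewrite mxE.
    by have := b i (lshift k j); rewrite row_mxEl.
  by have := b i (rshift n j); rewrite row_mxEr.
split=> // i j; rewrite -(splitK j); case: (fintype.split j) => j' /=.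
  by rewrite row_mxEl; have := by0 i j'; rewrite mxE.
by rewrite row_mxEr; have := bt0 i j'; rewrite mxE.
Qed.

Lemma lsubmx_mul z : lsubmx z = z *m col_mx 1%:M 0.
Proof. by rewrite -{2}[z]hsubmxK mul_row_col mulmx1 mulmx0 addr0. Qed.

Lemma rsubmx_mul z : rsubmx z = z *m col_mx 0 1%:M.
Proof. by rewrite -{2}[z]hsubmxK mul_row_col mulmx1 mulmx0 add0r. Qed.

Lemma derive_lsubmx h z : 'D_h (fun z : 'rV[R]_(n + k) => lsubmx z) z = lsubmx h.
Proof.
have -> : (fun z : 'rV[R]_(n + k) => lsubmx z) = fun z => z *m col_mx 1%:M 0.
  by apply/funext => w; exact: lsubmx_mul.
have di : differentiable (fun w : 'rV[R]_(n + k) => w) z by [].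
by have := derive_mulmxr (col_mx 1%:M 0) h di; rewrite derive_id -lsubmx_mul.
Qed.

Lemma derive_rsubmx h z : 'D_h (fun z : 'rV[R]_(n + k) => rsubmx z) z = rsubmx h.
Proof.
have -> : (fun z : 'rV[R]_(n + k) => rsubmx z) = fun z => z *m col_mx 0 1%:M.
  by apply/funext => w; exact: rsubmx_mul.
have di : differentiable (fun w : 'rV[R]_(n + k) => w) z by [].
by have := derive_mulmxr (col_mx 0 1%:M) h di; rewrite derive_id -rsubmx_mul.
Qed.

End ProductBall.

Section FoliatedChart.
Context {R : realType} {n k : nat}.
Variables (D : set 'rV[R]_n) (psi : 'rV[R]_n -> affext R n (n + k)) (y0 : 'rV[R]_n).
Let psi1 z := (psi z).1.
Let v z := (psi z).2.
Let P z := projN (psi1 z).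
Hypothesis oD : open D.
Hypothesis Dy0 : D y0.
Hypothesis psiQ : forall y, D y -> Qaff (psi y).
Hypothesis cpsi : forall j, Ck j D psi.
Hypothesis flat : forall a b y, D y ->
  ('D_b P y *m 'D_a P y - 'D_a P y *m 'D_b P y) *m P y = 0.
Hypothesis lagr : forall a b y, D y ->
  ('D_b v y *m 'D_a P y - 'D_a v y *m 'D_b P y) *m P y = 0.
Hypothesis immersed : forall X, 'D_X psi1 y0 = 0 -> X = 0.
Variable Phi : 'M[R]_(n, n + k).
Hypothesis PhiT : Phi *m projT (psi1 y0) = Phi.
Hypothesis Phi_inj : forall X : 'rV[R]_n, X *m Phi = 0 -> X = 0.
Hypothesis Phi_sym : forall X Y : 'rV[R]_n,
  (Y *m Phi) *m hom_of_tangent (psi1 y0) ('D_X psi1 y0) =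
  (X *m Phi) *m hom_of_tangent (psi1 y0) ('D_Y psi1 y0).

(* [F (row_mx y t) = g y + t *m xi y] displaces a leaf [g] along a parallel normal
   frame [xi]; fixing [t] gives a leaf. *)
Lemma foliated_chart : exists (r : R) (t0 : 'rV[R]_k) (xi : 'rV[R]_n -> 'M[R]_(k, n + k))
    (F G : 'rV[R]_(n + k) -> 'rV[R]_(n + k)),
  [/\ 0 < r, ball y0 r `<=` D, open (F @` ball (row_mx y0 t0) r),
      forall j, Ck j (ball (row_mx y0 t0) r) F /\ Ck j (F @` ball (row_mx y0 t0) r) G &
      forall z, ball (row_mx y0 t0) r z -> let y := lsubmx z in
        [/\ G (F z) = z, (F z - v y) *m P y = F z - v y, xi y *m P y = xi y,
            xi y *m (xi y)^T = 1%:M &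
            forall h, 'D_h F z *m P y = rsubmx h *m xi y]].
Proof.
have Q1 y : D y -> Qo (psi1 y) by move=> /psiQ[].
have c1 j : Ck j D psi1 by exact: (Ck_fst oD cpsi).
have cv j : Ck j D v by exact: (Ck_snd oD cpsi).
have cP j : Ck j D P by exact: (Ck_projN oD Q1 c1).
have [ep [epep epe epN epP]] := complement_frame (Q1 _ Dy0).
have PP y : D y -> P y *m P y = P y by move=> Dy; exact: projN_idem (Q1 _ Dy).
have sP y : D y -> (P y)^T = P y by move=> _; exact: projN_tr.
have rP y : D y -> \rank (P y) = k by move=> /Q1 Qy; rewrite (rank_projN Qy) addKn.
have [r1 [xi [g [r10 B1 xi0 cxg pf]]]] :=
  parallel_frame oD Dy0 cP cv PP sP rP epep epN flat lagr.
have oB1 : open (ball y0 r1) by exact: ball_open.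
have B10 : ball y0 r1 y0 := ballxx y0 r10.
have cxi j := (cxg j).1; have cg j := (cxg j).2.
have dxi y : ball y0 r1 y -> differentiable xi y := Ck_differentiable (cxi 0%N).
have dg y : ball y0 r1 y -> differentiable g y := Ck_differentiable (cg 0%N).
pose e := frame (psi1 y0).
(* The tangential derivative of the leaf [g]. Displacement by [t *m xi] adds the combination of
   shape operators with weights [t], and [t0] is taken away from focal points. *)
pose N0 : 'M[R]_n := \matrix_(i < n) ('D_(delta_mx 0 i) g y0 *m e^T).
have [t0 ut0] := shape_generic oD Dy0 Q1 c1 (fun a b => flat a b Dy0) immersed
  PhiT Phi_inj Phi_sym epN epP N0.
pose z0 := row_mx y0 t0.
pose F (z : 'rV[R]_(n + k)) := g (lsubmx z) + rsubmx z *m xi (lsubmx z).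
(* No bound is put on [t], since [t0] may be far from 0. *)
pose D2 : set 'rV[R]_(n + k) := [set: 'rV[R]_(n + k)] `&` (fun z => lsubmx z) @^-1` ball y0 r1.
have oT : open [set: 'rV[R]_(n + k)] := openT.
have cl0 j : Ck j [set: 'rV[R]_(n + k)] (fun z => lsubmx z : 'rV[R]_n).
  by apply: Ck_lsubmx => //; exact: Ck_id.
have cr0 j : Ck j [set: 'rV[R]_(n + k)] (fun z => rsubmx z : 'rV[R]_k).
  by apply: Ck_rsubmx => //; exact: Ck_id.
have oD2 : open D2.
  apply: (open_setI_preimage oT oB1) => z _; apply: differentiable_continuous.
  exact: (Ck_differentiable (cl0 0%N)).
have s2 : D2 `<=` [set: 'rV[R]_(n + k)] by [].
have D2B z : D2 z -> ball y0 r1 (lsubmx z) by move=> [].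
have cl j := Ck_subset s2 (cl0 j); have cr j := Ck_subset s2 (cr0 j).
have cgl j : Ck j D2 (g \o (fun z => lsubmx z)) := Ck_comp oD2 D2B (cl j) (cg j).
have cxl j : Ck j D2 (xi \o (fun z => lsubmx z)) := Ck_comp oD2 D2B (cl j) (cxi j).
have cF j : Ck j D2 F := Ck_add oD2 (cgl j) (Ck_mulmx oD2 (cr j) (cxl j)).
have D2z0 : D2 z0 by split=> //; rewrite /preimage /= row_mxKl.
have DF h z : D2 z -> 'D_h F z = 'D_(lsubmx h) g (lsubmx z)
    + (rsubmx h *m xi (lsubmx z) + rsubmx z *m 'D_(lsubmx h) xi (lsubmx z)).
  move=> D2z; have Bz := D2B z D2z.
  have dl : differentiable (fun z => lsubmx z : 'rV[R]_n) z := Ck_differentiable (cl 0%N) D2z.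
  have dr : differentiable (fun z => rsubmx z : 'rV[R]_k) z := Ck_differentiable (cr 0%N) D2z.
  have dgl := Ck_differentiable (cgl 0%N) D2z; have dxl := Ck_differentiable (cxl 0%N) D2z.
  apply: etrans (derive_addf h dgl (differentiable_mulmx dr dxl)) _.
  apply: etrans (congr2 +%R (derive_comp h dl (dg _ Bz)) (derive_mulmx h dr dxl)) _.
  rewrite derive_lsubmx derive_rsubmx; congr (_ + (_ + _ *m _)).
  by apply: etrans (derive_comp h dl (dxi _ Bz)) _; rewrite derive_lsubmx.
have DFP h z : D2 z -> 'D_h F z *m P (lsubmx z) = rsubmx h *m xi (lsubmx z).
  move=> D2z; have [xiP _ _ DxiP DgP] := pf _ (D2B _ D2z).
  rewrite DF // mulmxDl DgP add0r mulmxDl -!mulmxA DxiP mulmx0 addr0.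
  by rewrite xiP.
(* The normal part of the derivative is [rsubmx h *m xi], which forces [rsubmx h = 0]; the
   tangential part is then [lsubmx h] times the invertible matrix at [t0]. *)
have Finj h : 'D_h F z0 = 0 -> h = 0.
  move=> h0; have [xiP xixi _ DxiP _] := pf y0 B10.
  have l0 : lsubmx z0 = y0 by rewrite row_mxKl.
  have r0 : rsubmx z0 = t0 by rewrite row_mxKr.
  have rh : rsubmx h = 0.
    have := DFP h z0 D2z0; rewrite h0 mul0mx l0 => /esym hx.
    by rewrite -[LHS]mulmx1 -xixi mulmxA hx mul0mx.
  have := DF h z0 D2z0; rewrite h0 l0 r0 rh mul0mx add0r => /esym e0.
  have xiD a : 'D_a xi y0 = ep *m 'D_a P y0.
    have nr : {near y0, (fun y => xi y *m P y) =1 xi}.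
      by apply: filterS (open_nbhs_nbhs (conj oB1 B10)) => y By; have [->] := pf y By.
    have dP : differentiable P y0 := Ck_differentiable (cP 0%N) Dy0.
    apply: etrans (esym (near_eq_derive a nr)) _.
    by apply: etrans (derive_mulmx a (dxi _ B10) dP) _; rewrite DxiP add0r xi0.
  have lh : lsubmx h *m (N0 + \sum_j t0 0 j *: shape psi1 y0 ep j) = 0.
    have h1 : lsubmx h *m N0 = 'D_(lsubmx h) g y0 *m e^T.
      have gE := derive_sum_dir (lsubmx h) (dg _ B10).
      rewrite gE /N0 mulmx_sum_row mulmx_suml.
      by apply: eq_bigr => i _; rewrite rowK scalemxAl.
    rewrite mulmxDr h1 mulmx_sumr.
    have -> : \sum_j lsubmx h *m (t0 0 j *: shape psi1 y0 ep j) =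
        t0 *m (ep *m 'D_(lsubmx h) P y0 *m e^T).
      rewrite mulmx_sum_row; apply: eq_bigr => j _; rewrite -scalemxAr; congr (_ *: _).
      by apply: etrans (mul_shape oD Dy0 Q1 c1 ep (lsubmx h) j) _; rewrite !row_mul.
    by rewrite -xiD (mulmxA t0) -mulmxDl e0 mul0mx.
  have lh0 : lsubmx h = 0 by rewrite -[LHS](mulmxK ut0) lh mul0mx.
  by rewrite -[h]hsubmxK lh0 rh row_mx0.
have [r [G [r0 BD2 oFB GF cG]]] := inverse_function oD2 D2z0 cF Finj.
have BB y : ball y0 r y -> ball y0 r1 y.
  move=> By; have : D2 (row_mx y t0).
    by apply: BD2; apply/ball_row_mx; rewrite row_mxKl row_mxKr; split=> //; exact: ballxx.
  by move=> [_]; rewrite /preimage /= row_mxKl.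
exists r, t0, xi, F, G; split=> //.
- by move=> y /BB/B1.
- by move=> j; split=> //; exact: Ck_subset BD2 (cF j).
move=> z Bz y; have D2z := BD2 _ Bz; have By := D2B _ D2z.
have [xiP xixi gP _ _] := pf _ By; split=> //; first exact: GF.
- by rewrite /F addrAC mulmxDl gP -mulmxA xiP.
by move=> h; exact: DFP.
Qed.

End FoliatedChart.

(** * The foliation *)

Lemma dotBr {R : realType} {m} (x u w : 'rV[R]_m) : dot x (u - w) = dot x u - dot x w.
Proof. by rewrite !dotE -sumrB; apply: eq_bigr => i _; rewrite !mxE mulrBr. Qed.

Section Foliation.
Context {R : realType} {n k : nat}.
Variables (y0 : 'rV[R]_n) (t0 : 'rV[R]_k) (r : R).
Variables (P : 'rV[R]_n -> 'M[R]_(n + k)) (xi : 'rV[R]_n -> 'M[R]_(k, n + k)).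
Variables F G : 'rV[R]_(n + k) -> 'rV[R]_(n + k).
Let B := ball (row_mx y0 t0) r.
Hypothesis r0 : 0 < r.
Hypothesis oFB : open (F @` B).
Hypothesis cF : forall j, Ck j B F.
Hypothesis cG : forall j, Ck j (F @` B) G.
Hypothesis PP : forall y, ball y0 r y -> P y *m P y = P y.
Hypothesis sP : forall y, ball y0 r y -> (P y)^T = P y.
Hypothesis GF : forall z, B z -> G (F z) = z.
Hypothesis xixi : forall y, ball y0 r y -> xi y *m (xi y)^T = 1%:M.
Hypothesis DFP : forall z, B z -> forall h,
  'D_h F z *m P (lsubmx z) = rsubmx h *m xi (lsubmx z).

Let oB : open B. Proof. exact: ball_open. Qed.

Let Bl z : B z -> ball y0 r (lsubmx z). Proof. by move=> /ball_row_mx[]. Qed.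

Let dF z : B z -> differentiable F z. Proof. exact: (Ck_differentiable (@cF 0%N)). Qed.

Let dG z : B z -> differentiable G (F z).
Proof. by move=> Bz; apply: (Ck_differentiable (@cG 0%N)); exists z. Qed.

Lemma chart_diffK z h : B z -> 'd G (F z) ('d F z h) = h.
Proof.
move=> Bz; have nr : {near z, G \o F =1 id}.
  by apply: filterS (open_nbhs_nbhs (conj oB Bz)) => w; exact: GF.
apply: etrans (diff_factor h (dF Bz) (dG Bz) nr) _.
by rewrite -deriveE //; exact: derive_id.
Qed.

Lemma chart_diff_onto z u : B z -> exists h, 'd F z h = u.
Proof.
move=> Bz; have JE h : 'd F z h = h *m jacobian F z by rewrite /jacobian mul_rV_lin1.
have uJ : jacobian F z \in unitmx.
  apply: inj_unitmx => h h0; have e1 := JE h; rewrite h0 in e1.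
  exact: etrans (esym (chart_diffK h Bz)) (etrans (congr1 ('d G (F z)) e1) (linear0 _)).
by exists (u *m invmx (jacobian F z)); rewrite JE mulmxKV.
Qed.

Lemma chart_diff_normal z h : B z -> 'd F z h *m P (lsubmx z) = rsubmx h *m xi (lsubmx z).
Proof. by move=> Bz; rewrite -(DFP Bz) deriveE //; exact: dF. Qed.

Lemma leaf_tangent z u : B z -> u *m P (lsubmx z) = 0 ->
  exists a, u = 'd F z (row_mx a 0).
Proof.
move=> Bz uP; have [h hu] := chart_diff_onto u Bz.
have h0 : rsubmx h = 0.
  have := chart_diff_normal h Bz; rewrite hu uP => /esym hx.
  by rewrite -[LHS]mulmx1 -(xixi (Bl Bz)) mulmxA hx mul0mx.
by exists (lsubmx h); rewrite -h0 hsubmxK.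
Qed.

Lemma leaf_tangentP z a : B z -> 'd F z (row_mx a 0) *m P (lsubmx z) = 0.
Proof. by move=> Bz; rewrite chart_diff_normal // row_mxKr mul0mx. Qed.

Let f w := rsubmx (G w) : 'rV[R]_k.

Let cf j : Ck j (F @` B) f. Proof. exact: (Ck_rsubmx oFB (@cG j)). Qed.

Let df z u : B z -> 'd f (F z) u = rsubmx ('d G (F z) u).
Proof.
move=> Bz; have Oz : (F @` B) (F z) by exists z.
have dr w : differentiable (fun w : 'rV[R]_(n + k) => rsubmx w) w.
  by apply: (@Ck_differentiable _ _ _ 0%N setT) => //;
     apply: Ck_rsubmx; [exact: openT|exact: Ck_id].
have dff : differentiable f (F z) := Ck_differentiable (@cf 0%N) Oz.
rewrite -deriveE //; have dr' := dr (G (F z)).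
apply: etrans (derive_comp u (dG Bz) dr') _.
by rewrite derive_rsubmx deriveE //; exact: dG.
Qed.

(** The tangential component of [u] is a leaf direction, hence in the kernel of ['d f], hence
    orthogonal to [u] and so zero. The submersion is then isometric because the rows of [xi] are
    orthonormal. *)
Lemma normal_part z u : B z -> orth [set u | 'd f (F z) u = 0] u ->
  u = 'd f (F z) u *m xi (lsubmx z).
Proof.
move=> Bz ou; have By := Bl Bz; pose Q := P (lsubmx z).
have QQ : Q *m Q = Q := PP By; have QT : Q^T = Q := sP By.
have [h hu] := chart_diff_onto u Bz.
have uQ : u *m Q = 'd f (F z) u *m xi (lsubmx z).
  by rewrite -{1}hu chart_diff_normal // df // -hu chart_diffK.
have [a aE] : exists a, u - u *m Q = 'd F z (row_mx a 0).
  by apply: leaf_tangent => //; rewrite mulmxBl -mulmxA QQ subrr.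
have k0 : 'd f (F z) (u - u *m Q) = 0 by rewrite aE df // chart_diffK // row_mxKr.
have d0 : dot (u - u *m Q) u = 0 := ou _ k0.
have d1 : dot (u - u *m Q) (u *m Q) = 0.
  by rewrite dotC dot_mulmxl QT mulmxBl -mulmxA QQ subrr /dot trmx0 mulmx0 mxE.
have /dot_eq0/eqP : dot (u - u *m Q) (u - u *m Q) = 0.
  by rewrite dotBr d0 d1 subrr.
by rewrite subr_eq0 uQ => /eqP.
Qed.

Lemma foliation_submersion : riemannian_submersion (F @` B) f.
Proof.
split; first exact/smooth_onP.
move=> _ [z Bz <-]; split.
  apply/seteqP; split=> // b _; exists ('d F z (row_mx 0 b)) => //.
  by rewrite df // chart_diffK // row_mxKr.
move=> u w /set_mem ou /set_mem ow.
rewrite {2}(normal_part Bz ou) {2}(normal_part Bz ow).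
by rewrite dot_mulmxl -mulmxA xixi ?mulmx1 //; exact: Bl.
Qed.

Lemma foliation_image : f @` (F @` B) = ball t0 r.
Proof.
apply/seteqP; split=> [_ [_ [z Bz <-] <-]|t Bt].
  by rewrite /f GF //; have /ball_row_mx[] := Bz.
have Bz : B (row_mx y0 t).
  by apply/ball_row_mx; rewrite row_mxKl row_mxKr; split=> //; exact: ballxx.
exists (F (row_mx y0 t)); first by exists (row_mx y0 t).
by rewrite /f GF // row_mxKr.
Qed.

Section Leaf.
Variable t : 'rV[R]_k.
Hypothesis Bt : ball t0 r t.
Let sigma (y : 'rV[R]_n) := F (row_mx y t).
Let S := F @` B `&` f @^-1` [set t].

Let Brow y : ball y0 r y -> B (row_mx y t).
Proof. by move=> By; apply/ball_row_mx; rewrite row_mxKl row_mxKr. Qed.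

Lemma leaf_image : sigma @` ball y0 r = S.
Proof.
apply/seteqP; split=> [_ [y By <-]|_ [[z Bz <-]]].
  have Bz := Brow By; split; first by exists (row_mx y t).
  by rewrite /preimage /= /f GF // row_mxKr.
rewrite /preimage /= /f GF // => zt; exists (lsubmx z); first exact: Bl.
by rewrite /sigma -zt hsubmxK.
Qed.

Let oBy : open (ball y0 r). Proof. exact: ball_open. Qed.

Let crow j : Ck j (ball y0 r) (fun y => row_mx y t).
Proof. by apply: Ck_row_mx => //; [exact: Ck_id|exact: Ck_cst]. Qed.

Lemma leaf_Ck j : Ck j (ball y0 r) sigma.
Proof. exact: (Ck_comp oBy Brow (@crow j) (@cF j)). Qed.

Lemma leaf_diff y a : ball y0 r y -> 'd sigma y a = 'd F (row_mx y t) (row_mx a 0).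
Proof.
move=> By; have dr : differentiable (fun y => row_mx y t) y :=
  Ck_differentiable (@crow 0%N) By.
have nr : {near y, F \o (fun y => row_mx y t) =1 sigma}.
  by apply: filterS (open_nbhs_nbhs (conj oBy By)).
have rE : (fun y : 'rV[R]_n => row_mx y t) = fun y => y *m row_mx 1%:M 0 + row_mx 0 t.
  by apply/funext => w; rewrite mul_mx_row mulmx1 mulmx0 add_row_mx addr0 add0r.
have Dr : 'd (fun y : 'rV[R]_n => row_mx y t) y a = row_mx a 0.
  rewrite -deriveE // rE; have di : differentiable (fun w : 'rV[R]_n => w) y by [].
  have dm : differentiable (fun w : 'rV[R]_n => w *m row_mx 1%:M (0 : 'M[R]_(n, k))) y.
    exact: (differentiable_mulmx di (differentiable_cst _ y)).
  have dc : differentiable (fun _ : 'rV[R]_n => row_mx (0 : 'rV[R]_n) t) y by exact: differentiable_cst.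
  apply: etrans (derive_addf a dm dc) _.
  apply: etrans (congr2 +%R (derive_mulmxr _ a di) (derive_cst _ _ _)) _.
  by rewrite derive_id addr0 mul_mx_row mulmx1 mulmx0.
apply: etrans (esym (diff_factor a dr (dF (Brow By)) nr)) _.
exact: (congr1 ('d F (row_mx y t)) Dr).
Qed.

Lemma leaf_submanifold : submanifold n S.
Proof.
move=> p [Op _]; exists (F @` B), (ball y0 r), sigma, (fun w => lsubmx (G w)).
split=> //; split=> //.
- by apply/smooth_onP; exact: leaf_Ck.
- by apply/smooth_onP => j; exact: (Ck_lsubmx oFB (@cG j)).
- by rewrite leaf_image; apply/seteqP; split=> [q Sq|q []] //; split=> //; case: Sq.
by move=> y By; rewrite /sigma GF ?row_mxKl //; exact: Brow.
Qed.

Lemma leaf_diff_inj y a : ball y0 r y -> 'd sigma y a = 0 -> a = 0.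
Proof.
move=> By; rewrite leaf_diff // => h0; have Bz := Brow By.
have e1 := chart_diffK (row_mx a 0) Bz.
have e2 : row_mx a (0 : 'rV[R]_k) = 0 :=
  etrans (esym e1) (etrans (congr1 ('d G (F (row_mx y t))) h0) (linear0 _)).
have := congr1 lsubmx e2; rewrite row_mxKl => ->.
by apply/matrixP => i j; rewrite !mxE.
Qed.

Lemma leaf_normal y w : ball y0 r y ->
  (forall a, dot ('d sigma y a) w = 0) <-> w *m P y = w.
Proof.
move=> By; have Bz := Brow By; have := @leaf_tangent _ (w - w *m P y) Bz.
have := @leaf_tangentP _ _ Bz; rewrite row_mxKl => tP tQ.
have QQ := PP By; have QT := sP By; split=> [h|<- a]; last first.
  by rewrite leaf_diff // dotC dot_mulmxl QT tP /dot trmx0 mulmx0 mxE.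
have [|a aE] := tQ; first by rewrite mulmxBl -mulmxA QQ subrr.
have d0 : dot (w - w *m P y) w = 0 by rewrite aE -leaf_diff.
have d1 : dot (w - w *m P y) (w *m P y) = 0.
  by rewrite dotC dot_mulmxl QT mulmxBl -mulmxA QQ subrr /dot trmx0 mulmx0 mxE.
have /dot_eq0/eqP : dot (w - w *m P y) (w - w *m P y) = 0.
  by rewrite dotBr d0 d1 subrr.
by rewrite subr_eq0 => /eqP.
Qed.

End Leaf.

End Foliation.

(** * Transfer of the foliation from the chart to the manifold *)

Section Sufficiency.
Context {R : realType} {n k : nat} {M : oriented_manifold R n}.
Variable phi : M -> affext R n (n + k).
Hypothesis phi_smooth : msmooth_on [set: M] phi.
Hypothesis phi_Q : forall x, Qaff (phi x).

Section Leaf.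
Variables (c0 : chart R n M) (y0 : 'rV[R]_n) (t0 t : 'rV[R]_k) (r : R).
Variables (xi : 'rV[R]_n -> 'M[R]_(k, n + k)) (F G : 'rV[R]_(n + k) -> 'rV[R]_(n + k)).
Hypothesis ac0 : atlas c0.
Hypothesis sub : ball y0 r `<=` cmap c0 @` cdom c0.
Let B := ball (row_mx y0 t0) r.
Let psi := phi \o cinv c0.
Let P y := projN (psi y).1.
Hypothesis oFB : open (F @` B).
Hypothesis cF : forall j, Ck j B F.
Hypothesis cG : forall j, Ck j (F @` B) G.
Hypothesis chartP : forall z, B z -> let y := lsubmx z in
  [/\ G (F z) = z, (F z - (psi y).2) *m P y = F z - (psi y).2, xi y *m P y = xi y,
      xi y *m (xi y)^T = 1%:M & forall h, 'D_h F z *m P y = rsubmx h *m xi y].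
Hypothesis Bt : ball t0 r t.
Let U : set M := cdom c0 `&` cmap c0 @^-1` ball y0 r.

Lemma ball_projN y : ball y0 r y -> P y *m P y = P y /\ (P y)^T = P y.
Proof.
by move=> _; split; [exact: projN_idem (phi_Q _).1|exact: projN_tr].
Qed.

Let GF z : B z -> G (F z) = z. Proof. by move=> /chartP[]. Qed.

Let Brow y : ball y0 r y -> B (row_mx y t).
Proof. by move=> By; apply/ball_row_mx; rewrite row_mxKl row_mxKr. Qed.

Lemma xi_orthonormal y : ball y0 r y -> xi y *m (xi y)^T = 1%:M.
Proof. by move=> /Brow/chartP; rewrite row_mxKl => -[]. Qed.

Let DFP z : B z -> forall h, 'D_h F z *m P (lsubmx z) = rsubmx h *m xi (lsubmx z).
Proof. by move=> /chartP[]. Qed.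

Let sigma y := F (row_mx y t).
Let f x := sigma (cmap c0 x).

Let csigma j : Ck j (ball y0 r) sigma.
Proof. exact: (leaf_Ck cF Bt). Qed.

Let PP y (By : ball y0 r y) := (ball_projN By).1.
Let sP y (By : ball y0 r y) := (ball_projN By).2.

Lemma leaf_smooth : msmooth_on U f.
Proof.
move=> c ac; have [oc _ _ cc _] := atlas_chart ac0.
have oU : open U by apply: open_setI_preimage => //; exact: ball_open.
have oE := chart_image_open ac oU; apply/smooth_onP => j.
have s1 : cmap c @` (U `&` cdom c) `<=` cmap c @` (cdom c `&` cdom c0).
  by move=> _ [x [[c0x _] cx] <-]; exists x.
have cT : Ck j (cmap c @` (U `&` cdom c)) (cmap c0 \o cinv c).
  exact: Ck_subset s1 ((smooth_onP _ _).1 (atlas_smooth ac ac0) j).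
have mp y : (cmap c @` (U `&` cdom c)) y -> ball y0 r ((cmap c0 \o cinv c) y).
  by move=> [x [[c0x bx] cx] <-]; rewrite /= cinvK.
exact: (Ck_comp oE mp cT (csigma (j := j))).
Qed.

Lemma leaf_mdiff x X : U x -> mdiff f x X =
  'd sigma (cmap c0 x) ('d (cmap c0 \o cinv (chart_at x)) (cmap (chart_at x) x) X).
Proof.
move=> [c0x bx]; rewrite /mdiff; have := chart_at_atlas x; have := chart_at_dom x.
move: (chart_at x) => c cx ac; have dt := transition_differentiable ac ac0 cx c0x.
have e0 : (cmap c0 \o cinv c) (cmap c x) = cmap c0 x by rewrite /= cinvK.
have ds : differentiable sigma ((cmap c0 \o cinv c) (cmap c x)).
  by rewrite e0; exact: (Ck_differentiable (csigma (j := 0%N)) bx).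
have nr : {near cmap c x, sigma \o (cmap c0 \o cinv c) =1 f \o cinv c}.
  by apply: filterS (transition_near ac ac0 cx c0x) => z _.
by have := diff_factor X dt ds nr; rewrite e0 => e1; exact: esym e1.
Qed.

Lemma leaf_immersion : immersion_on U f.
Proof.
split=> [|x Ux X Y]; first exact: leaf_smooth.
have [c0x bx] := Ux; rewrite !leaf_mdiff //.
have ac := chart_at_atlas x; have cx := chart_at_dom x.
have u := transition_unit ac ac0 cx c0x; rewrite !transition_diffE.
set J := jacobian _ _ in u *; move=> /eqP; rewrite -subr_eq0 -linearB /= => /eqP h.
have := leaf_diff_inj cF cG GF Bt bx h.
rewrite -mulmxBl => h0; apply/eqP; rewrite -subr_eq0.
by rewrite -[X - Y](mulmxK u) h0 mul0mx.
Qed.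

Lemma leaf_surface : f @` U = F @` B `&` (fun w => rsubmx (G w)) @^-1` [set t].
Proof.
rewrite -(leaf_image GF Bt); apply/seteqP; split=> [_ [x [c0x bx] <-]|_ [y By <-]].
  by exists (cmap c0 x).
have [x c0x xy] := sub By; exists x; last by rewrite /f xy.
by split=> //; rewrite /preimage /= xy.
Qed.

(** Both planes have the same direction by [leaf_normal], and their base points differ by
    [f x - (phi x).2], which belongs to it. *)
Lemma leaf_planes x : U x ->
  affine_plane (phi x) = [set f x + w | w in orth (range (mdiff f x))].
Proof.
move=> Ux; have [c0x bx] := Ux; have [Qx _] := phi_Q x.
have xE : psi (cmap c0 x) = phi x by rewrite /psi /= cinvK.
have [_ fP _ _ _] := chartP (Brow bx); rewrite row_mxKl /P xE in fP.
have rE w : orth (range (mdiff f x)) w <-> orth (plane (phi x).1) w.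
  have ln := leaf_normal cF cG PP sP GF xi_orthonormal DFP Bt w bx.
  rewrite /P xE in ln; apply: iff_trans (iff_sym (orth_plane_projN Qx w)).
  apply: iff_trans ln; split=> [h a|h _ [X _ <-]]; last by rewrite leaf_mdiff.
  have ac := chart_at_atlas x; have cx := chart_at_dom x.
  have u := transition_unit ac ac0 cx c0x.
  have := h _ (ex_intro2 _ _ (a *m invmx (jacobian (cmap c0 \o cinv (chart_at x))
    (cmap (chart_at x) x))) I erefl).
  by rewrite leaf_mdiff // transition_diffE mulmxKV.
have op := orth_plane_projN Qx.
apply/seteqP; split=> [_ [w /op wP <-]|_ [w /rE/op wP <-]].
  exists ((phi x).2 - f x + w); last by rewrite addrA [f x + _]addrC subrK.
  apply/rE/op; rewrite mulmxDl wP; congr (_ + _).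
  by rewrite -opprB mulNmx fP.
exists (f x - (phi x).2 + w); last by rewrite addrA [_ + (_ - _)]addrC subrK.
by apply/op; rewrite mulmxDl wP fP.
Qed.

Lemma leaf_integral : integral_submanifold phi U
  (F @` B `&` (fun w => rsubmx (G w)) @^-1` [set t]).
Proof.
split; first exact: (leaf_submanifold oFB cF cG GF Bt).
exists f; split; [exact: leaf_immersion|exact: leaf_surface|exact: leaf_planes].
Qed.

End Leaf.

Hypothesis phio_immersion : immersion_on [set: M] (@bpi R n (n + k) \o phi).
Hypothesis Phi_exists : exists Phi : M -> 'M[R]_(n, n + k),
  bundle_iso (@bpi R n (n + k) \o phi) Phi /\
  forall (x : M) (X Y : 'rV[R]_n),
    (Y *m Phi x) *m hom_of_tangent (bpi (phi x)) (mdiff (@bpi R n (n + k) \o phi) x X)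
    = (X *m Phi x) *m hom_of_tangent (bpi (phi x)) (mdiff (@bpi R n (n + k) \o phi) x Y).
Hypothesis EN_flat : flat_EN (@bpi R n (n + k) \o phi).

Lemma foliated_of_lagrangian : lagrangian phi -> locally_foliated phi.
Proof.
move=> L x0; have ac := chart_at_atlas x0; have cx := chart_at_dom x0.
have [Phi [[Phi_bij _] Phi_sym]] := Phi_exists.
have := phio_immersion.2 x0 I; have := Phi_sym x0; rewrite /mdiff.
move: (chart_at x0) ac cx => c ac cx sy im.
pose psi := phi \o cinv c; pose psi1 z := (psi z).1; pose y0 := cmap c x0.
have oD := chart_domain_open ac; have Dy0 : (cmap c @` cdom c) y0 by exists x0.
have psi0 : psi y0 = phi x0 by rewrite /psi /= cinvK.
have dpsi : differentiable psi1 y0.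
  by apply: (Ck_differentiable (k := 0%N) _ Dy0); exact: (local_Ck_fst phi_smooth ac).
have DE X : 'd ((@bpi R n (n + k) \o phi) \o cinv c) y0 X = 'D_X psi1 y0.
  exact: esym (deriveE X dpsi).
have immersed X : 'D_X psi1 y0 = 0 -> X = 0.
  move=> h; apply: im; apply: etrans (DE X) (etrans h _).
  by apply: esym; apply: etrans (DE 0) _; exact: derive0.
have Qx : Qo (phi x0).1 by have [] := phi_Q x0.
have PhiT : Phi x0 *m projT (psi1 y0) = Phi x0.
  rewrite /psi1 psi0; apply/row_matrixP => i; rewrite row_mul rowE.
  apply/(plane_projT Qx); have [h _ _] := Phi_bij x0; exact: (h (delta_mx 0 i) I).
have Phi_inj (X : 'rV[R]_n) : X *m Phi x0 = 0 -> X = 0.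
  move=> h; have [_ inj _] := Phi_bij x0; by apply: inj; rewrite ?in_setT // h mul0mx.
have symm (X Y : 'rV[R]_n) : (Y *m Phi x0) *m hom_of_tangent (psi1 y0) ('D_X psi1 y0) =
    (X *m Phi x0) *m hom_of_tangent (psi1 y0) ('D_Y psi1 y0).
  by have := sy X Y; rewrite /psi1 psi0 -!DE.
have [r [t0 [xi [F [G [r0 BD oFB cFG chartP]]]]]] :=
  foliated_chart oD Dy0 (local_Qaff phi_Q (c := c)) (local_Ck phi_smooth ac)
    (fun a b y => flat_projN phi_smooth phi_Q EN_flat ac a b (y := y))
    (fun a b y Dy => local_lagrangian phi_smooth phi_Q ac a b Dy L)
    immersed PhiT Phi_inj symm.
have cF j := (cFG j).1; have cG j := (cFG j).2.
pose B := ball (row_mx y0 t0) r.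
have GF z : B z -> G (F z) = z by move=> /chartP[].
have DFP z : B z -> forall h, 'D_h F z *m projN (psi1 (lsubmx z)) = rsubmx h *m xi (lsubmx z).
  by move=> /chartP[].
have B0 : B (row_mx y0 t0) by exact: ballxx.
have xixi y : ball y0 r y -> xi y *m (xi y)^T = 1%:M.
  exact: (xi_orthonormal chartP (ballxx t0 r0)).
have PP y : ball y0 r y -> projN (psi1 y) *m projN (psi1 y) = projN (psi1 y).
  by move=> _; exact: projN_idem (phi_Q _).1.
have sP y : ball y0 r y -> (projN (psi1 y))^T = projN (psi1 y).
  by move=> _; exact: projN_tr.
exists (cdom c `&` cmap c @^-1` ball y0 r), (F @` B), (fun w => rsubmx (G w)); split.
- split; last by split=> //; exact: ballxx.
  have [oc _ _ cc _] := atlas_chart ac.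
  by apply: open_setI_preimage => //; exact: ball_open.
- by split=> //; exists (F (row_mx y0 t0)), (row_mx y0 t0).
- exact: (foliation_submersion oFB cF cG PP sP GF xixi DFP).
- by rewrite (foliation_image r0 GF); exact: ball_open.
rewrite (foliation_image r0 GF) => t Bt.
exact: (leaf_integral ac BD oFB cF cG chartP Bt).
Qed.

End Sufficiency.

Theorem corollary1 (R : realType) (n k : nat) (M : oriented_manifold R n)
    (phi : M -> affext R n (n + k))
    (phi_smooth : msmooth_on [set: M] phi)
    (phi_Q : forall x, Qaff (phi x))
    (phio_immersion : immersion_on [set: M] (@bpi R n (n + k) \o phi))
    (Phi_exists : exists Phi : M -> 'M[R]_(n, n + k),
       bundle_iso (@bpi R n (n + k) \o phi) Phi /\
       forall (x : M) (X Y : 'rV[R]_n),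
         (Y *m Phi x) *m hom_of_tangent (bpi (phi x))
                           (mdiff (@bpi R n (n + k) \o phi) x X)
         = (X *m Phi x) *m hom_of_tangent (bpi (phi x))
                             (mdiff (@bpi R n (n + k) \o phi) x Y))
    (EN_flat : flat_EN (@bpi R n (n + k) \o phi)) :
  locally_foliated phi <-> lagrangian phi.
Proof.
split=> [fol|L]; last exact: foliated_of_lagrangian.
apply: lagrangian_of_leaves => // x.
(* One leaf over a neighbourhood of each point suffices; the nonempty domain of the foliation
   provides it. *)
have [U [A [f [[oU Ux] [_ [w Aw]] _ _ leaf]]]] := fol x.
exists U, (A `&` f @^-1` [set f w]); split=> //.
by apply: leaf; exists w.
Qed.
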